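(* Let $(\Omega,\mathcal{F},\mu;(\mathcal{F}_i)_{i\in\mathbb{Z}})$ be a $\sigma$-finite filtered measure space, let $1<p<\infty$, let $v,\omega$ be weights, and let $\sigma:=\omega^{-\frac1{p-1}}\in\mathcal{L}^+$. Let $M$ be the Doob maximal operator. (1) If $(v,\omega)\in B_p$, then $$\|M\|_{L^p(\omega)\rightarrow L^p(v)}\lesssim[v,\omega]_{B_p}^{\frac1p}.$$ (2) If $(v,\omega)\in A_p$ and $\sigma\in A^*_{\infty}$, then $$\|M\|_{L^p(\omega)\rightarrow L^p(v)}\lesssim[v,\omega]_{A_p}^{\frac1p}\,[\sigma]_{A^*_{\infty}}^{\frac1p}.$$ (3) If $\omega\in A_p$, then $$\|M\|_{L^p(\omega)\rightarrow L^p(\omega)}\lesssim[\sigma]_{(A_{p'})^{\frac1{p'}}(A^*_{\infty})^{\frac1p}}\Big(1+\log_2[\omega]_{A_p}\Big)^{\frac1p}.$$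
   Context: A $\sigma$-finite filtered measure space $(\Omega,\mathcal{F},\mu;(\mathcal{F}_i)_{i\in\mathbb{Z}})$ consists of a measure space with sub-$\sigma$-algebras $\mathcal{F}_i\subset\mathcal{F}$, $i\in\mathbb{Z}$, such that $\mathcal{F}_i\subset\mathcal{F}_j$ for $i<j$; all measure spaces, including every $(\Omega,\mathcal{F}_i,\mu)$, are assumed $\sigma$-finite. $\mathcal{F}_i^0$ denotes the collection of sets in $\mathcal{F}_i$ of finite $\mu$-measure. $\mathcal{L}$ is the set of $\mathcal{F}$-measurable functions $f:\Omega\to\mathbb{R}$ such that $\chi_E f\in L^1(\mathcal{F},\mu)$ for all $E\in\mathcal{F}_i^0$ and all $i\in\mathbb{Z}$; $\mathcal{L}^+$ is the set of nonnegative functions in $\mathcal{L}$, called weights. For $f\in\mathcal{L}$, $\mathbb{E}_i(f)=\mathbb{E}(f|\mathcal{F}_i)$ is the conditional expectation: the a.e. unique $\mathcal{F}_i$-measurable function, integrable on every $G\in\mathcal{F}_i^0$, with $\int_G \mathbb{E}_i(f)\,d\mu=\int_G f\,d\mu$ for all $G\in\mathcal{F}_i^0$. For a weight $w$, $w(E)=\int_E w\,d\mu$ and $L^p(w)=L^p(\Omega,w\,d\mu)$. Doob maximal operator: $Mf=\sup_{i\in\mathbb{Z}}|\mathbb{E}_i(f)|$. Tailed Doob maximal operator: ${}^*M_i f=\sup_{j\geq i}|\mathbb{E}_j(f)|$ for $i\in\mathbb{Z}$. $\|M\|_{L^p(\omega)\to L^p(v)}$ is the smallest $C$ with $\|Mf\|_{L^p(v)}\leq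 C\|f\|_{L^p(\omega)}$ for all $f\in L^p(\omega)$. Weight conditions (with $\frac1p+\frac1{p'}=1$, so $\omega^{1-p'}=\sigma$; all inequalities $\mu$-a.e.): - $(v,\omega)\in A_p$: there is $C>0$ with $\sup_{j\in\mathbb{Z}}\mathbb{E}_j(v)\,\mathbb{E}_j(\omega^{1-p'})^{p/p'}\leq C$; the smallest $C$ is $[v,\omega]_{A_p}$. One writes $\omega\in A_p$ and $[\omega]_{A_p}$ for the case $v=\omega$. - $(v,\omega)\in B_p$: there is $C>0$ such that for all $i\in\mathbb{Z}$, $\mathbb{E}_i(v)\,\mathbb{E}_i(\sigma)^p\leq C\exp\big(\mathbb{E}_i(\log\sigma)\big)$; the smallest $C$ is $[v,\omega]_{B_p}$. (Since $\log^+\sigma\leq\sigma$, $\mathbb{E}_i(\log\sigma)$ is well defined in $[-\infty,\infty)$, with $\exp(-\infty)=0$.) - A weight $w$ satisfies $A^*_\infty$: there is $C>0$ such that for all $i\in\mathbb{Z}$ and $E\in\mathcal{F}_i^0$, $\int_E {}^*M_i(w\chi_E)\,d\mu\leq C\,w(E)$; the smallest $C$ is $[w]_{A^*_\infty}$. - Mixed constant: $$[\sigma]_{(A_{p'})^{\frac1{p'}}(A^*_{\infty})^{\frac1p}}:=\sup_{i\in\mathbb{Z},\,Q\in\mathcal{F}_i^0,\,\mu(Q)>0}\Bigg(\operatorname*{ess\,sup}_{Q}\Big(\mathbb{E}_i(\omega)\,\mathbb{E}_i(\sigma)^{p-1}\Big)\,\frac{\int_Q {}^*M_i(\sigma\chi_Q)\,d\mu}{\sigma(Q)}\Bigg)^{\frac1p}.$$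 The notation $A\lesssim B$ means $A\leq CB$ with a constant $C$ independent of the weights and weight constants (it may depend on $p$). *)

(* Defs.v *)
From HB Require Import structures.
From mathcomp Require Import all_boot all_order all_algebra.
From mathcomp Require Import all_classical all_reals all_analysis.
From mathcomp Require Import measurable_realfun ess_sup_inf.

Set Implicit Arguments.
Unset Strict Implicit.
Unset Printing Implicit Defensive.

Import Order.TTheory GRing.Theory Num.Theory.
Import numFieldNormedType.Exports.

Local Open Scope classical_set_scope.
Local Open Scope ring_scope.

Section filtered_measure_space.
Context {d : measure_display} {T : measurableType d} {R : realType}.
Variables (mu : {measure set T -> \bar R}) (F : int -> set (set T)).

Definition sigma_finite_filtration : Prop :=
  [/\ forall i, sigma_algebra [set: T] (F i),
      forall i, F i `<=` measurable,
      forall i j, i < j -> F i `<=` F j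
    & forall i, exists2 G : nat -> set T, \bigcup_n G n = [set: T] &
        forall n, F i (G n) /\ (mu (G n) < +oo)%E].

Definition F0 (i : int) : set (set T) := [set E | F i E /\ (mu E < +oo)%E].

(* [g_sigma_algebraType (F i)] is T equipped with the sigma-algebra <<s F i >>,
   which is F i itself as soon as F i is a sigma-algebra. *)
Definition adapted (i : int) (g : T -> R) : Prop :=
  @measurable_fun _ _ (g_sigma_algebraType (F i)) R [set: T] g.

Definition eadapted (i : int) (g : T -> \bar R) : Prop :=
  @measurable_fun _ _ (g_sigma_algebraType (F i)) (\bar R) [set: T] g.

Definition locally_integrable : set (T -> R) :=
  [set f | measurable_fun [set: T] f /\
     forall i E, F0 i E -> mu.-integrable E (EFin \o f)].

Definition weight : set (T -> R) :=
  [set w | locally_integrable w /\ forall x, 0 <= w x].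

Definition is_condexp (i : int) (f g : T -> R) : Prop :=
  adapted i g /\ forall G, F0 i G ->
    mu.-integrable G (EFin \o g) /\
    (\int[mu]_(x in G) (g x)%:E = \int[mu]_(x in G) (f x)%:E)%E.

(* A version of E(f | F_i); it is unique up to a mu-negligible set, and all the
   notions below are insensitive to the version.  The default value is irrelevant
   when f is locally integrable. *)
Definition condexp (i : int) (f : T -> R) : T -> R :=
  xget (cst 0) [set g | is_condexp i f g].

(* Conditional expectation with values in [-oo, +oo[, for measurable functions f
   whose positive part is locally integrable; the negative part may have infinite
   integral, in which case both integrals are -oo. *)
Definition is_econdexp (i : int) (f : T -> R) (g : T -> \bar R) : Prop :=
  eadapted i g /\ forall G, F0 i G ->
    (\int[mu]_(x in G) (g^\+ x) < +oo)%E /\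
    (\int[mu]_(x in G) g x = \int[mu]_(x in G) (f x)%:E)%E.

Definition econdexp (i : int) (f : T -> R) : T -> \bar R :=
  xget (cst -oo%E) [set g | is_econdexp i f g].

Definition doob (f : T -> R) : T -> \bar R :=
  fun x => ereal_sup [set (`|condexp i f x|)%:E | i in [set: int]].

Definition tailed_doob (i : int) (f : T -> R) : T -> \bar R :=
  fun x => ereal_sup [set (`|condexp j f x|)%:E | j in [set j | i <= j]].

(* The norm of L^p(w dmu). *)
Definition wnorm (p : R) (w : T -> R) (g : T -> \bar R) : \bar R :=
  ((\int[mu]_x (`|g x| `^ p * (w x)%:E)) `^ p^-1)%E.

Definition Lp (p : R) (w : T -> R) : set (T -> R) :=
  [set f | measurable_fun [set: T] f /\ (wnorm p w (EFin \o f) < +oo)%E].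

(* The norm of an operator from L^p(w) to L^p(v); +oo if it is unbounded. *)
Definition opnorm (p : R) (w v : T -> R) (N : (T -> R) -> T -> \bar R) : \bar R :=
  ereal_inf [set C%:E | C in [set C : R | 0 <= C /\
    forall f, Lp p w f ->
      (wnorm p v (N f) <= C%:E * wnorm p w (EFin \o f))%E]].

Definition mass (w : T -> R) (E : set T) : \bar R :=
  (\int[mu]_(x in E) (w x)%:E)%E.

(* w^(- 1 / (p - 1)) = w^(1 - p').  Pitfall: powR gives 0 instead of +oo at the
   zeros of w, so this must only be used when w > 0 almost everywhere. *)
Definition dual_weight (p : R) (w : T -> R) : T -> R :=
  fun x => w x `^ (- (p - 1)^-1).

Definition conj_exponent (p : R) : R := p / (p - 1).

Definition Ap_bound (p : R) (v w : T -> R) : set R :=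
  [set C | 0 < C /\ {ae mu, forall x,
    (ereal_sup [set (condexp j v x *
        condexp j (dual_weight p w) x `^ (p / conj_exponent p))%:E
      | j in [set: int]] <= C%:E)%E}].

Definition Ap (p : R) (v w : T -> R) : Prop := exists C, Ap_bound p v w C.

Definition Ap_const (p : R) (v w : T -> R) : \bar R :=
  ereal_inf [set C%:E | C in Ap_bound p v w].

Definition Bp_bound (p : R) (v w : T -> R) : set R :=
  [set C | 0 < C /\ forall i, {ae mu, forall x,
    ((condexp i v x * condexp i (dual_weight p w) x `^ p)%:E <=
      C%:E * expeR (econdexp i (fun y => ln (dual_weight p w y)) x))%E}].

Definition Bp (p : R) (v w : T -> R) : Prop := exists C, Bp_bound p v w C.

Definition Bp_const (p : R) (v w : T -> R) : \bar R :=
  ereal_inf [set C%:E | C in Bp_bound p v w].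

Definition Ainfty_bound (w : T -> R) : set R :=
  [set C | 0 < C /\ forall i E, F0 i E ->
    (\int[mu]_(x in E) tailed_doob i (w \* \1_E)%R x <= C%:E * mass w E)%E].

Definition Ainfty (w : T -> R) : Prop := exists C, Ainfty_bound w C.

Definition Ainfty_const (w : T -> R) : \bar R :=
  ereal_inf [set C%:E | C in Ainfty_bound w].

(* The function inside ess_sup is a.e. nonnegative, so that extending it by 0
   outside Q gives the essential supremum over Q.  The supremum is that of
   [0, +oo]: the singleton 0 only matters when mu = 0, i.e., when no Q exists. *)
Definition mixed_const (p : R) (w : T -> R) : \bar R :=
  let s := dual_weight p w in
  ereal_sup ([set 0%E] `|`
    [set y : \bar R | exists i Q, [/\ F0 i Q, (0 < mu Q)%E & y =
      ((ess_sup mu (fun x =>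
            (condexp i w x * condexp i s x `^ (p - 1) * \1_Q x)%:E) *
         ((\int[mu]_(x in Q) tailed_doob i (s \* \1_Q)%R x) / mass s Q))
       `^ p^-1)%E]]).

End filtered_measure_space.

Definition log2 {R : realType} (x : R) : R := ln x / ln 2.

(* Main.v *)
Require Import Defs.
From HB Require Import structures.
From mathcomp Require Import all_boot all_order all_algebra.
From mathcomp Require Import all_classical all_reals all_analysis.
From mathcomp Require Import measurable_realfun ess_sup_inf.
From mathcomp Require Import ring lra.

(** Let f be in L^p(omega), put g = |f| / sigma, so that the integral of
    g^p sigma is that of |f|^p omega, and look at the filtration between the
    times -N and N only, renumbered from 0 to M = 2N. Write X_n, S_n, V_n for the conditional expectations
    of g sigma, sigma and v, m_n for the running maximum of X_0, ..., X_n, and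
    F_n = X_n / S_n for the conditional mean of g with respect to the measure
    sigma mu. It is enough to bound the integral of (m_M)^p v by a constant
    times the integral of g^p sigma, with a constant that does not depend on
    the horizon; monotone convergence does the rest ([doob_integral_le]).

    Instead of stopping times or principal sets, the proof telescopes
    (m_M)^p and conditions every increment. An increment of m at time n lives
    where m_n = X_n, so that the integral of (m_M)^p v is at most p times the
    sum over n of the integrals of c_n X_n^p V_n, where c_n is the relative
    jump (m_n - m_(n-1)) / m_n ([maximal_le_relative_jump_sum]). The relative
    jumps play the part of a sparse family: for adapted H_n >= 0, the sum of
    the integrals of c_n H_n is at most twice the integral of sup_n H_n
    ([sparse_sum]). Indeed at a new maximum the conditional expectation of
    1 / m_M given the past is at least 1 / (2 m_n), because a nonnegative
    martingale is unlikely to grow much further, so that c_n may be replaced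
    by 2 (m_n - m_(n-1)) / m_M; and these add up to at most 2.

    Since X_n^p V_n = F_n^p S_n^p V_n, what remains is to dominate
    S_n^p V_n, and to integrate the supremum of the resulting H_n.

    For B_p, Jensen's inequality gives S_n^p V_n <= C Y_n^2 where Y_n is the
    conditional expectation of sigma^(1/2) ([expectation_log_le]), and
    F_n^(p/2) Y_n is at most the conditional expectation of
    u = sigma^(1/2) (sup_k F_k)^(p/2). Doob's inequality in L^2(mu) for u, then
    in L^p(sigma mu) for g, conclude ([maximal_geometric_bound]). Both are
    instances of one weighted inequality, [doob_weighted].

    For A_p, S_n^p V_n <= C S_n. With h_n the running maximum of F, one has
    F_n^p S_n <= h_n^p S_n, and summing the increments of h^p shows that this
    is at most the sum over k <= n of (h_k^p - h_(k-1)^p) sup_(j >= k) S_j.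
    The A*_infinity condition trades sup_(j >= k) S_j for sigma against
    F_k-measurable weights, and the sum collapses to the integral of h_M^p
    sigma ([tail_domination]).

    For the mixed constant, the product S_n^(p-1) V_n takes values between 1
    and the A_p constant. Splitting according to the dyadic levels 2^l below
    it, on the part where it is at least 2^l the mixed constant m controls the
    tails with the constant m^p / 2^l; this factor cancels the size 2^(l+1) of
    the product, and there are at most 1 + log_2 of the A_p constant levels
    ([maximal_tail_bound], [opnorm_le_mixed]). *)

Set Implicit Arguments.
Unset Strict Implicit.

Import Order.TTheory GRing.Theory Num.Theory.
Import numFieldNormedType.Exports.

Local Open Scope classical_set_scope.
Local Open Scope ring_scope.

(** * Measurability with respect to a sub-sigma-algebra *)

Section submeasurable.
Context {d : measure_display} {T : measurableType d} {R : realType}.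
Implicit Types (A : set (set T)) (f g : T -> R).

(** The type [g_sigma_algebraType A] shares its carrier with [T], so that the
    measurability of real functions with respect to a sub-sigma-algebra is
    that of functions on [T] seen through this alias. *)
Definition measurable_for A f :=
  @measurable_fun _ _ (g_sigma_algebraType A) R [set: T] f.

Lemma measurable_for_cst A c : measurable_for A (cst c).
Proof. exact: measurable_cst. Qed.

Lemma measurable_forD A f g : measurable_for A f -> measurable_for A g ->
  measurable_for A (fun x => f x + g x).
Proof. exact: measurable_funD. Qed.

Lemma measurable_forB A f g : measurable_for A f -> measurable_for A g ->
  measurable_for A (fun x => f x - g x).
Proof. exact: measurable_funB. Qed.

Lemma measurable_forM A f g : measurable_for A f -> measurable_for A g ->
  measurable_for A (fun x => f x * g x).
Proof. exact: measurable_funM. Qed.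

Lemma measurable_for_max A f g : measurable_for A f -> measurable_for A g ->
  measurable_for A (fun x => Num.max (f x) (g x)).
Proof. exact: measurable_maxr. Qed.

Lemma measurable_for_min A f g : measurable_for A f -> measurable_for A g ->
  measurable_for A (fun x => Num.min (f x) (g x)).
Proof. exact: measurable_minr. Qed.

Lemma measurable_for_powR A f q : measurable_for A f ->
  measurable_for A (fun x => f x `^ q).
Proof.
by move=> mf; apply: (measurableT_comp (measurable_powR q) mf).
Qed.

Lemma measurable_forV A f : (forall x, 0 <= f x) -> measurable_for A f ->
  measurable_for A (fun x => (f x)^-1).
Proof.
move=> f0 mf; rewrite (_ : (fun x => _) = (fun x => f x `^ (-1))).
  exact: measurable_for_powR.
by apply/funext => x; rewrite powR_inv1.
Qed.

Lemma measurable_for_indic A (Q : set T) : <<s A >> Q ->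
  measurable_for A (\1_Q : T -> R).
Proof. by move=> AQ; apply: measurable_indic. Qed.

Lemma generated_setI A (P Q : set T) :
  <<s A >> P -> <<s A >> Q -> <<s A >> (P `&` Q).
Proof.
by move=> AP AQ; exact: (@measurableI _ (g_sigma_algebraType A) P Q AP AQ).
Qed.

Lemma measurable_for_le A f g : measurable_for A f -> measurable_for A g ->
  <<s A >> [set x | f x <= g x].
Proof.
move=> mf mg; have := measurable_fun_ler mf mg measurableT (Y := [set true]) I.
by rewrite setTI.
Qed.

Lemma measurable_for_lt A f g : measurable_for A f -> measurable_for A g ->
  <<s A >> [set x | f x < g x].
Proof.
move=> mf mg; have := measurable_fun_ltr mf mg measurableT (Y := [set true]) I.
by rewrite setTI.
Qed.

Lemma generatedS A B : A `<=` B -> <<s A >> `<=` <<s B >>.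
Proof. by move=> AB; apply: sub_smallest2r; first exact: smallest_sigma_algebra. Qed.

Lemma measurable_forS A B f : A `<=` B -> measurable_for A f ->
  measurable_for B f.
Proof.
move=> AB mf _ Y mY; have := mf measurableT Y mY.
exact: generatedS.
Qed.

Lemma generated_measurable A : A `<=` measurable -> <<s A >> `<=` measurable.
Proof.
by move=> AT; apply: smallest_sub => //; exact: sigma_algebra_measurable.
Qed.

Lemma measurable_for_measurable A f : A `<=` measurable -> measurable_for A f ->
  measurable_fun [set: T] f.
Proof.
move=> AT mf _ Y mY; have /(generated_measurable AT) := mf measurableT Y mY.
exact.
Qed.

End submeasurable.

Section test_functions.
Context {d : measure_display} {T : measurableType d} {R : realType}.
Variable mu : {measure set T -> \bar R}.
Import HBNNSimple.
Implicit Types (A : set (set T)) (u w : T -> R).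

(** The form in which sigma-finiteness of mu on A is used: the sets increase,
    so that integrals over them converge to integrals over the space. *)
Definition exhausting A (G : nat -> set T) :=
  [/\ forall k, <<s A >> (G k), forall k, (mu (G k) < +oo)%E,
      nondecreasing_seq G & \bigcup_k G k = [set: T]].

Lemma le_integral_exhausting A G u w : A `<=` measurable -> exhausting A G ->
  measurable_fun [set: T] u -> measurable_fun [set: T] w ->
  (forall x, 0 <= u x) -> (forall x, 0 <= w x) ->
  (forall Q, <<s A >> Q -> (mu Q < +oo)%E ->
     (\int[mu]_(x in Q) (u x)%:E <= \int[mu]_(x in Q) (w x)%:E)%E) ->
  forall Q, <<s A >> Q ->
     (\int[mu]_(x in Q) (u x)%:E <= \int[mu]_(x in Q) (w x)%:E)%E.
Proof.
move=> AT [AG Gfin ndG GT] mu_ mw u0 w0 uw Q AQ.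
have mQ := generated_measurable AT AQ.
have mG k := generated_measurable AT (AG k).
have AQG k : <<s A >> (Q `&` G k).
  exact: generated_setI.
have ndQG : nondecreasing_seq (fun k => Q `&` G k).
  move=> m n mn; apply/subsetPset; apply: setIS; apply/subsetPset.
  exact: ndG.
have QE : Q = \bigcup_k (Q `&` G k) by rewrite -setI_bigcupr GT setIT.
have cvgI (f : T -> R) : measurable_fun [set: T] f -> (forall x, 0 <= f x) ->
    (\int[mu]_(x in Q `&` G k) (f x)%:E)%E @[k --> \oo] -->
    (\int[mu]_(x in Q) (f x)%:E)%E.
  move=> mf f0; rewrite {2}QE.
  apply: ge0_nondecreasing_set_cvg_integral => //.
  - by move=> k; exact: measurableI.
  - move=> k; apply: measurable_funTS; exact/measurable_EFinP.
  - by move=> k x _; rewrite lee_fin.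
have := cvgI _ mu_ u0; have := cvgI _ mw w0 => cw cu.
rewrite -(cvg_lim _ cu)// -(cvg_lim _ cw)//.
apply: lee_lim; [by apply/cvg_ex; eexists; exact: cu|
  by apply/cvg_ex; eexists; exact: cw|].
near=> k; apply: uw => //.
apply: le_lt_trans (Gfin k); apply: le_measure; rewrite ?inE//.
exact: measurableI.
Unshelve. all: by end_near.
Qed.

(** Stated for a bare function with its decomposition into level sets, not for
    a simple function: the simple functions to which it applies are simple for
    the sub-sigma-algebra, while the integral is taken on the full space. *)
Lemma integral_mul_fimfun (phi f : T -> R) :
  measurable_fun [set: T] phi -> (forall x, 0 <= phi x) ->
  finite_set (range phi) ->
  (forall x, phi x = \sum_(y \in range phi) y * \1_(phi @^-1` [set y]) x) ->
  measurable_fun [set: T] f -> (forall x, 0 <= f x) ->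
  (\int[mu]_x (phi x * f x)%:E = \sum_(y \in range phi)
     y%:E * \int[mu]_(x in phi @^-1` [set y]) (f x)%:E)%E.
Proof.
move=> mphi phi0 finphi phiE mf f0.
have mphiy y : measurable (phi @^-1` [set y]).
  by rewrite -[X in measurable X]setTI; exact: mphi.
have mi y : measurable_fun [set: T] (fun x => \1_(phi @^-1` [set y]) x * f x).
  by apply: measurable_funM => //; exact: measurable_indic.
transitivity (\int[mu]_x (\sum_(y \in range phi)
   (y * (\1_(phi @^-1` [set y]) x * f x))%:E)%E)%E.
  apply: eq_integral => x _; rewrite fsumEFin//; congr EFin.
  rewrite {1}phiE mulr_fsuml.
  by apply: eq_fsbigr => y _; rewrite mulrA.
rewrite ge0_integral_fsum//; last 2 first.
- by move=> y; apply/measurable_EFinP; exact: measurable_funM.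
- move=> y x _; rewrite lee_fin indicE; case: (boolP (x \in _)).
    by rewrite inE => <-; rewrite !mulr_ge0.
  by rewrite mul0r mulr0.
apply: eq_fsbigr => y; rewrite inE => -[t _ <-].
under eq_integral do rewrite EFinM.
rewrite ge0_integralZl//; last 3 first.
- exact/measurable_EFinP.
- by move=> x _; rewrite lee_fin mulr_ge0.
- by rewrite lee_fin.
congr (_ * _)%E; rewrite [RHS]integral_mkcond; apply: eq_integral => x _.
by rewrite patchE indicE; case: ifPn => _; rewrite (mul1r, mul0r).
Qed.

(** Testing on sets is testing on functions, by approximating psi from below
    by simple functions. This turns the set-wise definitions (conditional
    expectation, A*_infinity, the mixed constant) into inequalities that can
    be applied to adapted weights. *)
Lemma le_integral_test A u w psi : A `<=` measurable ->
  measurable_fun [set: T] u -> measurable_fun [set: T] w ->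
  (forall x, 0 <= u x) -> (forall x, 0 <= w x) ->
  (forall Q, <<s A >> Q ->
     (\int[mu]_(x in Q) (u x)%:E <= \int[mu]_(x in Q) (w x)%:E)%E) ->
  measurable_for A psi -> (forall x, 0 <= psi x) ->
  (\int[mu]_x (psi x * u x)%:E <= \int[mu]_x (psi x * w x)%:E)%E.
Proof.
move=> AT mu_ mw u0 w0 uw mpsi psi0.
have mpsiE : measurable_fun [set: g_sigma_algebraType A] (EFin \o psi).
  exact/measurable_EFinP.
pose h := nnsfun_approx (@measurableT _ (g_sigma_algebraType A)) mpsiE.
have h0 n x : 0 <= h n x by [].
have mh n : measurable_fun [set: T] (h n : T -> R).
  by apply: (measurable_for_measurable AT); exact: measurable_funP.
have cvgI (f : T -> R) : measurable_fun [set: T] f -> (forall x, 0 <= f x) ->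
    (\int[mu]_x (h n x * f x)%:E)%E @[n --> \oo] -->
    (\int[mu]_x (psi x * f x)%:E)%E.
  move=> mf f0.
  rewrite [X in _ --> X](_ : _ =
      (\int[mu]_x (limn (fun n => (h n x * f x)%:E)))%E); last first.
    apply: eq_integral => x _; apply/esym/cvg_lim => //.
    rewrite EFinM; under eq_fun do rewrite EFinM.
    apply: cvgeZr => //; apply: (@cvg_nnsfun_approx _ _ _ _ _ _ mpsiE) => //.
    by move=> y _; rewrite lee_fin.
  apply: cvg_monotone_convergence => //.
  - by move=> n; apply/measurable_EFinP; exact: measurable_funM.
  - by move=> n x _; rewrite lee_fin mulr_ge0.
  - move=> x _ m n mn; rewrite lee_fin ler_wpM2r//.
    by move: (nd_nnsfun_approx measurableT mpsiE mn) => /lefP; apply.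
have cu := cvgI _ mu_ u0; have cw := cvgI _ mw w0.
rewrite -(cvg_lim _ cu)// -(cvg_lim _ cw)//.
apply: lee_lim; [by apply/cvg_ex; eexists; exact: cu|
  by apply/cvg_ex; eexists; exact: cw|].
near=> n.
have hE := integral_mul_fimfun (mh n) (h0 n) (fimfunP (h n)) (fimfunE (h n)).
rewrite !hE//; apply: lee_fsum => [|y [t _ <-]]; first exact: (fimfunP (h n)).
rewrite lee_wpmul2l ?lee_fin//; apply: uw.
exact: (measurable_funPTI (h n) (measurable_set1 (h n t))).
Unshelve. all: by end_near.
Qed.

End test_functions.

(** * Conditional expectations of nonnegative functions *)

Section conditional_expectation.
Context {d : measure_display} {T : measurableType d} {R : realType}.
Variable mu : {measure set T -> \bar R}.
Implicit Types (A : set (set T)) (u w : T -> R).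

(** The source of all almost everywhere statements below: a set on which one
    function exceeds another is null as soon as the integrals over it are
    ordered the other way. *)
Lemma positive_integral_null (D : set T) (f : T -> \bar R) :
  measurable D -> measurable_fun D f -> (forall x, D x -> (0 < f x)%E) ->
  (\int[mu]_(x in D) f x <= 0)%E -> mu D = 0%E.
Proof.
move=> mD mf f0 If.
have I0 : (\int[mu]_(x in D) `|f x| = 0)%E.
  apply/eqP; rewrite eq_le integral_ge0 ?andbT//.
  rewrite (_ : (\int[mu]_(x in D) _ = \int[mu]_(x in D) f x)%E)//.
  by apply: eq_integral => x; rewrite inE => /f0 /ltW /gee0_abs.
have /(ae_eq_integral_abs mu mD mf) [N [mN N0 subN]] := I0.
apply/(negligibleP mu mD); exists N; split=> //.
by apply: subset_trans subN => x Dx /= /(_ Dx) fx0; have := f0 _ Dx; rewrite fx0 ltxx.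
Qed.

(** X is a version of the conditional expectation of u >= 0 given the
    sigma-algebra generated by A. Demanding the identity for every nonnegative
    measurable psi includes the rule that known factors can be taken out,
    and avoids all integrability assumptions. *)
Definition nonneg_condexp A u X := [/\ measurable_for A X, forall x, 0 <= X x &
  forall psi, measurable_for A psi -> (forall x, 0 <= psi x) ->
  (\int[mu]_x (psi x * X x)%:E = \int[mu]_x (psi x * u x)%:E)%E].

Lemma nonneg_condexp_of_sets A G u X : A `<=` measurable -> exhausting mu A G ->
  measurable_fun [set: T] u -> (forall x, 0 <= u x) ->
  measurable_for A X -> (forall x, 0 <= X x) ->
  (forall Q, <<s A >> Q -> (mu Q < +oo)%E ->
     (\int[mu]_(x in Q) (X x)%:E = \int[mu]_(x in Q) (u x)%:E)%E) ->
  nonneg_condexp A u X.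
Proof.
move=> AT exG mu_ u0 mX X0 Xu; split=> // psi mpsi psi0.
have mXT := measurable_for_measurable AT mX.
apply/eqP; rewrite eq_le; apply/andP; split; apply: (le_integral_test AT) => //;
  by apply: (le_integral_exhausting AT exG) => // Q AQ finQ; rewrite Xu.
Qed.

(** The exceptional set is cut into pieces of finite measure on which V is
    bounded, where the integral of V is finite and can be subtracted. *)
Lemma ae_le_of_sets A G U V : A `<=` measurable -> exhausting mu A G ->
  measurable_for A U -> measurable_for A V -> (forall x, 0 <= U x) -> (forall x, 0 <= V x) ->
  (forall Q, <<s A >> Q -> (mu Q < +oo)%E ->
     (\int[mu]_(x in Q) (U x)%:E <= \int[mu]_(x in Q) (V x)%:E)%E) ->
  {ae mu, forall x, U x <= V x}.
Proof.
move=> AT [AG Gfin ndG GT] mU mV U0 V0 UV.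
have mUT := measurable_for_measurable AT mU; have mVT := measurable_for_measurable AT mV.
pose D k := [set x | V x < U x] `&` (G k `&` [set x | V x <= k%:R]).
have AD k : <<s A >> (D k).
  apply: generated_setI; first exact: measurable_for_lt.
  by apply: generated_setI => //; apply: measurable_for_le => //; exact: measurable_for_cst.
have mD k := generated_measurable AT (AD k).
have mG k := generated_measurable AT (AG k).
have finD k : (mu (D k) < +oo)%E.
  apply: le_lt_trans (Gfin k); apply: le_measure; rewrite ?inE//.
  by move=> x [_ []].
have muD k : mu (D k) = 0%E.
  apply: (@positive_integral_null _ (fun x => (U x - V x)%:E)) => //.
  - apply/measurable_EFinP; apply: measurable_funTS; exact: measurable_funB.
  - by move=> x [/= + _]; rewrite lte_fin subr_gt0.
  have IV : (\int[mu]_(x in D k) (V x)%:E < +oo)%E.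
    apply: (@le_lt_trans _ _ (\int[mu]_(x in D k) (k%:R)%:E)%E).
      apply: ge0_le_integral => //.
      - by move=> x _; rewrite lee_fin.
      - by apply/measurable_EFinP; apply: measurable_funTS.
      - by move=> x [_ [_ /=]]; rewrite lee_fin.
    by rewrite integral_cst// lte_mul_pinfty ?lee_fin.
  have mUV : measurable_fun [set: T] (fun x => U x - V x).
    exact: measurable_funB.
  have := UV _ (AD k) (finD k).
  rewrite [X in (X <= _)%E](_ : _ = (\int[mu]_(x in D k) (V x)%:E +
      \int[mu]_(x in D k) (U x - V x)%:E)%E).
    by rewrite -[leRHS]adde0 leeD2lE// ge0_fin_numE// integral_ge0// => x _; rewrite lee_fin.
  rewrite -ge0_integralD//.
  - by apply: eq_integral => x _; rewrite -EFinD; congr EFin; ring.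
  - by move=> x _; rewrite lee_fin.
  - by apply/measurable_EFinP; apply: measurable_funTS.
  - by move=> x [/= + _]; rewrite lee_fin subr_ge0 => /ltW.
  - by apply/measurable_EFinP; apply: measurable_funTS.
have [N [mN N0 subN]] : mu.-negligible (\bigcup_k D k).
  by apply: negligible_bigcup => k; apply/(negligibleP mu (mD k)); exact: muD.
exists N; split=> //; apply: subset_trans subN => x /= /negP; rewrite -ltNge => VU.
have [k Gk] : exists k, G k x by have : [set: T] x by []; rewrite -GT => -[k _]; exists k.
pose n := maxn k (Num.trunc (V x)).+1.
exists n => //; split=> //; split.
  by have /subsetPset := ndG k n (leq_maxl _ _); apply.
apply: ltW; apply: lt_le_trans (truncnS_gt _) _.
by rewrite ler_nat leq_maxr.
Qed.

(** Radon-Nikodym on the sub-sigma-algebra: the measure u mu restricted to D is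
    finite and dominated by the restriction of mu, which is sigma-finite by
    exhaustion. *)
Lemma density_on A G (D : set T) u : A `<=` measurable -> exhausting mu A G ->
  <<s A >> D -> measurable_fun [set: T] u -> (forall x, 0 <= u x) ->
  (\int[mu]_(x in D) (u x)%:E < +oo)%E ->
  exists X, [/\ measurable_for A X, forall x, 0 <= X x & forall Q, <<s A >> Q ->
    (\int[mu]_(x in Q) (X x)%:E = \int[mu]_(x in Q `&` D) (u x)%:E)%E].
Proof.
move=> AT [AG Gfin ndG GT] AD mu_ u0 finD.
have mD := generated_measurable AT AD.
pose TA := g_sigma_algebraType A.
have midA : @measurable_fun _ _ T TA [set: T] (fun x => x).
  by move=> _ Y AY; rewrite setTI; exact: generated_measurable AY.
pose m0 : set TA -> \bar R := @pushforward _ _ T TA R mu (fun x => x).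
have m00 : m0 set0 = 0%E by exact: (measure0 mu).
have m0ge Q : (0 <= m0 Q)%E by exact: (measure_ge0 mu (Q : set T)).
have AmT (Q : set TA) : measurable Q -> d.-measurable (Q : set T).
  exact: generated_measurable.
have m0s : semi_sigma_additive m0.
  move=> F mF tF mUF; apply: (@measure_semi_sigma_additive _ _ _ mu) => //.
  - by move=> k; exact: (AmT _ (mF k)).
  - exact: (AmT _ mUF).
pose H0 := isMeasure.Build _ TA R m0 m00 m0ge m0s.
pose mA0 := HB.pack_for (measure TA R) m0 H0.
have sf : sigma_finite [set: TA] mA0.
  by exists G => // k; split; [exact: AG | exact: Gfin].
pose H1 := isSFinite.Build _ _ _ _ (sfinite_measure_sigma_finite sf).
pose H2 := isSigmaFinite.Build _ _ _ _ sf.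
pose mA := HB.pack_for (sigma_finite_measure TA R)
  (Measure.sort mA0) H1 H2.
pose phi : T -> \bar R := fun x => (u x * \1_D x)%:E.
have phi0 x : (0 <= phi x)%E by rewrite lee_fin mulr_ge0.
have mphi : measurable_fun [set: T] phi.
  by apply/measurable_EFinP; apply: measurable_funM.
have phiE Q : measurable Q -> (\int[mu]_(x in Q) phi x =
    \int[mu]_(x in Q `&` D) (u x)%:E)%E.
  move=> mQ; rewrite [RHS]integral_mkcondr; apply: eq_integral => x _.
  by rewrite patchE /phi indicE; case: ifPn; rewrite ?(mulr1, mulr0).
pose n0 : set TA -> \bar R := fun Q => (\int[mu]_(x in Q) phi x)%E.
have n00 : n0 set0 = 0%E by rewrite /n0 integral_set0.
have n0ge Q : (0 <= n0 Q)%E by apply: integral_ge0.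
have n0s : semi_sigma_additive n0.
  move=> F mF tF mUF.
  exact: (@semi_sigma_additive_nng_induced _ T R mu phi mphi phi0 F
    (fun k => AmT _ (mF k)) tF (AmT _ mUF)).
pose K0 := isMeasure.Build _ TA R n0 n00 n0ge n0s.
pose nA0 := HB.pack_for (measure TA R) n0 K0.
have fn : fin_num_fun nA0.
  move=> Q /AmT mQ; rewrite ge0_fin_numE// /nA0/= /n0 phiE//.
  apply: le_lt_trans finD; apply: ge0_subset_integral => //.
  - exact: measurableI.
  - by apply/measurable_EFinP; apply: measurable_funTS.
  - by move=> x _; rewrite lee_fin.
have sfn : sigma_finite [set: TA] nA0.
  by apply: fin_num_fun_sigma_finite => //; rewrite measure0.
pose K1 := isSFinite.Build _ _ _ _ (sfinite_measure_sigma_finite sfn).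
pose K2 := isSigmaFinite.Build _ _ _ _ sfn.
pose K3 := isFinite.Build _ _ _ _ fn.
pose nA := HB.pack_for (FiniteMeasure.type TA R) (Measure.sort nA0) K1 K2 K3.
have dom : nA `<< mA.
  move=> N nullN P mP PN; have := nullN P mP PN; rewrite /nA/= /n0 => muP.
  by apply: null_set_integral => //; [exact: AmT|exact: measurable_funTS].
have [X [X0 Xfin intX XE]] := radon_nikodym_sigma_finite dom.
have mX : measurable_fun [set: TA] X by exact: measurable_int intX.
exists (fun x => fine (X x)); split.
- exact: measurableT_comp.
- by move=> x; rewrite fine_ge0.
- move=> Q AQ; have mQ := AmT _ AQ; rewrite -phiE//.
  have := XE _ AQ; rewrite {1}/nA/= {1}/n0 => ->.
  transitivity (\int[mu]_(x in Q) X x)%E.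
    by apply: eq_integral => x _; rewrite fineK.
  rewrite -(@ge0_integral_pushforward _ _ T TA R _ midA mu Q X)//.
  exact: measurable_funTS.
Qed.

(** The measure u mu is only sigma-finite on A, so densities are taken on the
    disjoint pieces of the exhaustion and glued. *)
Lemma nonneg_condexp_exists A G u : A `<=` measurable -> exhausting mu A G ->
  measurable_fun [set: T] u -> (forall x, 0 <= u x) ->
  (forall k, (\int[mu]_(x in G k) (u x)%:E < +oo)%E) ->
  exists X, nonneg_condexp A u X.
Proof.
move=> AT exG mu_ u0 finG; have [AG Gfin ndG GT] := exG.
pose D := seqDU G.
have AD k : <<s A >> (D k).
  apply: (@measurableD _ (g_sigma_algebraType A)); first exact: AG.
  by apply: (@bigsetU_measurable _ (g_sigma_algebraType A)) => i _; exact: AG.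
have mD k := generated_measurable AT (AD k).
have mG k := generated_measurable AT (AG k).
have finD k : (\int[mu]_(x in D k) (u x)%:E < +oo)%E.
  apply: le_lt_trans (finG k); apply: ge0_subset_integral => //.
  - by apply/measurable_EFinP; apply: measurable_funTS.
  - by move=> x _; rewrite lee_fin.
  - exact: subset_seqDU.
have /choice[Y YP] : forall k, exists X, [/\ measurable_for A X, forall x, 0 <= X x &
    forall Q, <<s A >> Q ->
    (\int[mu]_(x in Q) (X x)%:E = \int[mu]_(x in Q `&` D k) (u x)%:E)%E].
  by move=> k; apply: (density_on AT exG).
have DT : \bigcup_k D k = [set: T] by rewrite -seqDU_bigcup_eq.
have /choice[k_ Dk_] : forall x, exists k, D k x.
  by move=> x; have : [set: T] x by []; rewrite -DT => -[k _]; exists k.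
have tD : trivIset [set: nat] D := trivIset_seqDU _.
have k_E k x : D k x -> k_ x = k.
  move=> Dkx; apply: contrapT => /eqP neq.
  move/trivIsetP : tD => /(_ _ _ I I neq) /seteqP[/(_ x) + _].
  by apply; split.
pose X x := Y (k_ x) x.
have X0 x : 0 <= X x by rewrite /X; have [] := YP (k_ x).
have mX : measurable_for A X.
  rewrite /measurable_for -DT; apply/(@measurable_fun_bigcup _ _ (g_sigma_algebraType A)).
    by move=> k; exact: AD.
  move=> k; apply: (@eq_measurable_fun _ _ (g_sigma_algebraType A) _ _ (Y k)).
    by move=> x; rewrite inE => /k_E kE; rewrite /X kE.
  have [mY _ _] := YP k.
  by apply: (@measurable_funS _ _ (g_sigma_algebraType A) _ setT).
exists X; apply: (nonneg_condexp_of_sets AT exG) => // Q AQ _.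
have mQ := generated_measurable AT AQ.
have QE : Q = \bigcup_k (Q `&` D k) by rewrite -setI_bigcupr DT setIT.
have tQD : trivIset [set: nat] (fun k => Q `&` D k).
  by apply: trivIset_setIl.
have IE (f : T -> R) : measurable_fun [set: T] f -> (forall x, 0 <= f x) ->
  (\int[mu]_(x in Q) (f x)%:E =
    \sum_(k <oo) \int[mu]_(x in Q `&` D k) (f x)%:E)%E.
  move=> mf f0; rewrite {1}QE ge0_integral_bigcup//.
  - by move=> k; exact: measurableI.
  - by apply/measurable_EFinP; apply: measurable_funTS.
  - by move=> x _; rewrite lee_fin.
have mXT := measurable_for_measurable AT mX.
rewrite IE// [RHS]IE//; apply: eq_eseriesr => k _.
have [_ _ YE] := YP k.
transitivity (\int[mu]_(x in Q `&` D k) (Y k x)%:E)%E.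
  by apply: eq_integral => x; rewrite inE => -[_ /k_E kE]; rewrite /X kE.
have AQD : <<s A >> (Q `&` D k) by exact: generated_setI.
by rewrite YE// -setIA setIid.
Qed.

End conditional_expectation.

(** * Power inequalities and running maxima *)

Section power_inequalities.
Context {R : realType}.
Implicit Types (a b x y m p : R).

Lemma le_powR r a b : 0 <= r -> 0 <= a -> a <= b -> a `^ r <= b `^ r.
Proof.
by move=> r0 a0 ab; apply: ge0_ler_powR; rewrite ?nnegrE// (le_trans a0).
Qed.

(** Young's inequality for the exponents p / (p - 1) and p, cleared of
    denominators. *)
Lemma young_powR p a b : 1 < p -> 0 <= a -> 0 <= b ->
  p * (a `^ (p - 1) * b) <= (p - 1) * a `^ p + b `^ p.
Proof.
move=> p1 a0 b0.
have p0 : 0 < p by apply: lt_trans p1.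
have pB0 : 0 < p - 1 by rewrite subr_gt0.
have pp : 0 < p / (p - 1) by rewrite divr_gt0.
have := conjugate_powR (powR_ge0 a (p - 1)) b0 pp p0.
rewrite -powRrM mulrCA divff ?gt_eqF// mulr1.
have -> : (p / (p - 1))^-1 + p^-1 = 1 by field; rewrite !gt_eqF.
move=> /(_ erefl) H.
have := ler_wpM2l (ltW p0) H.
congr (_ <= _); field; by rewrite !gt_eqF.
Qed.

(** Trades the increment of a p-th power for one of a (p-1)-th power; this
    discrete form of d(x^p) = p' x d(x^(p-1)) is Young's inequality. It lets a
    factor x be absorbed by a conditional expectation in Doob's inequality. *)
Lemma powRB_le_base p x y : 1 < p -> 0 <= y -> y <= x ->
  x `^ p - y `^ p <= p / (p - 1) * (x * (x `^ (p - 1) - y `^ (p - 1))).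
Proof.
move=> p1 y0 yx; have x0 := le_trans y0 yx.
have p0 : 0 < p by apply: lt_trans p1.
have pB0 : 0 < p - 1 by rewrite subr_gt0.
have xE : x * x `^ (p - 1) = x `^ p by exact: mulr_powRB1.
rewrite mulrAC ler_pdivlMr// [x * (_ - _)]mulrBr xE.
have := young_powR p1 y0 x0; lra.
Qed.

(** The companion bound, a discrete form of d(x^p) = p x^(p-1) dx. *)
Lemma powRB_le_exponent p x y : 1 < p -> 0 <= y -> y <= x ->
  x `^ p - y `^ p <= p * (x `^ (p - 1) * (x - y)).
Proof.
move=> p1 y0 yx; have x0 := le_trans y0 yx.
have p0 : 0 < p by apply: lt_trans p1.
have xE : x `^ (p - 1) * x = x `^ p by rewrite mulrC; exact: mulr_powRB1.
rewrite mulrBr xE.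
have := young_powR p1 x0 y0; lra.
Qed.

(** One step of an Azema-Yor submartingale: 2 / m - x / m^2 is the function
    of the martingale x and its running maximum m attached to 1 / m. When the
    maximum is exceeded, the two sides differ by (x - m)^2 / (x m^2). *)
Lemma azema_yor_pointwise m x : 0 < m -> 0 <= x ->
  2 / m + x / Num.max m x ^+ 2 <= 2 / Num.max m x + x / m ^+ 2.
Proof.
move=> m0 x0; have [//|mx] := leP x m.
have x1 : 0 < x by apply: lt_trans mx.
rewrite -subr_ge0 (_ : _ - _ = (x - m) ^+ 2 / (x * m ^+ 2)).
  by rewrite divr_ge0 ?sqr_ge0// mulr_ge0// sqr_ge0.
by field; rewrite !gt_eqF.
Qed.

(** A substitute for Hoelder's inequality: either g is small compared with h,
    and the left side is at most h^p / 2, or h is at most a multiple of g. *)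
Lemma doob_absorption p h g : 1 < p -> 0 <= h -> 0 <= g ->
  p / (p - 1) * (h `^ (p - 1) * g) <=
    2^-1 * h `^ p + 2^-1 * (2 * (p / (p - 1))) `^ p * g `^ p.
Proof.
move=> p1 h0 g0.
have p0 : 0 < p by apply: lt_trans p1.
have pB0 : 0 < p - 1 by rewrite subr_gt0.
have q0 : 0 < p / (p - 1) by rewrite divr_gt0.
move: (p / (p - 1)) q0 => q q0.
have [hg|hg] := leP (2 * q * g) h.
  apply: (@le_trans _ _ (2^-1 * h `^ p)); last first.
    by rewrite lerDl !mulr_ge0// ?powR_ge0.
  rewrite -(mulr_powRB1 h0 p0) (mulrC h) mulrCA [leRHS]mulrCA ler_wpM2l ?powR_ge0//.
  lra.
apply: (@le_trans _ _ (2^-1 * (2 * q) `^ p * g `^ p)); last first.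
  by rewrite lerDr !mulr_ge0 ?powR_ge0.
have G0 : 0 <= 2 * q * g by rewrite !mulr_ge0// ltW.
rewrite -mulrA -powRM//; last by rewrite mulr_ge0// ltW.
rewrite -[X in 2^-1 * X]mulr_powRB1//.
have := ge0_ler_powR (ltW pB0) h0 G0 (ltW hg) => H.
rewrite (_ : q * _ = 2^-1 * (2 * q * g * h `^ (p - 1))).
  by rewrite ler_wpM2l// ler_wpM2l.
by field.
Qed.

End power_inequalities.

Section running_maximum.
Context {T : Type} {R : realType}.
Implicit Types (X theta : nat -> T -> R).

Fixpoint running_max X n x : R :=
  if n is k.+1 then Num.max (running_max X k x) (X k.+1 x) else X 0%N x.

(** The convention theta_(-1) = 0 makes the increments add up to theta. *)
Definition increment theta n x : R :=
  theta n x - (if n is k.+1 then theta k x else 0).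

Lemma sum_increment theta M x : \sum_(n < M.+1) increment theta n x = theta M x.
Proof.
elim: M => [|M IH]; first by rewrite big_ord1 /increment subr0.
by rewrite big_ord_recr/= IH /increment addrC subrK.
Qed.

Lemma increment_ge0 theta n x : 0 <= theta 0%N x ->
  (forall k, theta k x <= theta k.+1 x) -> 0 <= increment theta n x.
Proof. by move=> t0 nd; case: n => [|n]; rewrite /increment subr_ge0. Qed.

Lemma running_max_leS X n x : running_max X n x <= running_max X n.+1 x.
Proof. by rewrite /= le_max lexx. Qed.

Lemma running_max_le X m n x : (m <= n)%N ->
  running_max X m x <= running_max X n x.
Proof.
elim: n => [|n IH]; first by rewrite leqn0 => /eqP ->.
rewrite leq_eqVlt => /orP[/eqP ->//|]; rewrite ltnS => /IH.
by move=> /le_trans; apply; exact: running_max_leS.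
Qed.

Lemma le_running_max X n x : X n x <= running_max X n x.
Proof. by case: n => [|n]//=; rewrite le_max lexx orbT. Qed.

Lemma le_running_max_of X m n x : (m <= n)%N -> X m x <= running_max X n x.
Proof. by move=> mn; apply: le_trans (running_max_le X x mn); exact: le_running_max. Qed.

Lemma running_max_ge0 X n x : (forall k, 0 <= X k x) -> 0 <= running_max X n x.
Proof. by move=> X0; apply: le_trans (le_running_max X n x). Qed.

Lemma running_max_ub X n x c : (forall k, (k <= n)%N -> X k x <= c) ->
  running_max X n x <= c.
Proof.
elim: n => [|n IH] Xc; first exact: Xc.
by rewrite /= ge_max Xc// andbT IH// => k kn; apply: Xc; exact: leqW.
Qed.

Lemma running_max_new X n x :
  running_max X n x = X n x \/ exists2 k, n = k.+1 & running_max X n x = running_max X k x.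
Proof.
case: n => [|n]; first by left.
have [h|h] := leP (X n.+1 x) (running_max X n x); last first.
  by left; rewrite /= max_r// ltW.
by right; exists n => //; rewrite /= max_l.
Qed.

Lemma increment_running_max_ge0 X n x : (forall k, 0 <= X k x) ->
  0 <= increment (running_max X) n x.
Proof. by move=> X0; apply: increment_ge0 => [|k]; [exact: X0|exact: running_max_leS]. Qed.

End running_maximum.

(** * Relative jumps of a running maximum *)

Section nonneg_integrals.
Context {d : measure_display} {T : measurableType d} {R : realType}.
Variable mu : {measure set T -> \bar R}.
Implicit Types (f g : T -> R).

Lemma ge0_integralD_real f g : measurable_fun [set: T] f ->
  measurable_fun [set: T] g ->
  (forall x, 0 <= f x) -> (forall x, 0 <= g x) ->
  (\int[mu]_x (f x + g x)%:E = \int[mu]_x (f x)%:E + \int[mu]_x (g x)%:E)%E.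
Proof.
move=> mf mg f0 g0; under eq_integral do rewrite EFinD.
rewrite ge0_integralD//; do ?by move=> x _; rewrite lee_fin.
- exact/measurable_EFinP.
- exact/measurable_EFinP.
Qed.

Lemma ge0_integralZl_real c f : 0 <= c -> measurable_fun [set: T] f ->
  (forall x, 0 <= f x) ->
  (\int[mu]_x (c * f x)%:E = c%:E * \int[mu]_x (f x)%:E)%E.
Proof.
move=> c0 mf f0; under eq_integral do rewrite EFinM.
by rewrite ge0_integralZl//; [exact/measurable_EFinP|
  move=> x _; rewrite lee_fin].
Qed.

Lemma ge0_le_integral_real f g : measurable_fun [set: T] f ->
  measurable_fun [set: T] g ->
  (forall x, 0 <= f x) -> (forall x, f x <= g x) ->
  (\int[mu]_x (f x)%:E <= \int[mu]_x (g x)%:E)%E.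
Proof.
move=> mf mg f0 fg; apply: ge0_le_integral => //.
- by move=> x _; rewrite lee_fin.
- exact/measurable_EFinP.
- exact/measurable_EFinP.
- by move=> x _; rewrite lee_fin.
Qed.

Lemma ae_ge0_le_integral_real f g : measurable_fun [set: T] f ->
  measurable_fun [set: T] g ->
  (forall x, 0 <= f x) -> (forall x, 0 <= g x) ->
  {ae mu, forall x, f x <= g x} ->
  (\int[mu]_x (f x)%:E <= \int[mu]_x (g x)%:E)%E.
Proof.
move=> mf mg f0 g0 fg; apply: ae_ge0_le_integral => //.
- by move=> x _; rewrite lee_fin.
- exact/measurable_EFinP.
- by move=> x _; rewrite lee_fin.
- exact/measurable_EFinP.
- by apply: filterS fg => x fgx _; rewrite lee_fin.
Qed.

Lemma integral_ge0_real f : (forall x, 0 <= f x) ->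
  (0 <= \int[mu]_x (f x)%:E)%E.
Proof. by move=> f0; apply: integral_ge0 => x _; rewrite lee_fin. Qed.

Lemma ge0_integral_sum_real n (f : nat -> T -> R) :
  (forall k, measurable_fun [set: T] (f k)) -> (forall k x, 0 <= f k x) ->
  (\int[mu]_x (\sum_(k < n) f k x)%:E =
   \sum_(k < n) \int[mu]_x (f k x)%:E)%E.
Proof.
move=> mf f0.
under eq_integral do rewrite -sumEFin.
rewrite (@ge0_integral_sum _ _ _ mu [set: T] measurableT _
  (fun k : 'I_n => EFin \o f k))//.
- by move=> k; apply/measurable_EFinP.
- by move=> k x _; rewrite lee_fin.
Qed.

Lemma measurable_fun_inv f : (forall x, 0 <= f x) ->
  measurable_fun [set: T] f -> measurable_fun [set: T] (fun x => (f x)^-1).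
Proof.
move=> f0 mf; rewrite (_ : (fun x => _) = (fun x => f x `^ (-1))).
  exact: (measurableT_comp (measurable_powR (-1)) mf).
by apply/funext => x; rewrite powR_inv1.
Qed.

Lemma measurable_fun_powR f q :
  measurable_fun [set: T] f -> measurable_fun [set: T] (fun x => f x `^ q).
Proof. by move=> mf; apply: (measurableT_comp (measurable_powR q) mf). Qed.

End nonneg_integrals.

Section martingale_core.
Context {d : measure_display} {T : measurableType d} {R : realType}.
Variable mu : {measure set T -> \bar R}.
Variable A : nat -> set (set T).
Hypothesis AT : forall n, A n `<=` measurable.
Hypothesis AS : forall n, A n `<=` A n.+1.
Implicit Types (X theta W : nat -> T -> R).

Lemma filtration_le k n : (k <= n)%N -> A k `<=` A n.
Proof.
elim: n => [|n IH]; first by rewrite leqn0 => /eqP ->.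
rewrite leq_eqVlt => /orP[/eqP ->//|]; rewrite ltnS => /IH kn.
by apply: subset_trans kn _; exact: AS.
Qed.

Lemma measurable_for_le_filtration k n (f : T -> R) : (k <= n)%N ->
  measurable_for (A k) f -> measurable_for (A n) f.
Proof. by move=> kn; apply: measurable_forS; exact: filtration_le. Qed.

Lemma measurable_for_running_max X n :
  (forall k, measurable_for (A k) (X k)) ->
  measurable_for (A n) (running_max X n).
Proof.
move=> mX; elim: n => [|n IH]; first exact: mX.
by apply: measurable_for_max => //; apply: measurable_forS IH; exact: AS.
Qed.

Lemma measurable_for_increment theta n :
  (forall k, measurable_for (A k) (theta k)) ->
  measurable_for (A n) (increment theta n).
Proof.
move=> mt; apply: measurable_forB => //; case: n => [|n]; first exact: measurable_for_cst.
by apply: measurable_forS (mt n); exact: AS.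
Qed.

(** Each increment of theta is known at its own time, so that w may be replaced
    by its conditional expectation at that time. *)
Lemma telescoping theta (w : T -> R) W M :
  (forall k, measurable_for (A k) (theta k)) -> (forall x, 0 <= theta 0%N x) ->
  (forall k x, theta k x <= theta k.+1 x) ->
  measurable_fun [set: T] w -> (forall x, 0 <= w x) ->
  (forall k, nonneg_condexp mu (A k) w (W k)) ->
  (\int[mu]_x (theta M x * w x)%:E =
   \sum_(n < M.+1) \int[mu]_x (increment theta n x * W n x)%:E)%E.
Proof.
move=> mt t0 nd mw w0 cW.
have mi k : measurable_fun [set: T] (increment theta k).
  by apply: (measurable_for_measurable (@AT k)); exact: measurable_for_increment.
have i0 k x : 0 <= increment theta k x by exact: increment_ge0.
transitivity (\int[mu]_x (\sum_(n < M.+1) increment theta n x * w x)%:E)%E.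
  by apply: eq_integral => x _; rewrite -mulr_suml sum_increment.
rewrite (@ge0_integral_sum_real _ _ _ mu _ (fun n x => increment theta n x * w x)).
- apply: eq_bigr => n _; have [_ _ ->] := cW n => //; first exact: measurable_for_increment.
- by move=> k; exact: measurable_funM.
- by move=> k x; rewrite mulr_ge0.
Qed.

Section sparse.
Variables (f : T -> R) (X : nat -> T -> R).
Hypothesis cX : forall n, nonneg_condexp mu (A n) f (X n).

Let mX n : measurable_for (A n) (X n). Proof. by have [] := cX n. Qed.
Let X0 n x : 0 <= X n x. Proof. by have [] := cX n. Qed.
Local Notation m := (running_max X).
Let mm n : measurable_for (A n) (m n). Proof. exact: measurable_for_running_max. Qed.
Let m0 n x : 0 <= m n x. Proof. exact: running_max_ge0. Qed.

Lemma martingale n psi : measurable_for (A n) psi -> (forall x, 0 <= psi x) ->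
  (\int[mu]_x (psi x * X n.+1 x)%:E = \int[mu]_x (psi x * X n x)%:E)%E.
Proof.
move=> mpsi psi0; have [_ _ ->//] := cX n; have [_ _ ->//] := cX n.+1.
by apply: measurable_forS mpsi; exact: AS.
Qed.

(** Backward induction on the distance k to the horizon: the process
    2 / m_j - X_j / m_j^2 is a submartingale. The negative terms are moved to
    the other side, so that only nonnegative integrals occur. *)
Lemma azema_yor n k psi : measurable_for (A n) psi -> (forall x, 0 <= psi x) ->
  (forall x, m n x = 0 -> psi x = 0) ->
  (\int[mu]_x (psi x * (m n x)^-1)%:E < +oo)%E ->
  (\int[mu]_x (psi x * (2 / m n x))%:E <=
    \int[mu]_x (psi x * (2 / m (n + k) x))%:E +
    \int[mu]_x (psi x * (X n x / m n x ^+ 2))%:E)%E.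
Proof.
elim: k n psi => [|k IH] n psi mpsi psi0 psim fin.
  by rewrite addn0 leeDl// integral_ge0_real// => x; rewrite !mulr_ge0// invr_ge0 exprn_ge0.
have mV j : measurable_for (A j) (fun x => (m j x)^-1) by exact: measurable_forV.
have mV2 j : measurable_for (A j) (fun x => (m j x ^+ 2)^-1).
  apply: measurable_forV => [x|]; first by rewrite exprn_ge0.
  exact: measurable_forM.
have mpsiS : measurable_for (A n.+1) psi by apply: measurable_forS mpsi; exact: AS.
have Tm j (h : T -> R) : measurable_for (A j) h -> measurable_fun [set: T] h.
  exact: measurable_for_measurable.
have V0 j x : 0 <= (m j x)^-1 by rewrite invr_ge0.
have V20 j x : 0 <= (m j x ^+ 2)^-1 by rewrite invr_ge0 exprn_ge0.
have mN x : psi x != 0 -> 0 < m n x.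
  by move=> px; rewrite lt0r m0 andbT; apply: contraNN px => /eqP /psim /eqP.
have mSle x : psi x * (m n.+1 x)^-1 <= psi x * (m n x)^-1.
  have [->|px] := eqVneq (psi x) 0; first by rewrite !mul0r.
  rewrite ler_wpM2l// lef_pV2 ?posrE ?mN//; first exact: running_max_leS.
  by apply: lt_le_trans (mN _ px) _; exact: running_max_leS.
have finS : (\int[mu]_x (psi x * (m n.+1 x)^-1)%:E < +oo)%E.
  apply: le_lt_trans fin; apply: ge0_le_integral_real => //.
  - by apply: (Tm n.+1); exact: measurable_forM.
  - by apply: (Tm n); exact: measurable_forM.
  - by move=> x; rewrite mulr_ge0.
have psimS x : m n.+1 x = 0 -> psi x = 0.
  move=> mS0; apply: psim; apply/eqP; rewrite eq_le m0 andbT -mS0.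
  exact: running_max_leS.
have mX2 i j : (i <= j.+1)%N -> (j <= i)%N ->
    measurable_for (A i) (fun x => X i x * (m j x ^+ 2)^-1).
  move=> ij ji; apply: measurable_forM => //; exact: measurable_for_le_filtration (mV2 j).
have fXS : (\int[mu]_x (psi x * (X n.+1 x / m n.+1 x ^+ 2))%:E < +oo)%E.
  apply: le_lt_trans finS; apply: ge0_le_integral_real => //.
  - by apply: (Tm n.+1); apply: measurable_forM => //; exact: mX2.
  - by apply: (Tm n.+1); exact: measurable_forM.
  - by move=> x; rewrite !mulr_ge0.
  - move=> x; rewrite ler_wpM2l//.
    have [->|/eqP mne] := eqVneq (m n.+1 x) 0.
      by rewrite expr0n/= invr0 mulr0.
    have mp : 0 < m n.+1 x by rewrite lt0r m0 andbT; apply/eqP.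
    rewrite ler_pdivrMr ?exprn_gt0// expr2 mulrA mulVf ?gt_eqF// mul1r.
    exact: le_running_max.
have step : (\int[mu]_x (psi x * (2 / m n x))%:E +
    \int[mu]_x (psi x * (X n.+1 x / m n.+1 x ^+ 2))%:E <=
    \int[mu]_x (psi x * (2 / m n.+1 x))%:E +
    \int[mu]_x (psi x * (X n.+1 x / m n x ^+ 2))%:E)%E.
  have s1 : measurable_for (A n.+1) (fun x => psi x * (2 / m n x)).
    apply: measurable_forM => //; apply: measurable_forM; first exact: measurable_for_cst.
    exact: measurable_for_le_filtration (mV n).
  have s2 : measurable_for (A n.+1) (fun x => psi x * (X n.+1 x / m n.+1 x ^+ 2)).
    by apply: measurable_forM => //; exact: mX2.
  have s3 : measurable_for (A n.+1) (fun x => psi x * (2 / m n.+1 x)).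
    by apply: measurable_forM => //; apply: measurable_forM; first exact: measurable_for_cst.
  have s4 : measurable_for (A n.+1) (fun x => psi x * (X n.+1 x / m n x ^+ 2)).
    by apply: measurable_forM => //; exact: mX2.
  rewrite -!ge0_integralD_real; try by [exact: (Tm n.+1) | move=> x; rewrite !mulr_ge0].
  apply: ge0_le_integral_real.
  - by apply: (Tm n.+1); exact: measurable_forD.
  - by apply: (Tm n.+1); exact: measurable_forD.
  - by move=> x; rewrite addr_ge0// !mulr_ge0.
  - move=> x; rewrite -!mulrDr.
    have [->|px] := eqVneq (psi x) 0; first by rewrite !mul0r.
    by rewrite ler_wpM2l//; apply: azema_yor_pointwise => //; exact: mN.
have mart : (\int[mu]_x (psi x * (X n.+1 x / m n x ^+ 2))%:E =
    \int[mu]_x (psi x * (X n x / m n x ^+ 2))%:E)%E.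
  have := @martingale n (fun x => psi x * (m n x ^+ 2)^-1).
  under eq_integral do rewrite mulrAC -mulrA.
  under [X in _ -> _ -> _ = X]eq_integral do rewrite mulrAC -mulrA.
  apply; first exact: measurable_forM.
  by move=> x; rewrite mulr_ge0.
have := IH n.+1 psi mpsiS psi0 psimS finS; rewrite addSnnS => IHn.
rewrite mart in step.
have /fineK cE : (\int[mu]_x (psi x * (X n.+1 x / m n.+1 x ^+ 2))%:E)%E
    \is a fin_num.
  by rewrite ge0_fin_numE// integral_ge0_real// => x; rewrite !mulr_ge0.
(* Add to both sides the finite term that the induction hypothesis yields. *)
rewrite -(@leeD2rE _ (\int[mu]_x (psi x * (X n.+1 x / m n.+1 x ^+ 2))%:E)%E);
  last by rewrite -cE.
apply: le_trans step _; rewrite [leRHS]addeAC.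
by apply: leeD.
Qed.

(** At a time where the martingale sits at its running maximum, the
    conditional expectation of the future value of 1 / m loses at most a
    factor 2: then X_n / m_n^2 = 1 / m_n in [azema_yor]. *)
Lemma integral_inv_running_max n M psi : (n <= M)%N ->
  measurable_for (A n) psi -> (forall x, 0 <= psi x) ->
  (forall x, psi x != 0 -> 0 < X n x /\ m n x = X n x) ->
  (\int[mu]_x (psi x * (m n x)^-1)%:E < +oo)%E ->
  (\int[mu]_x (psi x * (m n x)^-1)%:E <=
    2%:E * \int[mu]_x (psi x * (m M x)^-1)%:E)%E.
Proof.
move=> nM mpsi psi0 psiX fin.
have psim x : m n x = 0 -> psi x = 0.
  by move=> mx; apply: contrapT => /eqP /psiX[X1 mX1]; move: X1; rewrite -mX1 mx ltxx.
have := azema_yor (M - n) mpsi psi0 psim fin; rewrite subnKC//.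
have mVn j : (j <= M)%N -> measurable_fun [set: T] (fun x => psi x * (m j x)^-1).
  move=> jM; apply: (measurable_for_measurable (@AT M)).
  apply: measurable_forM; first exact: measurable_for_le_filtration mpsi.
  by apply: measurable_for_le_filtration jM _; exact: measurable_forV.
have V0 j x : 0 <= psi x * (m j x)^-1 by rewrite mulr_ge0// invr_ge0.
have two j : (j <= M)%N -> (\int[mu]_x (psi x * (2 / m j x))%:E =
    2%:E * \int[mu]_x (psi x * (m j x)^-1)%:E)%E.
  move=> jM; rewrite -ge0_integralZl_real//; last exact: mVn.
  by apply: eq_integral => x _; congr EFin; ring.
rewrite !two//.
rewrite (_ : (\int[mu]_x (psi x * (X n x / m n x ^+ 2))%:E)%E =
  (\int[mu]_x (psi x * (m n x)^-1)%:E)%E); last first.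
  apply: eq_integral => x _; congr EFin.
  have [->|px] := eqVneq (psi x) 0; first by rewrite !mul0r.
  have [X1 ->] := psiX x px; congr (_ * _); field; by rewrite gt_eqF.
have fn : (\int[mu]_x (psi x * (m n x)^-1)%:E)%E \is a fin_num.
  by rewrite ge0_fin_numE// integral_ge0_real.
(* Of the two copies on the left, one is cancelled by the last term. *)
rewrite (_ : 2%:E = 1%:E + 1%:E)%E// ge0_muleDl ?lee_fin// mul1e.
by rewrite leeD2rE.
Qed.

(** The Carleson property of the relative jumps. By
    [integral_inv_running_max] the denominator m_n may be replaced by m_M at
    the cost of a factor 2, and the increments of m add up to m_M. *)
Lemma sparse_sum M (H : nat -> T -> R) (Hs : T -> R) :
  (forall n, measurable_for (A n) (H n)) -> (forall n x, 0 <= H n x) ->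
  measurable_fun [set: T] Hs -> (forall n x, (n <= M)%N -> H n x <= Hs x) ->
  (\sum_(n < M.+1) \int[mu]_x (increment m n x / m n x * H n x)%:E <=
   2%:E * \int[mu]_x (Hs x)%:E)%E.
Proof.
move=> mH H0 mHs HHs.
have Hs0 x : 0 <= Hs x by apply: le_trans (HHs 0%N x _).
have i0 n x : 0 <= increment m n x by exact: increment_running_max_ge0.
have [->|] := eqVneq (\int[mu]_x (Hs x)%:E)%E +oo%E.
  by rewrite gt0_muley ?lte_fin// leey.
rewrite -ltey => finHs.
have mi n : measurable_for (A n) (increment m n) by exact: measurable_for_increment.
have ile n x : increment m n x <= m n x.
  by case: n => [|n]; rewrite /increment ?subr0// lerBlDr lerDl.
have mterm n : measurable_for (A n) (fun x => increment m n x * H n x * (m n x)^-1).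
  by apply: measurable_forM; [exact: measurable_forM|exact: measurable_forV].
have term (n : 'I_M.+1) : (\int[mu]_x (increment m n x / m n x * H n x)%:E <=
    2%:E * \int[mu]_x (increment m n x * H n x * (m M x)^-1)%:E)%E.
  under eq_integral do rewrite mulrAC.
  apply: integral_inv_running_max.
  - by rewrite -ltnS.
  - exact: measurable_forM.
  - by move=> x; rewrite mulr_ge0.
  - move=> x; rewrite mulf_eq0 negb_or => /andP[inz _].
    have ip : 0 < increment m n x by rewrite lt0r inz i0.
    have [E|[k nk E]] := running_max_new X n x.
      by rewrite -E; split => //; apply: lt_le_trans ip _; exact: ile.
    by move: inz; rewrite /increment nk -nk E subrr eqxx.
  - apply: le_lt_trans finHs; apply: ge0_le_integral_real => //.
    + exact: (measurable_for_measurable (@AT n)).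
    + by move=> x; rewrite !mulr_ge0// invr_ge0.
    + move=> x; rewrite mulrAC.
      have Hn := HHs n x (ltnSE (ltn_ord n)).
      apply: le_trans Hn; rewrite ler_piMl//.
      have [->|mne] := eqVneq (m n x) 0; first by rewrite invr0 mulr0.
      by rewrite ler_pdivrMr ?mul1r ?ile// lt0r mne m0.
apply: (@le_trans _ _ (\sum_(n < M.+1)
   2%:E * \int[mu]_x (increment m n x * H n x * (m M x)^-1)%:E)%E).
  exact: lee_sum.
have mT (n : 'I_M.+1) : measurable_fun [set: T] (fun x => increment m n x * H n x).
  by apply: (measurable_for_measurable (@AT n)); exact: measurable_forM.
have mVM : measurable_fun [set: T] (fun x => (m M x)^-1).
  by apply: (measurable_for_measurable (@AT M)); exact: measurable_forV.
rewrite -ge0_sume_distrr; last first.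
  by move=> n _; apply: integral_ge0_real => x; rewrite !mulr_ge0// invr_ge0.
rewrite lee_wpmul2l ?lee_fin//.
rewrite -(@ge0_integral_sum_real _ _ _ mu _ (fun n x => increment m n x * H n x * (m M x)^-1)).
- apply: ge0_le_integral_real => //.
  + apply: measurable_sum => n; exact: measurable_funM.
  + by move=> x; apply: sumr_ge0 => n _; rewrite !mulr_ge0// invr_ge0.
  + move=> x; rewrite -mulr_suml.
    apply: (@le_trans _ _ ((\sum_(n < M.+1) increment m n x * Hs x) / m M x)).
      rewrite ler_wpM2r ?invr_ge0//; apply: ler_sum => n _.
      by rewrite ler_wpM2l// HHs// -ltnS.
    rewrite -mulr_suml sum_increment mulrAC.
    have [->|mne] := eqVneq (m M x) 0; first by rewrite invr0 mulr0 mul0r.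
    by rewrite divff// mul1r.
- move=> n; apply: measurable_funM => //.
  by apply: (measurable_for_measurable (@AT n)); exact: measurable_forM.
- by move=> n x; rewrite !mulr_ge0// invr_ge0.
Qed.

End sparse.

End martingale_core.

(** * Doob's inequality for weighted conditional means *)

Section weighted_doob.
Context {d : measure_display} {T : measurableType d} {R : realType}.
Variable mu : {measure set T -> \bar R}.
Variable A : nat -> set (set T).
Hypothesis AT : forall n, A n `<=` measurable.
Hypothesis AS : forall n, A n `<=` A n.+1.
Variables (sigma g : T -> R) (Sg X : nat -> T -> R) (G : nat -> set T).
Hypothesis msigma : measurable_fun [set: T] sigma.
Hypothesis sigma0 : forall x, 0 <= sigma x.
Hypothesis mg : measurable_fun [set: T] g.
Hypothesis g0 : forall x, 0 <= g x.
Hypothesis cS : forall n, nonneg_condexp mu (A n) sigma (Sg n).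
Hypothesis Spos : forall n x, 0 < Sg n x.
Hypothesis cX : forall n, nonneg_condexp mu (A n) (fun x => g x * sigma x) (X n).
Hypothesis AG : forall k, <<s A 0%N >> (G k).
Hypothesis ndG : nondecreasing_seq G.
Hypothesis GT : \bigcup_k G k = [set: T].
Hypothesis Gfin : forall k, (\int[mu]_(x in G k) (sigma x)%:E < +oo)%E.

(** The conditional expectation of g with respect to the measure sigma mu, since
    X_n and Sg_n are those of g sigma and sigma with respect to mu. *)
Definition weighted_mean n x := X n x / Sg n x.
Local Notation F := weighted_mean.

Let mS n : measurable_for (A n) (Sg n). Proof. by have [] := cS n. Qed.
Let mX n : measurable_for (A n) (X n). Proof. by have [] := cX n. Qed.
Let X0 n x : 0 <= X n x. Proof. by have [] := cX n. Qed.
Let S0 n x : 0 <= Sg n x. Proof. exact: ltW. Qed.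

Lemma weighted_mean_ge0 n x : 0 <= F n x.
Proof. by rewrite divr_ge0. Qed.

Lemma measurable_for_weighted_mean n : measurable_for (A n) (F n).
Proof. by apply: measurable_forM => //; exact: measurable_forV. Qed.

Lemma weighted_meanK n x : F n x * Sg n x = X n x.
Proof. by rewrite /F divfK// gt_eqF. Qed.

Let h n x := running_max F n x.
Let h0 n x : 0 <= h n x. Proof. by apply: running_max_ge0 => k; exact: weighted_mean_ge0. Qed.
Let mh n : measurable_for (A n) (h n).
Proof. by apply: measurable_for_running_max => //; exact: measurable_for_weighted_mean. Qed.

(** The maximal function, truncated to be bounded with support in a set on
    which sigma is integrable. *)
Let theta c n x := Num.min (h n x) c%:R * \1_(G c) x.

Let theta0 c n x : 0 <= theta c n x.
Proof. by rewrite mulr_ge0// le_min h0 ler0n. Qed.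

Let mtheta c n : measurable_for (A n) (theta c n).
Proof.
apply: measurable_forM; first by apply: measurable_for_min => //; exact: measurable_for_cst.
apply: (measurable_for_le_filtration AS (leq0n n)).
exact: measurable_for_indic.
Qed.

Let theta_nd c n x : theta c n x <= theta c n.+1 x.
Proof.
rewrite ler_wpM2r// le_min ge_min running_max_leS/=.
by rewrite ge_min lexx orbT.
Qed.

(** Truncation keeps the property of running maxima that drives the proof:
    theta only grows where it is at most the current mean. *)
Let theta_new c n x :
  theta c n x <= F n x \/ exists2 k, n = k.+1 & theta c n x = theta c k x.
Proof.
have [E|[k nk E]] := running_max_new F n x; last first.
  by right; exists k => //; rewrite /theta /h E.
left; rewrite /theta /h E; apply: (@le_trans _ _ (F n x * 1)); last by rewrite mulr1.
apply: ler_pM => //; first by rewrite le_min weighted_mean_ge0 ler0n.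
  by rewrite ge_min lexx.
Qed.

(** Doob's inequality, where truncation makes the left side finite so that
    half of it can be absorbed. Conditioning and [powRB_le_base] turn the
    increments of theta^q sigma into those of theta^(q-1) X, that is, of
    theta^(q-1) g sigma. *)
Let truncated_doob c M q : 1 < q ->
  (\int[mu]_x (theta c M x `^ q * sigma x)%:E <=
   ((2 * (q / (q - 1))) `^ q)%:E * \int[mu]_x (g x `^ q * sigma x)%:E)%E.
Proof.
move=> q1.
have q0 : 0 < q by apply: lt_trans q1.
have qB0 : 0 < q - 1 by rewrite subr_gt0.
have qq0 : 0 < q / (q - 1) by rewrite divr_gt0.
have mpow r k : measurable_for (A k) (fun x => theta c k x `^ r) by exact: measurable_for_powR.
have pow0 r k x : 0 <= theta c k x `^ r by exact: powR_ge0.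
have pow_nd r k x : 0 < r -> theta c k x `^ r <= theta c k.+1 x `^ r.
  by move=> r0; apply: le_powR => //; exact: ltW.
have mT k (f : T -> R) : measurable_for (A k) f -> measurable_fun [set: T] f.
  exact: measurable_for_measurable.
have mgs : measurable_fun [set: T] (fun x => g x * sigma x).
  exact: measurable_funM.
have mgqs : measurable_fun [set: T] (fun x => g x `^ q * sigma x).
  by apply: measurable_funM => //; exact: measurable_fun_powR.
have gqs0 x : 0 <= g x `^ q * sigma x by rewrite mulr_ge0// powR_ge0.
pose I := (\int[mu]_x (theta c M x `^ q * sigma x)%:E)%E.
have finI : (I < +oo)%E.
  apply: (@le_lt_trans _ _ (\int[mu]_x ((c%:R `^ q) * (sigma x * \1_(G c) x))%:E)%E).
    have mGc : d.-measurable (G c) := generated_measurable (AT (n := 0%N)) (AG c).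
    have msG : measurable_fun [set: T] (fun x => sigma x * \1_(G c) x).
      by apply: measurable_funM => //; exact: measurable_indic.
    apply: ge0_le_integral_real.
    - by apply: measurable_funM => //; exact: (mT M).
    - exact: measurable_funM.
    - by move=> x; rewrite mulr_ge0.
    - move=> x; rewrite /theta indicE; case: (x \in G c); last first.
        by rewrite mulr0 powR0 ?gt_eqF// mul0r mulr0 mulr0.
      rewrite !mulr1 ler_wpM2r//; apply: le_powR; first exact: ltW.
        by rewrite le_min h0 ler0n.
      by rewrite ge_min lexx orbT.
  have mGc : d.-measurable (G c) := generated_measurable (AT (n := 0%N)) (AG c).
  rewrite ge0_integralZl_real ?powR_ge0//; last 2 first.
  - by apply: measurable_funM => //; exact: measurable_indic.
  - by move=> x; rewrite mulr_ge0.
  rewrite lte_mul_pinfty ?lee_fin ?powR_ge0//.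
  apply: le_lt_trans (Gfin c); rewrite [leRHS]integral_mkcond.
  rewrite le_eqVlt; apply/orP; left; apply/eqP; apply: eq_integral => x _.
  by rewrite patchE indicE; case: ifPn => _; rewrite (mulr1, mulr0).
have Itel : I = (\sum_(n < M.+1)
    \int[mu]_x (increment (fun k x => theta c k x `^ q) n x * Sg n x)%:E)%E.
  apply: (telescoping (w := sigma) AT AS) => // k x; exact: pow_nd.
have Jtel : (\int[mu]_x (theta c M x `^ (q - 1) * (g x * sigma x))%:E = \sum_(n < M.+1)
    \int[mu]_x (increment (fun k x => theta c k x `^ (q - 1)) n x * X n x)%:E)%E.
  apply: (telescoping (w := fun x => g x * sigma x) AT AS) => //.
  - by move=> k x; exact: pow_nd.
  - by move=> x; rewrite mulr_ge0.
have IJ : (I <= (q / (q - 1))%:E *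
    \int[mu]_x (theta c M x `^ (q - 1) * (g x * sigma x))%:E)%E.
  rewrite Itel Jtel ge0_sume_distrr; last first.
    move=> n _; apply: integral_ge0_real => x; rewrite mulr_ge0//.
    by apply: increment_ge0 => // k; exact: pow_nd.
  apply: lee_sum => n _.
  have i0 r k x : 0 < r -> 0 <= increment (fun k x => theta c k x `^ r) k x.
    by move=> r0; apply: increment_ge0 => // j; exact: pow_nd.
  have mi r : measurable_for (A n) (increment (fun k x => theta c k x `^ r) n).
    exact: measurable_for_increment.
  rewrite -ge0_integralZl_real; last 3 first.
  - exact: ltW.
  - by apply: (mT n); exact: measurable_forM.
  - by move=> x; rewrite mulr_ge0// i0.
  apply: ge0_le_integral_real.
  - by apply: (mT n); exact: measurable_forM.
  - by apply: (mT n); apply: measurable_forM; [exact: measurable_for_cst|exact: measurable_forM].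
  - by move=> x; rewrite mulr_ge0// i0.
  move=> x.
  have key y : 0 <= y -> y <= theta c n x -> theta c n x <= F n x ->
      (theta c n x `^ q - y `^ q) * Sg n x <=
      q / (q - 1) * ((theta c n x `^ (q - 1) - y `^ (q - 1)) * X n x).
    move=> y0 yt tF; rewrite -weighted_meanK.
    have H1 : (theta c n x `^ q - y `^ q) * Sg n x <=
       q / (q - 1) * (theta c n x * (theta c n x `^ (q - 1) - y `^ (q - 1))) * Sg n x.
      by rewrite ler_wpM2r//; exact: powRB_le_base.
    apply: le_trans H1 _; rewrite -[leLHS]mulrA ler_wpM2l ?(ltW qq0)//.
    rewrite (mulrC (theta c n x)) -mulrA ler_wpM2l ?ler_wpM2r//.
    by rewrite subr_ge0; apply: le_powR => //; exact: ltW.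
  have [tF|[k nk E]] := theta_new c n x; last first.
    rewrite /increment nk -[_ k.+1]/(theta c k.+1); move: E; rewrite nk => ->.
    by rewrite !subrr !mul0r mulr0.
  case: (n : nat) key tF => [|k] key tF.
    by have := key 0 (lexx _) (theta0 _ _ _) tF; rewrite !powR0 ?gt_eqF.
  by rewrite /increment; apply: key.
have absorb : (I <= (2^-1)%:E * I + (2^-1)%:E * (((2 * (q / (q - 1))) `^ q)%:E *
    \int[mu]_x (g x `^ q * sigma x)%:E))%E.
  have mtq : measurable_fun [set: T] (fun x => theta c M x `^ q * sigma x).
    by apply: measurable_funM => //; exact: (mT M).
  have tq0 x : 0 <= theta c M x `^ q * sigma x by rewrite mulr_ge0.
  apply: le_trans IJ _; rewrite -ge0_integralZl_real//; last 3 first.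
  - exact: ltW.
  - by apply: measurable_funM => //; exact: (mT M).
  - by move=> x; rewrite !mulr_ge0.
  rewrite /I -!ge0_integralZl_real// ?powR_ge0//; last 2 first.
  - exact: measurable_funM.
  - by move=> x; rewrite mulr_ge0 ?powR_ge0.
  rewrite -ge0_integralD_real; last 4 first.
  - exact: measurable_funM.
  - by apply: measurable_funM => //; exact: measurable_funM.
  - by move=> x; rewrite mulr_ge0.
  - by move=> x; rewrite !mulr_ge0 ?powR_ge0.
  apply: ge0_le_integral_real.
  - by do 2 apply: measurable_funM => //; exact: (mT M).
  - by apply: measurable_funD; do 2 apply: measurable_funM => //; exact: (mT M).
  - by move=> x; rewrite mulr_ge0 ?(ltW qq0)// mulr_ge0// mulr_ge0.
  - move=> x.
    have := ler_wpM2r (sigma0 x) (doob_absorption q1 (theta0 c M x) (g0 x)).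
    by rewrite mulrDl !mulrA.
have I0 : (0 <= I)%E by apply: integral_ge0_real => x; rewrite mulr_ge0.
move: absorb.
set B := (((2 * (q / (q - 1))) `^ q)%:E * _)%E.
have B0 : (0 <= B)%E by rewrite mule_ge0 ?lee_fin ?powR_ge0// integral_ge0_real.
rewrite -/I; move: I0 finI B0; case: I {Itel IJ} => [i||]//; case: B => [b||]//=.
by rewrite !lee_fin => i0 _ b0; lra.
Qed.

Lemma doob_weighted q M : 1 < q ->
  (\int[mu]_x (running_max F M x `^ q * sigma x)%:E <=
   ((2 * (q / (q - 1))) `^ q)%:E * \int[mu]_x (g x `^ q * sigma x)%:E)%E.
Proof.
move=> q1; have q0 : 0 < q by apply: lt_trans q1.
have mT k (f : T -> R) : measurable_for (A k) f -> measurable_fun [set: T] f.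
  exact: measurable_for_measurable.
have cvgh x : theta c M x `^ q * sigma x @[c --> \oo] --> h M x `^ q * sigma x.
  have [k Gk] : exists k, G k x.
    by have : [set: T] x by []; rewrite -GT => -[k _]; exists k.
  apply: cvg_near_cst; near=> c.
  rewrite /theta indicE mem_set ?mulr1; last first.
    have kc : (k <= c)%N by near: c; exact: nbhs_infty_ge.
    by have /subsetPset := ndG kc; apply.
  rewrite (min_idPl _)//; apply: ltW; apply: lt_le_trans (truncnS_gt _) _.
  by rewrite ler_nat; near: c; exact: nbhs_infty_ge.
have -> : (\int[mu]_x (running_max F M x `^ q * sigma x)%:E =
    \int[mu]_x limn (fun c => (theta c M x `^ q * sigma x)%:E))%E.
  apply: eq_integral => x _; apply/esym/cvg_lim => //.
  by apply: cvg_EFin; [exact: nearW|exact: cvgh].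
have mth c : measurable_fun [set: T] (fun x => theta c M x `^ q * sigma x).
  apply: measurable_funM => //; apply: measurable_fun_powR; exact: (mT M).
have th0 c x : 0 <= theta c M x `^ q * sigma x by rewrite mulr_ge0 ?powR_ge0.
have ndth a b x : (a <= b)%N ->
    theta a M x `^ q * sigma x <= theta b M x `^ q * sigma x.
  move=> ab; rewrite ler_wpM2r//.
  apply: le_powR => //; first exact: ltW.
  apply: ler_pM => //; first by rewrite le_min h0 ler0n.
    by rewrite le_min ge_min lexx/= ge_min ler_nat ab orbT.
  rewrite !indicE; case: (boolP (x \in G a)) => [|//]; rewrite inE => Ga.
  by rewrite mem_set//; have /subsetPset := ndG ab; apply.
rewrite monotone_convergence//; last 3 first.
- by move=> c; apply/measurable_EFinP.
- by move=> c x _; rewrite lee_fin.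
- by move=> x _ a b ab; rewrite lee_fin; exact: ndth.
apply: lime_le; last by apply: nearW => c; exact: truncated_doob.
apply: ereal_nondecreasing_is_cvgn => a b ab; apply: ge0_le_integral_real => // x.
exact: ndth.
Unshelve. all: by end_near.
Qed.

End weighted_doob.

(** * Maximal inequalities over a finite horizon *)

Section finite_horizon.
Context {d : measure_display} {T : measurableType d} {R : realType}.
Variable mu : {measure set T -> \bar R}.
Variable A : nat -> set (set T).
Hypothesis AT : forall n, A n `<=` measurable.
Hypothesis AS : forall n, A n `<=` A n.+1.
Variables (sigma g v : T -> R) (Sg X V : nat -> T -> R) (G : nat -> set T).
Hypothesis msigma : measurable_fun [set: T] sigma.
Hypothesis sigma0 : forall x, 0 <= sigma x.
Hypothesis mg : measurable_fun [set: T] g.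
Hypothesis g0 : forall x, 0 <= g x.
Hypothesis mv : measurable_fun [set: T] v.
Hypothesis v0 : forall x, 0 <= v x.
Hypothesis cS : forall n, nonneg_condexp mu (A n) sigma (Sg n).
Hypothesis Spos : forall n x, 0 < Sg n x.
Hypothesis cX : forall n, nonneg_condexp mu (A n) (fun x => g x * sigma x) (X n).
Hypothesis cV : forall n, nonneg_condexp mu (A n) v (V n).
Hypothesis exG : exhausting mu (A 0%N) G.
Hypothesis Gfin : forall k, (\int[mu]_(x in G k) (sigma x)%:E < +oo)%E.
Variable p : R.
Hypothesis p1 : 1 < p.

Local Notation F := (weighted_mean Sg X).
Local Notation m := (running_max X).

Let mT k (f : T -> R) : measurable_for (A k) f -> measurable_fun [set: T] f.
Proof. exact: measurable_for_measurable. Qed.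
Let p0 : 0 < p. Proof. exact: lt_trans p1. Qed.
Let mS n : measurable_for (A n) (Sg n). Proof. by have [] := cS n. Qed.
Let mX n : measurable_for (A n) (X n). Proof. by have [] := cX n. Qed.
Let X0 n x : 0 <= X n x. Proof. by have [] := cX n. Qed.
Let mV n : measurable_for (A n) (V n). Proof. by have [] := cV n. Qed.
Let V0 n x : 0 <= V n x. Proof. by have [] := cV n. Qed.
Let S0 n x : 0 <= Sg n x. Proof. exact: ltW. Qed.
Let F0 n x : 0 <= F n x. Proof. exact: (weighted_mean_ge0 Spos cX). Qed.
Let mF n : measurable_for (A n) (F n). Proof. exact: (measurable_for_weighted_mean cS Spos cX). Qed.
Let mm n : measurable_for (A n) (m n). Proof. exact: measurable_for_running_max. Qed.
Let m0 n x : 0 <= m n x. Proof. exact: running_max_ge0. Qed.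

Definition relative_jump n x := increment m n x / m n x.

Lemma relative_jump_ge0 n x : 0 <= relative_jump n x.
Proof. by rewrite divr_ge0//; exact: increment_running_max_ge0. Qed.

Lemma measurable_for_relative_jump n : measurable_for (A n) (relative_jump n).
Proof. by apply: measurable_forM; [exact: measurable_for_increment|exact: measurable_forV]. Qed.

(** Where m jumps at time n one has m_n = X_n, whence
    m_n^p - m_(n-1)^p <= p m_n^(p-1) (m_n - m_(n-1)) = p c_n X_n^p. *)
Lemma maximal_le_relative_jump_sum M :
  (\int[mu]_x (m M x `^ p * v x)%:E <=
   p%:E * \sum_(n < M.+1) \int[mu]_x (relative_jump n x * (X n x `^ p * V n x))%:E)%E.
Proof.
have mmp k : measurable_for (A k) (fun x => m k x `^ p) by exact: measurable_for_powR.
have mp_nd k x : m k x `^ p <= m k.+1 x `^ p.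
  by apply: le_powR => //; [exact: ltW|exact: running_max_leS].
have mp0 x : 0 <= m 0%N x `^ p by exact: powR_ge0.
rewrite (telescoping AT AS M mmp mp0 mp_nd mv v0 cV).
have mj n : measurable_for (A n) (fun x => relative_jump n x * (X n x `^ p * V n x)).
  apply: measurable_forM; first exact: measurable_for_relative_jump.
  by apply: measurable_forM => //; exact: measurable_for_powR.
have j0 n x : 0 <= relative_jump n x * (X n x `^ p * V n x).
  by rewrite mulr_ge0 ?relative_jump_ge0// mulr_ge0 ?powR_ge0.
rewrite ge0_sume_distrr; last by move=> n _; exact: integral_ge0_real.
apply: lee_sum => n _; rewrite -ge0_integralZl_real//; [|exact: ltW|exact: (mT (k := n))].
apply: ge0_le_integral_real.
- by apply: (mT (k := n)); apply: measurable_forM => //; exact: measurable_for_increment.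
- by apply: (mT (k := n)); apply: measurable_forM; [exact: measurable_for_cst|].
- by move=> x; rewrite mulr_ge0//; apply: increment_ge0.
move=> x; rewrite !mulrA ler_wpM2r//.
have key y : 0 <= y -> y <= m n x -> m n x = X n x ->
    m n x `^ p - y `^ p <= p * (m n x - y) / m n x * X n x `^ p.
  move=> y0 ym mE; apply: le_trans (powRB_le_exponent p1 y0 ym) _.
  rewrite -!mulrA ler_wpM2l ?(ltW p0)// -mE mulrC ler_wpM2l ?subr_ge0//.
  by rewrite -[in leRHS](mulr_powRB1 (m0 n x) p0) mulrA; have [->|mne] :=
    eqVneq (m n x) 0; rewrite ?powR0 ?mulr0 ?subr_eq0 ?gt_eqF// mulVf// mul1r.
have [E|[k nk E]] := running_max_new X n x; last first.
  have incrE theta : increment theta n x = theta n x - theta k x by rewrite /increment nk.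
  by rewrite /relative_jump !incrE/= E !subrr mulr0 !mul0r.
rewrite /relative_jump /increment; case: (n : nat) key E => [|j] key E.
  have := key 0 (lexx _) (m0 _ _) E; rewrite powR0 ?gt_eqF//.
by apply: key => //; exact: running_max_leS.
Qed.

(** Tm n stands for the tailed maximal function of sigma from time n on. The
    running maximum h of the selected means only grows at times n inside Sb n,
    so that the increments of h^p are admissible weights for the tail
    hypothesis; the sum over k of these increments times Tm k dominates every
    h_n^p Sg_n. *)
Lemma tail_domination M (Sb : nat -> set T) (D : R) (Tm : nat -> T -> R) :
  0 <= D -> (forall n, <<s A n >> (Sb n)) ->
  (forall n, measurable_fun [set: T] (Tm n)) -> (forall n x, 0 <= Tm n x) ->
  (forall n k x, (n <= k <= M)%N -> Sg k x <= Tm n x) ->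
  (forall n psi, (n <= M)%N -> measurable_for (A n) psi -> (forall x, 0 <= psi x) ->
    (forall x, ~ Sb n x -> psi x = 0) ->
    (\int[mu]_x (psi x * Tm n x)%:E <= D%:E * \int[mu]_x (psi x * sigma x)%:E)%E) ->
  (\sum_(n < M.+1) \int[mu]_x
      (relative_jump n x * (\1_(Sb n) x * (F n x `^ p * Sg n x)))%:E <=
    (2 * D * (2 * (p / (p - 1))) `^ p)%:E *
      \int[mu]_x (g x `^ p * sigma x)%:E)%E.
Proof.
move=> D0 ASb mTm Tm0 STm tail.
pose Fs n x := \1_(Sb n) x * F n x.
have mFs n : measurable_for (A n) (Fs n).
  by apply: measurable_forM => //; exact: measurable_for_indic.
have Fs0 n x : 0 <= Fs n x by rewrite mulr_ge0.
pose h n x := running_max Fs n x.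
have h0 n x : 0 <= h n x by exact: running_max_ge0.
have mh n : measurable_for (A n) (h n) by exact: measurable_for_running_max.
pose hp n x := h n x `^ p.
have mhp n : measurable_for (A n) (hp n) by exact: measurable_for_powR.
have hp0 n x : 0 <= hp n x by exact: powR_ge0.
have hp_nd n x : hp n x <= hp n.+1 x.
  by apply: le_powR => //; [exact: ltW|exact: running_max_leS].
have i0 n x : 0 <= increment hp n x by exact: increment_ge0.
have mi n : measurable_for (A n) (increment hp n) by exact: measurable_for_increment.
pose Hs x := \sum_(k < M.+1) increment hp k x * Tm k x.
have mHs : measurable_fun [set: T] Hs.
  apply: measurable_sum => k; apply: measurable_funM => //.
  exact: (mT (k := k)).
have mH n : measurable_for (A n) (fun x => \1_(Sb n) x * (F n x `^ p * Sg n x)).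
  apply: measurable_forM; first exact: measurable_for_indic.
  by apply: measurable_forM => //; exact: measurable_for_powR.
have H0 n x : 0 <= \1_(Sb n) x * (F n x `^ p * Sg n x) :> R.
  by rewrite !mulr_ge0// powR_ge0.
have HHs n x : (n <= M)%N -> \1_(Sb n) x * (F n x `^ p * Sg n x) <= Hs x.
  move=> nM.
  apply: (@le_trans _ _ (hp n x * Sg n x)).
    rewrite mulrA ler_wpM2r// /hp.
    apply: (@le_trans _ _ (Fs n x `^ p)).
      rewrite /Fs indicE; case: (x \in Sb n); rewrite ?mul1r// mul0r.
      exact: powR_ge0.
    by apply: le_powR => //; [exact: ltW|exact: le_running_max].
  rewrite -(sum_increment hp) mulr_suml.
  apply: (@le_trans _ _ (\sum_(k < n.+1) increment hp k x * Tm k x)).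
    apply: ler_sum => k _; rewrite ler_wpM2l// STm//.
    by rewrite -ltnS ltn_ord nM.
  rewrite /Hs -!(big_mkord xpredT (fun k => increment hp k x * Tm k x)).
  rewrite [leRHS](@big_cat_nat _ _ _ n.+1)//= lerDl.
  by apply: sumr_ge0 => k _; rewrite mulr_ge0.
have := sparse_sum AT AS cX mH H0 mHs HHs => /le_trans; apply.
have IHs : (\int[mu]_x (Hs x)%:E <= D%:E *
    \int[mu]_x (h M x `^ p * sigma x)%:E)%E.
  rewrite (telescoping AT AS M mhp (hp0 _) hp_nd msigma sigma0 cS).
  rewrite (@ge0_integral_sum_real _ _ _ mu _ (fun k x => increment hp k x * Tm k x)); last 2 first.
  - by move=> k; apply: measurable_funM => //; exact: (mT (k := k)).
  - by move=> k x; rewrite mulr_ge0.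
  rewrite ge0_sume_distrr; last first.
    by move=> k _; apply: integral_ge0_real => x; rewrite mulr_ge0.
  apply: lee_sum => k _.
  have [_ _ ->//] := cS k.
  apply: tail => //; first by rewrite -ltnS.
  move=> x Sbx; have [E|[j kj E]] := running_max_new Fs k x; last first.
    have -> : increment hp k x = hp k x - hp j x by rewrite /increment kj.
    by rewrite /hp /h E subrr.
  have hk0 : h k x = 0 by rewrite /h E /Fs indicE memNset// mul0r.
  apply/eqP; rewrite eq_le i0 andbT.
  rewrite /increment /hp hk0 powR0 ?gt_eqF//; case: (k : nat) => [|j].
    by rewrite subr0.
  by rewrite sub0r oppr_le0 powR_ge0.
have hF x : h M x <= running_max F M x.
  apply: running_max_ub => k kM; apply: le_trans (le_running_max_of _ _ kM).
  by rewrite /Fs ler_piMl// indicE; case: (_ \in _).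
have [AG _ ndG GT] := exG.
have doob := doob_weighted AT AS msigma sigma0 mg g0 cS Spos cX AG ndG GT Gfin M p1.
have hdoob : (\int[mu]_x (h M x `^ p * sigma x)%:E <=
    ((2 * (p / (p - 1))) `^ p)%:E * \int[mu]_x (g x `^ p * sigma x)%:E)%E.
  apply: le_trans doob; apply: ge0_le_integral_real.
  - by apply: measurable_funM => //; exact: (mT (mhp M)).
  - apply: measurable_funM => //; apply: (mT (k := M)).
    by apply: measurable_for_powR; exact: measurable_for_running_max.
  - by move=> x; rewrite mulr_ge0// powR_ge0.
  - by move=> x; rewrite ler_wpM2r//; apply: le_powR => //; exact: ltW.
rewrite -mulrA EFinM -muleA lee_wpmul2l ?lee_fin//.
apply: le_trans IHs _; rewrite EFinM -muleA lee_wpmul2l//.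
Qed.

(** Several selections Sb l are allowed at once, each with its own tail
    constant D l, in order to split the space by the size of the product
    V_n Sg_n^(p-1). A single selection equal to the whole space gives the bound
    by A_p and A*_infinity. *)
Proposition maximal_tail_bound M L (a D : nat -> R) (Sb : nat -> nat -> set T)
    (Tm : nat -> T -> R) :
  (forall l, 0 <= a l) -> (forall l, 0 <= D l) ->
  (forall l n, <<s A n >> (Sb l n)) ->
  (forall n, measurable_fun [set: T] (Tm n)) -> (forall n x, 0 <= Tm n x) ->
  (forall n k x, (n <= k <= M)%N -> Sg k x <= Tm n x) ->
  (forall l n psi, (n <= M)%N -> measurable_for (A n) psi -> (forall x, 0 <= psi x) ->
    (forall x, ~ Sb l n x -> psi x = 0) ->
    (\int[mu]_x (psi x * Tm n x)%:E <=
     (D l)%:E * \int[mu]_x (psi x * sigma x)%:E)%E) ->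
  (forall n, {ae mu, forall x, V n x * Sg n x `^ (p - 1) <=
     \sum_(l < L) a l * \1_(Sb l n) x}) ->
  (\int[mu]_x (m M x `^ p * v x)%:E <=
   (2 * p * (2 * (p / (p - 1))) `^ p * \sum_(l < L) a l * D l)%:E *
     \int[mu]_x (g x `^ p * sigma x)%:E)%E.
Proof.
move=> a0 D0 ASb mTm Tm0 STm tail aeV.
set K := (2 * (p / (p - 1))) `^ p.
have K0 : 0 <= K by exact: powR_ge0.
apply: le_trans (maximal_le_relative_jump_sum M) _.
set I := (\int[mu]_x (g x `^ p * sigma x)%:E)%E.
have I0 : (0 <= I)%E by apply: integral_ge0_real => x; rewrite mulr_ge0// powR_ge0.
have mH l n : measurable_for (A n) (fun x => \1_(Sb l n) x * (F n x `^ p * Sg n x)).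
  apply: measurable_forM; first exact: measurable_for_indic.
  by apply: measurable_forM => //; exact: measurable_for_powR.
have H0 l n x : 0 <= \1_(Sb l n) x * (F n x `^ p * Sg n x) :> R.
  by rewrite !mulr_ge0// powR_ge0.
have mj l n : measurable_fun [set: T]
    (fun x => relative_jump n x * (\1_(Sb l n) x * (F n x `^ p * Sg n x))).
  by apply: (mT (k := n)); apply: measurable_forM => //; exact: measurable_for_relative_jump.
have j0 l n x : 0 <= relative_jump n x * (\1_(Sb l n) x * (F n x `^ p * Sg n x)).
  by rewrite mulr_ge0 ?relative_jump_ge0.
have step n : (\int[mu]_x (relative_jump n x * (X n x `^ p * V n x))%:E <=
    \sum_(l < L) (a l)%:E * \int[mu]_x
      (relative_jump n x * (\1_(Sb l n) x * (F n x `^ p * Sg n x)))%:E)%E.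
  apply: (@le_trans _ _ (\int[mu]_x (\sum_(l < L)
      a l * (relative_jump n x * (\1_(Sb l n) x * (F n x `^ p * Sg n x))))%:E)%E).
    apply: ae_ge0_le_integral_real.
    - apply: (mT (k := n)); apply: measurable_forM; first exact: measurable_for_relative_jump.
      by apply: measurable_forM => //; exact: measurable_for_powR.
    - by apply: measurable_sum => l; apply: measurable_funM.
    - by move=> x; rewrite mulr_ge0 ?relative_jump_ge0// mulr_ge0 ?powR_ge0.
    - by move=> x; apply: sumr_ge0 => l _; rewrite mulr_ge0.
    apply: filterS (aeV n) => x Vx.
    have -> : X n x `^ p * V n x =
        F n x `^ p * Sg n x * (V n x * Sg n x `^ (p - 1)).
      rewrite -(weighted_meanK X Spos) powRM// -[Sg n x `^ p](mulr_powRB1 (S0 n x) p0).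
      ring.
    have -> : \sum_(l < L) a l * (relative_jump n x * (\1_(Sb l n) x * (F n x `^ p * Sg n x)))
        = relative_jump n x * (F n x `^ p * Sg n x * \sum_(l < L) a l * \1_(Sb l n) x).
      by rewrite !mulr_sumr; apply: eq_bigr => l _; ring.
    by rewrite ler_wpM2l ?relative_jump_ge0// ler_wpM2l// mulr_ge0// powR_ge0.
  rewrite (@ge0_integral_sum_real _ _ _ mu _ (fun l x =>
    a l * (relative_jump n x * (\1_(Sb l n) x * (F n x `^ p * Sg n x))))).
  - by apply: lee_sum => l _; rewrite ge0_integralZl_real.
  - by move=> l; apply: measurable_funM.
  - by move=> l x; rewrite mulr_ge0.
apply: (@le_trans _ _ (p%:E * \sum_(n < M.+1) \sum_(l < L) (a l)%:E * \int[mu]_x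
      (relative_jump n x * (\1_(Sb l n) x * (F n x `^ p * Sg n x)))%:E)%E).
  by rewrite lee_wpmul2l ?lee_fin ?(ltW p0)//; apply: lee_sum.
rewrite exchange_big/=.
rewrite (_ : 2 * p * K * _ = p * \sum_(l < L) a l * (2 * D l * K)); last first.
  rewrite -!mulrA !mulr_sumr; apply: eq_bigr => l _; ring.
rewrite EFinM -muleA lee_wpmul2l ?lee_fin ?(ltW p0)//.
rewrite -sumEFin ge0_sume_distrl; last first.
  by move=> l _; rewrite lee_fin !mulr_ge0.
apply: lee_sum => l _.
rewrite -ge0_sume_distrr; last by move=> n _; exact: integral_ge0_real.
rewrite EFinM -muleA lee_wpmul2l ?lee_fin//.
by apply: (tail_domination (Tm := Tm)) => // n psi; exact: tail.
Qed.

(** Here Y_n^2 stands for the geometric mean exp(E_n(log sigma)), which it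
    dominates. With u^2 = sigma (sup_k F_k)^p, the product F_n^(p/2) Y_n is at
    most the conditional expectation of u; two applications of Doob's
    inequality, with exponents 2 and p, follow. *)
Proposition maximal_geometric_bound M (Y : nat -> T -> R) (B : R) : 0 < B ->
  (forall n, nonneg_condexp mu (A n) (fun x => sigma x `^ 2^-1) (Y n)) ->
  (forall n, {ae mu, forall x, V n x * Sg n x `^ p <= B * Y n x ^+ 2}) ->
  (\int[mu]_x (m M x `^ p * v x)%:E <=
   (2 * p * B * (2 * (2 / (2 - 1))) `^ 2 * (2 * (p / (p - 1))) `^ p)%:E *
     \int[mu]_x (g x `^ p * sigma x)%:E)%E.
Proof.
move=> B0 cY aeV.
set K := (2 * (p / (p - 1))) `^ p; set K2 := (2 * (2 / (2 - 1))) `^ 2.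
have K0 : 0 < K.
  by apply: powR_gt0; rewrite mulr_gt0// divr_gt0// subr_gt0.
have K20 : 0 < K2 by apply: powR_gt0; rewrite mulr_gt0// divr_gt0// subr_gt0 ltr1n.
set I := (\int[mu]_x (g x `^ p * sigma x)%:E)%E.
have I0 : (0 <= I)%E by apply: integral_ge0_real => x; rewrite mulr_ge0// powR_ge0.
have C0 : 0 < 2 * p * B * K2 * K by rewrite !mulr_gt0.
(* A finite right side makes u locally integrable. *)
have [->|] := eqVneq I +oo%E; first by rewrite gt0_muley ?lte_fin// leey.
rewrite -ltey => finI.
have [AG Gmu ndG GT] := exG.
have doob := doob_weighted AT AS msigma sigma0 mg g0 cS Spos cX AG ndG GT Gfin M p1.
rewrite -/K -/I in doob.
pose h x := running_max F M x.
have h0 x : 0 <= h x by exact: running_max_ge0.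
have mh : measurable_fun [set: T] h.
  by apply: (mT (k := M)); exact: measurable_for_running_max.
pose u x := sigma x `^ 2^-1 * h x `^ (p / 2).
have u0 x : 0 <= u x by rewrite mulr_ge0 ?powR_ge0.
have mu_ : measurable_fun [set: T] u.
  by apply: measurable_funM; exact: measurable_fun_powR.
have u2 x : u x `^ 2 = h x `^ p * sigma x.
  rewrite /u powRM ?powR_ge0// -!powRrM mulVf// powRr1// mulrC.
  by rewrite divfK.
have finu2 : (\int[mu]_x (u x `^ 2)%:E < +oo)%E.
  under eq_integral do rewrite u2.
  apply: le_lt_trans doob _.
  by rewrite lte_mul_pinfty ?lee_fin// ltW.
have exGn n : exhausting mu (A n) G.
  split=> // k; apply: (generatedS (filtration_le AS (leq0n n))).
  exact: AG.
have finGu k : (\int[mu]_(x in G k) (u x)%:E < +oo)%E.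
  have mGk : measurable (G k) := generated_measurable (AT (n := 0%N)) (AG k).
  apply: (@le_lt_trans _ _ (\int[mu]_(x in G k) (1 + u x `^ 2)%:E)%E).
    apply: ge0_le_integral => //.
    - by move=> x _; rewrite lee_fin.
    - by apply/measurable_EFinP; exact: measurable_funTS.
    - apply/measurable_EFinP; apply: measurable_funTS.
      by apply: measurable_funD => //; exact: measurable_fun_powR.
    - move=> x _; rewrite lee_fin powR_mulrn//.
      have := sqr_ge0 (u x - 1); rewrite !expr2 => ?; have := u0 x; nra.
  under eq_integral do rewrite EFinD.
  rewrite ge0_integralD//; last 2 first.
  - by move=> x _; rewrite lee_fin powR_ge0.
  - apply/measurable_EFinP; apply: measurable_funTS; exact: measurable_fun_powR.
  rewrite integral_cst// mul1e lte_add_pinfty//.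
  apply: le_lt_trans finu2; apply: ge0_subset_integral => //.
  - by apply/measurable_EFinP; exact: measurable_fun_powR.
  - by move=> x _; rewrite lee_fin powR_ge0.
have /choice[Z cZ] : forall n, exists Zn, nonneg_condexp mu (A n) u Zn.
  by move=> n; apply: (nonneg_condexp_exists (AT (n := n)) (exGn n)).
have mZ n : measurable_for (A n) (Z n) by have [] := cZ n.
have Z0 n x : 0 <= Z n x by have [] := cZ n.
have mY n : measurable_for (A n) (Y n) by have [] := cY n.
have Y0 n x : 0 <= Y n x by have [] := cY n.
have FYZ n : (n <= M)%N ->
    {ae mu, forall x, F n x `^ (p / 2) * Y n x <= Z n x}.
  move=> nM; apply: (ae_le_of_sets (AT (n := n)) (exGn n)) => //.
  - by apply: measurable_forM => //; exact: measurable_for_powR.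
  - by move=> x; rewrite mulr_ge0 ?powR_ge0.
  move=> Q AQ _.
  have onQ (f : T -> R) : (\int[mu]_(x in Q) (f x)%:E =
      \int[mu]_x (\1_Q x * f x)%:E)%E.
    rewrite integral_mkcond; apply: eq_integral => x _.
    by rewrite patchE indicE; case: ifPn => _; rewrite (mul1r, mul0r).
  have mQ : measurable_for (A n) (\1_Q : T -> R) by exact: measurable_for_indic.
  have mFp : measurable_for (A n) (fun x => F n x `^ (p / 2)) by exact: measurable_for_powR.
  rewrite !onQ; have [_ _ ->//] := cZ n.
  under eq_integral do rewrite mulrA.
  have [_ _ ->] := cY n; last 2 first.
  - exact: measurable_forM.
  - by move=> x; rewrite mulr_ge0 ?powR_ge0.
  apply: ge0_le_integral_real.
  - apply: measurable_funM; last exact: measurable_fun_powR.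
    by apply: (mT (k := n)); exact: measurable_forM.
  - by apply: measurable_funM => //; exact: (mT mQ).
  - by move=> x; rewrite !mulr_ge0 ?powR_ge0.
  - move=> x; rewrite -mulrA ler_wpM2l// /u mulrC ler_wpM2l ?powR_ge0//.
    apply: le_powR => //; first by rewrite divr_ge0// ltW.
    exact: le_running_max_of.
have m1 : measurable_fun [set: T] (fun=> 1 : R) by exact: measurable_cst.
have c1 n : nonneg_condexp mu (A n) (fun=> 1) (fun=> 1).
  by split => //; exact: measurable_for_cst.
have cZ1 n : nonneg_condexp mu (A n) (fun x => u x * 1) (Z n).
  by rewrite (_ : (fun x => _) = u)//; apply/funext => x; rewrite mulr1.
have Gmu1 k : (\int[mu]_(x in G k) 1%:E < +oo)%E.
  by rewrite integral_cst ?mul1e//; exact: (generated_measurable (AT (n := 0%N)) (AG k)).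
have lt12 : 1 < 2 :> R by rewrite ltr1n.
have doob2 := doob_weighted AT AS m1 (fun=> ler01) mu_ u0
  c1 (fun _ _ => ltr01) cZ1 AG ndG GT Gmu1 M lt12.
have FZ : weighted_mean (fun _ _ => 1) Z = Z.
  by apply/funext => n; apply/funext => x; rewrite /weighted_mean divr1.
rewrite FZ -/K2 in doob2.
apply: le_trans (maximal_le_relative_jump_sum M) _.
pose H n x := Z n x ^+ 2.
have mH n : measurable_for (A n) (H n) by exact: measurable_forM.
have H0 n x : 0 <= H n x by exact: sqr_ge0.
pose Hs x := running_max Z M x `^ 2.
have mHs : measurable_fun [set: T] Hs.
  apply: measurable_fun_powR; apply: (mT (k := M)); exact: measurable_for_running_max.
have HHs n x : (n <= M)%N -> H n x <= Hs x.
  move=> nM; rewrite /H -powR_mulrn//; apply: le_powR => //.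
  exact: le_running_max_of.
have sp := sparse_sum AT AS cX mH H0 mHs HHs.
have mj n : measurable_fun [set: T] (fun x => relative_jump n x * H n x).
  by apply: (mT (k := n)); apply: measurable_forM => //; exact: measurable_for_relative_jump.
have j0 n x : 0 <= relative_jump n x * H n x by rewrite mulr_ge0 ?relative_jump_ge0.
have step : (\sum_(n < M.+1) \int[mu]_x (relative_jump n x * (X n x `^ p * V n x))%:E <=
    B%:E * \sum_(n < M.+1) \int[mu]_x (relative_jump n x * H n x)%:E)%E.
  rewrite ge0_sume_distrr; last by move=> n _; exact: integral_ge0_real.
  apply: lee_sum => n _; rewrite -ge0_integralZl_real//; last exact: ltW.
  apply: ae_ge0_le_integral_real.
  - apply: (mT (k := n)); apply: measurable_forM; first exact: measurable_for_relative_jump.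
    by apply: measurable_forM => //; exact: measurable_for_powR.
  - exact: measurable_funM.
  - by move=> x; rewrite mulr_ge0 ?relative_jump_ge0// mulr_ge0 ?powR_ge0.
  - by move=> x; rewrite mulr_ge0// ltW.
  have nM : (n <= M)%N by rewrite -ltnS.
  apply: filterS2 (aeV n) (FYZ n nM) => x Vx FYx.
  rewrite [leRHS]mulrCA ler_wpM2l ?relative_jump_ge0//.
  have -> : X n x `^ p * V n x = F n x `^ p * (V n x * Sg n x `^ p).
    rewrite -(weighted_meanK X Spos) powRM//; ring.
  apply: (@le_trans _ _ (F n x `^ p * (B * Y n x ^+ 2))).
    by rewrite ler_wpM2l ?powR_ge0.
  rewrite [leLHS]mulrCA ler_wpM2l ?(ltW B0)// /H.
  have -> : F n x `^ p = (F n x `^ (p / 2)) ^+ 2.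
    by rewrite -powR_mulrn ?powR_ge0// -powRrM divfK.
  by rewrite -exprMn ler_sqr ?nnegrE// mulr_ge0 ?powR_ge0.
have {}step := le_trans step (lee_wpmul2l _ sp).
have step2 : (\int[mu]_x (Hs x)%:E <= K2%:E * (K%:E * I))%E.
  have -> : (\int[mu]_x (Hs x)%:E = \int[mu]_x (running_max Z M x `^ 2 * 1)%:E)%E.
    by apply: eq_integral => x _; rewrite mulr1.
  apply: le_trans doob2 _; rewrite lee_wpmul2l ?lee_fin ?(ltW K20)//.
  apply: le_trans doob; under eq_integral do rewrite mulr1 u2.
  by [].
apply: (@le_trans _ _ (p%:E * (B%:E * (2%:E * (K2%:E * (K%:E * I)))))%E).
  rewrite lee_wpmul2l ?lee_fin ?(ltW p0)//.
  apply: le_trans (step _) _; first by rewrite lee_fin ltW.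
  by rewrite !lee_wpmul2l ?lee_fin ?(ltW B0).
rewrite !muleA -!EFinM (_ : p * B * 2 * K2 * K = 2 * p * B * K2 * K)//.
by ring.
Qed.

End finite_horizon.

(** * Versions and almost everywhere comparisons *)

Section integrals_of_arbitrary_functions.
Context {d : measure_display} {T : measurableType d} {R : realType}.
Variable mu : {measure set T -> \bar R}.
Implicit Types (D N : set T) (f g : T -> \bar R).

(** The Doob maximal function is a supremum over all integer times of arbitrary
    versions; monotonicity without measurability spares the proof that it is
    measurable. *)
Lemma le_integral_subset D1 D2 f g : D1 `<=` D2 ->
  (forall x, D1 x -> (0 <= f x)%E) -> (forall x, D2 x -> (0 <= g x)%E) ->
  (forall x, D1 x -> (f x <= g x)%E) ->
  (\int[mu]_(x in D1) f x <= \int[mu]_(x in D2) g x)%E.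
Proof.
move=> D12 f0 g0 fg.
have g00 x : (0 <= (g \_ D2) x)%E.
  by rewrite patchE; case: ifPn => //; rewrite inE => /g0.
have fgD x : ((f \_ D1) x <= (g \_ D2) x)%E.
  rewrite patchE; case: ifPn => // /set_mem D1x.
  by rewrite patchE mem_set; [exact: fg|exact: D12].
have f00 x : (0 <= (f \_ D1) x)%E.
  by rewrite patchE; case: ifPn => //; rewrite inE => /f0.
rewrite integral_mkcond [leRHS]integral_mkcond !ge0_integralTE//.
apply: le_ereal_sup => _ [h hf <-]; exists h => //= x.
exact: le_trans (hf x) (fgD x).
Qed.

Lemma le_integral_nonmeasurable D f g :
  (forall x, D x -> (0 <= f x)%E) ->
  (forall x, D x -> (f x <= g x)%E) ->
  (\int[mu]_(x in D) f x <= \int[mu]_(x in D) g x)%E.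
Proof.
move=> f0 fg; apply: le_integral_subset => // x Dx.
exact: le_trans (f0 _ Dx) (fg _ Dx).
Qed.

Lemma ae_le_integral_right D f g : measurable D -> measurable_fun D g ->
  (forall x, D x -> (0 <= f x)%E) -> (forall x, D x -> (0 <= g x)%E) ->
  {ae mu, forall x, D x -> (f x <= g x)%E} ->
  (\int[mu]_(x in D) f x <= \int[mu]_(x in D) g x)%E.
Proof.
move=> mD mg f0 g0 [N [mN N0 subN]].
(* On the null set N the bound is lost, so g is raised to +oo there. *)
pose g' x := maxe (g x) (+oo * (\1_N x)%:E)%E.
have mg' : measurable_fun D g'.
  apply: measurable_maxe => //; apply: measurable_funeM.
  by apply/measurable_EFinP; exact: measurable_indic.
have gg' x : (g x <= g' x)%E by rewrite le_max lexx.
have g'0 x : D x -> (0 <= g' x)%E by move=> /g0 /le_trans; apply.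
apply: (@le_trans _ _ (\int[mu]_(x in D) g' x)%E).
  apply: le_integral_nonmeasurable => // x Dx; rewrite /g' indicE.
  case: (boolP (x \in N)) => [_|/negP xN].
    by rewrite mule1 le_max leey orbT.
  rewrite le_max; apply/orP; left.
  by apply: contrapT => nle; apply: xN; rewrite inE; apply: subN => /(_ Dx).
rewrite le_eqVlt; apply/orP; left; apply/eqP.
apply: ge0_ae_eq_integral => //.
exists N; split => // x /= nE; apply: contrapT => xN; apply: nE => Dx.
by rewrite /g' indicE memNset// mule0 max_l// g0.
Qed.

Lemma ae_le_integral_left D f g : measurable D -> measurable_fun D f ->
  (forall x, D x -> (0 <= f x)%E) -> (forall x, D x -> (0 <= g x)%E) ->
  {ae mu, forall x, D x -> (f x <= g x)%E} ->
  (\int[mu]_(x in D) f x <= \int[mu]_(x in D) g x)%E.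
Proof.
move=> mD mf f0 g0 [N [mN N0 subN]].
rewrite (ge0_negligible_integral mN mD mf f0 N0).
apply: le_integral_subset => // [x []|x [Dx xN]]; first by move=> + _; exact: f0.
by apply: contrapT => nle; apply: xN; apply: subN => /(_ Dx).
Qed.

End integrals_of_arbitrary_functions.

Section versions.
Context {d : measure_display} {T : measurableType d} {R : realType}.
Variable mu : {measure set T -> \bar R}.
Implicit Types (A : set (set T)) (u X : T -> R).

Lemma nonneg_condexp_set A u X Q : nonneg_condexp mu A u X -> <<s A >> Q ->
  (\int[mu]_(x in Q) (X x)%:E = \int[mu]_(x in Q) (u x)%:E)%E.
Proof.
move=> [_ _ XE] AQ.
have onQ (f : T -> R) : (\int[mu]_(x in Q) (f x)%:E =
    \int[mu]_x (\1_Q x * f x)%:E)%E.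
  rewrite integral_mkcond; apply: eq_integral => x _.
  by rewrite patchE indicE; case: ifPn => _; rewrite (mul1r, mul0r).
by rewrite !onQ XE//; exact: measurable_for_indic.
Qed.

Lemma nonneg_condexp_ae A u u' X X' : A `<=` measurable ->
  measurable_fun [set: T] u -> measurable_fun [set: T] u' ->
  (forall x, 0 <= u x) -> (forall x, 0 <= u' x) -> {ae mu, forall x, u x = u' x} ->
  measurable_for A X' -> (forall x, 0 <= X' x) -> {ae mu, forall x, X x = X' x} ->
  nonneg_condexp mu A u X -> nonneg_condexp mu A u' X'.
Proof.
move=> AT mu_ mu' u0 u'0 uu' mX' X'0 XX' [mX X0 XE]; split=> // psi mpsi psi0.
have mpsiT := measurable_for_measurable AT mpsi.
have aeE (f g : T -> R) : measurable_fun [set: T] f ->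
    measurable_fun [set: T] g -> (forall x, 0 <= f x) -> (forall x, 0 <= g x) ->
    {ae mu, forall x, f x = g x} ->
    (\int[mu]_x (psi x * f x)%:E = \int[mu]_x (psi x * g x)%:E)%E.
  move=> mf mg f0 g0 fg; apply: ge0_ae_eq_integral => //.
  - by apply/measurable_EFinP; exact: measurable_funM.
  - by apply/measurable_EFinP; exact: measurable_funM.
  - by move=> x _; rewrite lee_fin mulr_ge0.
  - by move=> x _; rewrite lee_fin mulr_ge0.
  - by apply: filterS fg => x -> _.
rewrite -(aeE X)//; try exact: (measurable_for_measurable AT).
by rewrite XE// (aeE u u').
Qed.

Lemma ae_le_of_integrable_sets A G (U V : T -> R) :
  A `<=` measurable -> exhausting mu A G -> measurable_for A U -> measurable_for A V ->
  (forall Q, <<s A >> Q -> (mu Q < +oo)%E ->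
    [/\ mu.-integrable Q (EFin \o U), mu.-integrable Q (EFin \o V) &
     (\int[mu]_(x in Q) (U x)%:E <= \int[mu]_(x in Q) (V x)%:E)%E]) ->
  {ae mu, forall x, U x <= V x}.
Proof.
move=> AT [AG Gfin ndG GT] mU mV UV.
have mUT := measurable_for_measurable AT mU; have mVT := measurable_for_measurable AT mV.
pose D k := [set x | V x < U x] `&` G k.
have AD k : <<s A >> (D k) by apply: generated_setI => //; exact: measurable_for_lt.
have mD k := generated_measurable AT (AD k).
have mG k := generated_measurable AT (AG k).
have finD k : (mu (D k) < +oo)%E.
  by apply: le_lt_trans (Gfin k); apply: le_measure; rewrite ?inE//; exact: subIsetr.
have muD k : mu (D k) = 0%E.
  apply: (@positive_integral_null _ _ _ mu _ (fun x => (U x - V x)%:E)) => //.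
  - by apply/measurable_EFinP; apply: measurable_funTS; exact: measurable_funB.
  - by move=> x [/= + _]; rewrite lte_fin subr_gt0.
  have [iU iV IUV] := UV _ (AD k) (finD k).
  under eq_integral do rewrite EFinB.
  rewrite (integralB (mD k) iU iV) sube_le0//.
have [N [mN N0 subN]] : mu.-negligible (\bigcup_k D k).
  by apply: negligible_bigcup => k; apply/(negligibleP mu (mD k)); exact: muD.
exists N; split=> //; apply: subset_trans subN => x /= /negP; rewrite -ltNge => VU.
by have : [set: T] x by []; rewrite -GT => -[k _ Gk]; exists k.
Qed.

(** The integral of u over the set where X vanishes is that of X, hence zero. *)
Lemma nonneg_condexp_positive A u X : A `<=` measurable ->
  measurable_fun [set: T] u -> (forall x, 0 <= u x) ->
  {ae mu, forall x, 0 < u x} -> nonneg_condexp mu A u X -> {ae mu, forall x, 0 < X x}.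
Proof.
move=> AT mu_ u0 upos cX; have [mX X0 _] := cX.
pose D := [set x | X x <= 0].
have AD : <<s A >> D by apply: measurable_for_le => //; exact: measurable_for_cst.
have mD := generated_measurable AT AD.
pose P := [set x | 0 < u x].
have mP : measurable P.
  have := measurable_fun_ltr (measurable_cst (0 : R)) mu_ measurableT (Y := [set true]) I.
  by rewrite setTI.
have PD0 : mu (D `&` P) = 0%E.
  apply: (@positive_integral_null _ _ _ mu _ (fun x => (u x)%:E)).
  - exact: measurableI.
  - by apply/measurable_EFinP; exact: measurable_funTS.
  - by move=> x [].
  apply: (@le_trans _ _ (\int[mu]_(x in D) (u x)%:E)%E).
    apply: ge0_subset_integral => //; first exact: measurableI.
      by apply/measurable_EFinP; exact: measurable_funTS.
    by move=> x _; rewrite lee_fin.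
  rewrite -(nonneg_condexp_set cX AD) integral0_eq// => x Dx.
  by congr EFin; apply/eqP; rewrite eq_le X0 andbT.
apply: (@negligibleS _ _ _ _ (~` P `|` D `&` P)).
  move=> x /= /negP; rewrite -leNgt => Dx.
  by have [Px|nPx] := pselect (P x); [right|left].
apply: negligibleU; first exact: upos.
by apply/negligibleP => //; exact: measurableI.
Qed.

End versions.

(** * Conditional expectations along a sigma-finite filtration *)

Section filtered_space.
Context {d : measure_display} {T : measurableType d} {R : realType}.
Variable mu : {measure set T -> \bar R}.
Variable F : int -> set (set T).
Hypothesis hF : sigma_finite_filtration mu F.

Lemma filtration_measurable i : F i `<=` measurable.
Proof. by have [_ + _ _] := hF; apply. Qed.

Lemma filtration_sigmaE i : <<s F i >> = F i.
Proof. by have [+ _ _ _] := hF => /(_ i); exact: sigma_algebra_id. Qed.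

Lemma filtration_exhausting i : exists G, exhausting mu (F i) G.
Proof.
have [_ FT _ /(_ i)[G GT GP]] := hF.
have mG n : measurable (G n) by have [/FT] := GP n.
exists (fun k => \bigcup_(n in `I_k.+1) G n); split.
- move=> k; rewrite bigcup_mkord.
  by apply: (@bigsetU_measurable _ (g_sigma_algebraType (F i))) => n _;
    apply: sub_sigma_algebra; have [] := GP n.
- move=> k; rewrite bigcup_mkord.
  apply: (@le_lt_trans _ _ _ _ _ (@Boole_inequality _ _ _ mu G k.+1 (fun n _ => mG n))).
  by apply: lte_sum_pinfty => n _; have [] := GP n.
- move=> a b ab; apply/subsetPset => x [n /= na Gn]; exists n => //=.
  exact: leq_trans na _.
- apply/seteqP; split => // x _; have : [set: T] x by []; rewrite -GT => -[n _ Gn].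
  by exists n => //; exists n => /=.
Qed.

Lemma F0_exhausting i G k : exhausting mu (F i) G -> F0 mu F i (G k).
Proof. by move=> [AG Gfin _ _]; split => //; rewrite -filtration_sigmaE. Qed.

Lemma nonneg_condexp_exists_filtration i (u : T -> R) :
  measurable_fun [set: T] u ->
  (forall x, 0 <= u x) ->
  (forall E, F0 mu F i E -> (\int[mu]_(x in E) (u x)%:E < +oo)%E) ->
  exists X, nonneg_condexp mu (F i) u X.
Proof.
move=> mu_ u0 fin; have [G exG] := filtration_exhausting i.
apply: (nonneg_condexp_exists (@filtration_measurable i) exG) => // k.
exact/fin/F0_exhausting.
Qed.

Lemma weight_measurable (w : T -> R) : weight mu F w ->
  measurable_fun [set: T] w.
Proof. by case=> -[]. Qed.

Lemma weight_ge0 (w : T -> R) : weight mu F w -> forall x, 0 <= w x.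
Proof. by case. Qed.

Lemma weight_lty (w : T -> R) i E : weight mu F w -> F0 mu F i E ->
  (\int[mu]_(x in E) (w x)%:E < +oo)%E.
Proof.
move=> [[mw iw] w0] FE; have /integrableP[_] := iw _ _ FE.
by apply: le_lt_trans; apply: le_integral_nonmeasurable => x _;
  [rewrite lee_fin|rewrite /= lee_fin ler_norm].
Qed.

Lemma nonneg_condexp_integrable i (u X : T -> R) E :
  nonneg_condexp mu (F i) u X -> F0 mu F i E ->
  (\int[mu]_(x in E) (u x)%:E < +oo)%E -> mu.-integrable E (EFin \o X).
Proof.
move=> cX [FE _] fin; have [mX X0 _] := cX.
have mXT := measurable_for_measurable (@filtration_measurable i) mX.
apply/integrableP; split; first by apply/measurable_EFinP; exact: measurable_funTS.
under eq_integral do rewrite /= ger0_norm//.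
by rewrite (nonneg_condexp_set cX)// filtration_sigmaE.
Qed.

(** Links the chosen version [condexp] with the nonnegative versions used in the
    proofs. *)
Lemma weight_condexp i (w : T -> R) : weight mu F w ->
  exists2 X, nonneg_condexp mu (F i) w X & {ae mu, forall x, condexp mu F i w x = X x}.
Proof.
move=> ww; have mw := weight_measurable ww; have w0 := weight_ge0 ww.
have [X cX] : exists X, nonneg_condexp mu (F i) w X.
  by apply: nonneg_condexp_exists_filtration => // E; exact: weight_lty.
have [mX X0 _] := cX.
have iX E : F0 mu F i E -> mu.-integrable E (EFin \o X).
  by move=> FE; apply: (nonneg_condexp_integrable cX FE); exact: weight_lty FE.
have XP : is_condexp mu F i w X.
  split=> // E FE; split; first exact: iX.
  by rewrite (nonneg_condexp_set cX)// filtration_sigmaE; case: FE.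
exists X => //.
have [mC CE] : is_condexp mu F i w (condexp mu F i w).
  by apply: xgetPex; exists X.
have [G exG] := filtration_exhausting i.
have FT := @filtration_measurable i.
have FQ Q : <<s F i >> Q -> (mu Q < +oo)%E -> F0 mu F i Q.
  by rewrite filtration_sigmaE.
have le1 : {ae mu, forall x, condexp mu F i w x <= X x}.
  apply: (ae_le_of_integrable_sets FT exG) => // Q AQ finQ.
  have FQ' := FQ _ AQ finQ; have [iC IE] := CE _ FQ'.
  by split=> //; [exact: iX|rewrite IE (nonneg_condexp_set cX)].
have le2 : {ae mu, forall x, X x <= condexp mu F i w x}.
  apply: (ae_le_of_integrable_sets FT exG) => // Q AQ finQ.
  have FQ' := FQ _ AQ finQ; have [iC IE] := CE _ FQ'.
  by split=> //; [exact: iX|rewrite IE (nonneg_condexp_set cX)].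
by apply: filterS2 le1 le2 => x ? ?; apply/eqP; rewrite eq_le; apply/andP.
Qed.

(** If f has no conditional expectation, [condexp] takes its default value 0 and
    the bound holds; otherwise -|f| <= f <= |f| is integrated over sets. *)
Lemma abs_condexp_le i (f X : T -> R) : measurable_fun [set: T] f ->
  (forall E, F0 mu F i E -> (\int[mu]_(x in E) (`|f x|)%:E < +oo)%E) ->
  nonneg_condexp mu (F i) (fun x => `|f x|) X ->
  {ae mu, forall x, `|condexp mu F i f x| <= X x}.
Proof.
move=> mf fin cX; have [mX X0 _] := cX.
have [ex|nex] := pselect (exists g, is_condexp mu F i f g); last first.
  apply: nearW => x; rewrite /condexp xgetPN ?normr0// => g Pg.
  by apply: nex; exists g.
have [mC CE] : is_condexp mu F i f (condexp mu F i f) by exact: xgetPex.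
have [G exG] := filtration_exhausting i.
have FT := @filtration_measurable i.
have FQ Q : <<s F i >> Q -> (mu Q < +oo)%E -> F0 mu F i Q.
  by rewrite filtration_sigmaE.
have iX E : F0 mu F i E -> mu.-integrable E (EFin \o X).
  by move=> FE; apply: (nonneg_condexp_integrable cX FE); exact: fin.
have mabs : measurable_fun [set: T] (fun x => `|f x|).
  exact: measurableT_comp.
have If E : F0 mu F i E -> mu.-integrable E (EFin \o f).
  move=> FE; apply/integrableP; split.
    by apply/measurable_EFinP; exact: measurable_funTS.
  exact: fin FE.
have Iabs E : F0 mu F i E -> mu.-integrable E (fun x => (`|f x|)%:E).
  by move=> FE; exact: (integrable_abse (If _ FE)).
have mE E : F0 mu F i E -> measurable E by move=> [/FT].
have le1 : {ae mu, forall x, condexp mu F i f x <= X x}.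
  apply: (ae_le_of_integrable_sets FT exG) => // Q AQ finQ.
  have FQ' := FQ _ AQ finQ; have [iC IE] := CE _ FQ'.
  split=> //; first exact: iX.
  rewrite IE (nonneg_condexp_set cX)//; apply: le_integral; [exact: mE|exact: If|exact: Iabs|].
  by move=> x _; rewrite lee_fin ler_norm.
have le2 : {ae mu, forall x, - X x <= condexp mu F i f x}.
  apply: (ae_le_of_integrable_sets FT exG) => //.
    by apply: (@measurable_funN _ (g_sigma_algebraType (F i))).
  move=> Q AQ finQ.
  have FQ' := FQ _ AQ finQ; have [iC IE] := CE _ FQ'.
  have iN : mu.-integrable Q (EFin \o (fun x => - X x)).
    exact: integrableN (iX _ FQ').
  split=> //; rewrite IE.
  under eq_integral do rewrite EFinN.
  rewrite integral_ge0N; last by move=> x _; rewrite lee_fin.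
  rewrite (nonneg_condexp_set cX)// -integral_ge0N; last by move=> x _; rewrite lee_fin.
  apply: le_integral; [exact: mE| |exact: If|].
    exact: integrableN (Iabs _ FQ').
  by move=> x _; rewrite -EFinN lee_fin lerNl -normrN ler_norm.
by apply: filterS2 le1 le2 => x ? ?; rewrite ler_norml; apply/andP.
Qed.

End filtered_space.

(** * From a finite horizon to the Doob maximal operator *)

Section lebesgue_bounds.
Context {d : measure_display} {T : measurableType d} {R : realType}.
Variable mu : {measure set T -> \bar R}.
Variable F : int -> set (set T).
Variable p : R.
Hypothesis p1 : 1 < p.
Let p0 : 0 < p. Proof. exact: lt_trans p1. Qed.

Lemma dual_weight_gt0 (w : T -> R) x : 0 < w x -> 0 < dual_weight p w x.
Proof. exact: powR_gt0. Qed.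

Lemma dual_weightK (w : T -> R) x : 0 < w x ->
  dual_weight p w x `^ (p - 1) * w x = 1.
Proof.
move=> w0; rewrite /dual_weight -powRrM mulNr mulVf ?subr_eq0 ?gt_eqF//.
by rewrite powR_inv1 ?mulVf ?gt_eqF// ltW.
Qed.

Lemma Lp_integral (w f : T -> R) : Lp mu p w f ->
  (\int[mu]_x (`|f x| `^ p * w x)%:E < +oo)%E.
Proof.
move=> [_]; rewrite /wnorm; set J := integral _ _ _.
rewrite -[X in _ -> (X < _)%E]/J.
by case: J => [r| |]; rewrite ?ltry// /poweR gt_eqF// invr_gt0.
Qed.

(** Pointwise |f| <= sigma + |f|^p omega: where |f| > sigma, multiply |f| by
    |f|^(p-1) omega >= sigma^(p-1) omega = 1. *)
Lemma Lp_locally_integrable (w f : T -> R) i E : F i `<=` measurable ->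
  weight mu F w -> {ae mu, forall x, 0 < w x} -> weight mu F (dual_weight p w) ->
  Lp mu p w f -> F0 mu F i E -> (\int[mu]_(x in E) (`|f x|)%:E < +oo)%E.
Proof.
move=> FT ww wpos ws Lf FE.
have mE : measurable E by apply: FT; case: FE.
have [mf _] := Lf.
have mw := weight_measurable ww; have ms := weight_measurable ws.
have w0 := weight_ge0 ww; have s0 := weight_ge0 ws.
have mfp : measurable_fun [set: T] (fun x => `|f x| `^ p * w x).
  by apply: measurable_funM => //; apply: measurable_fun_powR; exact: measurableT_comp.
have fp0 x : 0 <= `|f x| `^ p * w x by rewrite mulr_ge0// powR_ge0.
apply: (@le_lt_trans _ _ (\int[mu]_(x in E)
    (dual_weight p w x + `|f x| `^ p * w x)%:E)%E).
  apply: ae_le_integral_right => //.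
  - by apply/measurable_EFinP; apply: measurable_funTS; exact: measurable_funD.
  - by move=> x _; rewrite lee_fin addr_ge0.
  apply: filterS wpos => x wx _; rewrite lee_fin.
  have [fs|sf] := leP `|f x| (dual_weight p w x).
    by apply: (le_trans fs); rewrite lerDl.
  apply: (@le_trans _ _ (`|f x| `^ p * w x)); last by rewrite lerDr.
  have fx0 : 0 < `|f x| by apply: lt_trans sf; exact: dual_weight_gt0.
  rewrite -(mulr_powRB1 (ltW fx0) p0) -mulrA ler_peMr//.
  rewrite -[leLHS](dual_weightK wx) ler_wpM2r//; apply: le_powR => //.
  - by rewrite subr_ge0 ltW.
  - exact: ltW.
under eq_integral do rewrite EFinD.
rewrite ge0_integralD//; last 4 first.
- by move=> x _; rewrite lee_fin.
- by apply/measurable_EFinP; exact: measurable_funTS.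
- by move=> x _; rewrite lee_fin.
- by apply/measurable_EFinP; exact: measurable_funTS.
rewrite lte_add_pinfty//; first exact: weight_lty FE.
apply: le_lt_trans (Lp_integral Lf); by apply: le_integral_subset => // x _; rewrite lee_fin.
Qed.

Lemma ae_forall_int (P : int -> T -> Prop) :
  (forall i, {ae mu, forall x, P i x}) -> {ae mu, forall x, forall i, P i x}.
Proof.
move=> aeP.
have : {ae mu, forall x, forall n : nat, P n%:Z x /\ P (- n%:Z) x}.
  by apply: ae_foralln => n; apply: filterS2 (aeP n%:Z) (aeP (- n%:Z)).
apply: filterS => x Px i; case: (intP i) => [|n|n].
- by have [] := Px 0%N.
- by have [] := Px n.+1.
- by have [] := Px n.+1.
Qed.

Definition horizon_max (X : int -> T -> R) (N : nat) (x : T) : R :=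
  running_max (fun n => X (n%:Z - N%:Z)) (N + N) x.

Lemma horizon_max_ub (X : int -> T -> R) i x :
  exists N, X i x <= horizon_max X N x.
Proof.
pose N := absz i; exists N.
have iN : 0 <= i + N%:Z by rewrite -lerBlDr sub0r lerNnormlW// ler_normr lexx orbT.
pose n := absz (i + N%:Z).
have nE : n%:Z = i + N%:Z by rewrite gez0_abs.
have -> : i = n%:Z - N%:Z by rewrite nE addrK.
apply: (@le_running_max_of _ _ (fun n => X (n%:Z - N%:Z))).
rewrite -lez_nat nE PoszD lerD2r abszE; exact: ler_norm.
Qed.

Lemma horizon_max_nd (X : int -> T -> R) N x :
  horizon_max X N x <= horizon_max X N.+1 x.
Proof.
apply: running_max_ub => n nN.
have -> : n%:Z - N%:Z = n.+1%:Z - N.+1%:Z by rewrite !intS opprD addrACA subrr add0r.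
apply: (@le_running_max_of _ _ (fun n => X (n%:Z - N.+1%:Z))).
by rewrite addSn addnS ltnS leqW.
Qed.

(** The truncated maxima increase to a function that dominates the Doob maximal
    function almost everywhere. *)
Lemma doob_integral_le (v f : T -> R) (X : int -> T -> R) (B : \bar R) :
  measurable_fun [set: T] v -> (forall x, 0 <= v x) ->
  (forall i, measurable_fun [set: T] (X i)) -> (forall i x, 0 <= X i x) ->
  (forall i, {ae mu, forall x, `|condexp mu F i f x| <= X i x}) ->
  (forall N, (\int[mu]_x (horizon_max X N x `^ p * v x)%:E <= B)%E) ->
  (\int[mu]_x (`|doob mu F f x| `^ p * (v x)%:E) <= B)%E.
Proof.
move=> mv v0 mX X0 fX PB.
have P0 N x : 0 <= horizon_max X N x by exact: running_max_ge0.
have mP N : measurable_fun [set: T] (horizon_max X N).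
  rewrite /horizon_max; elim: (N + N)%N => [|n IH]; first exact: mX.
  by apply: measurable_maxr => //; exact: mX.
pose h N x := (horizon_max X N x `^ p * v x)%:E.
have mh N : measurable_fun [set: T] (h N).
  by apply/measurable_EFinP; apply: measurable_funM => //; exact: measurable_fun_powR.
have h0 N x : (0 <= h N x)%E by rewrite lee_fin mulr_ge0 ?powR_ge0.
have ndh x : {homo h^~ x : m n / (m <= n)%N >-> (m <= n)%E}.
  apply/nondecreasing_seqP => N; rewrite lee_fin ler_wpM2r//.
  by apply: le_powR => //; [exact: ltW|exact: horizon_max_nd].
have cvgh x : h N x @[N --> \oo] --> ereal_sup (range (h^~ x)).
  exact: ereal_nondecreasing_cvgn.
pose g x := ereal_sup (range (h^~ x)).
have hg N x : (h N x <= g x)%E by apply: ereal_sup_ubound; exists N.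
have mg : measurable_fun [set: T] g.
  by apply: (emeasurable_fun_cvg h g mh) => x _; exact: cvgh.
have g0 x : (0 <= g x)%E by apply: le_trans (hg 0%N x).
apply: (@le_trans _ _ (\int[mu]_x g x)%E).
  apply: ae_le_integral_right => //.
    by move=> x _; rewrite mule_ge0 ?lee_fin ?poweR_ge0.
  apply: filterS (ae_forall_int fX) => x fXx _.
  have [vx|vx] := eqVneq (v x) 0; first by rewrite vx mule0.
  have vx0 : 0 < v x by rewrite lt0r vx v0.
  case gE : (g x) => [r| |]; last 2 first.
  - by rewrite leey.
  - by have := g0 x; rewrite gE.
  have r0 : 0 <= r by have := g0 x; rewrite gE lee_fin.
  have Xr i : X i x <= (r / v x) `^ p^-1.
    have [N XN] := horizon_max_ub X i x.
    have := hg N x; rewrite gE lee_fin -ler_pdivlMr// => H.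
    apply: (le_trans XN).
    have -> : horizon_max X N x = (horizon_max X N x `^ p) `^ p^-1.
      by rewrite -powRrM divff ?gt_eqF// powRr1.
    by apply: le_powR; rewrite ?invr_ge0 ?powR_ge0// ltW.
  have D0 : (0 <= doob mu F f x)%E.
    apply: (@le_trans _ _ (`|condexp mu F 0 f x|)%:E); first by rewrite lee_fin.
    by apply: ereal_sup_ubound; exists 0.
  have Dr : (doob mu F f x <= ((r / v x) `^ p^-1)%:E)%E.
    apply: ge_ereal_sup => _ [i _ <-]; rewrite lee_fin.
    exact: le_trans (fXx i) (Xr i).
  rewrite gee0_abs//; case: (doob mu F f x) D0 Dr => [D| |]//=.
  rewrite !lee_fin => D0 Dr.
  have := le_powR (ltW p0) D0 Dr.
  rewrite -powRrM mulVf ?gt_eqF// powRr1; last by rewrite divr_ge0.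
  by rewrite ler_pdivlMr// -lee_fin.
rewrite (_ : (\int[mu]_x g x = \int[mu]_x limn (h^~ x))%E); last first.
  by apply: eq_integral => x _; apply/esym/cvg_lim => //; exact: cvgh.
rewrite monotone_convergence//.
apply: lime_le; last exact: nearW.
apply: ereal_nondecreasing_is_cvgn => a b ab.
by apply: le_integral_nonmeasurable => // x _; exact: ndh.
Qed.

Lemma opnorm_le (w v : T -> R) (C : R) : (forall x, 0 <= w x) ->
  (forall x, 0 <= v x) -> 0 <= C ->
  (forall f, Lp mu p w f -> (\int[mu]_x (`|doob mu F f x| `^ p * (v x)%:E) <=
     C%:E * \int[mu]_x (`|f x| `^ p * w x)%:E)%E) ->
  (opnorm mu p w v (doob mu F) <= (C `^ p^-1)%:E)%E.
Proof.
move=> w0 v0 C0 H; apply: ereal_inf_lbound; exists (C `^ p^-1) => //.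
split=> [|f Lf]; first exact: powR_ge0.
rewrite /wnorm.
have -> : (\int[mu]_x (`|(EFin \o f) x| `^ p * (w x)%:E) =
    \int[mu]_x (`|f x| `^ p * w x)%:E)%E by [].
set J := (\int[mu]_x (`|f x| `^ p * w x)%:E)%E.
have J0 : (0 <= J)%E by apply: integral_ge0_real => x; rewrite mulr_ge0// powR_ge0.
have -> : ((C `^ p^-1)%:E * J `^ p^-1 = (C%:E * J) `^ p^-1)%E.
  by rewrite poweRM ?lee_fin.
apply: gt0_ler_poweR; rewrite ?invr_ge0 ?(ltW p0)//.
- rewrite in_itv/= leey andbT; apply: integral_ge0 => x _.
  by rewrite mule_ge0 ?lee_fin ?poweR_ge0.
- by rewrite in_itv/= mule_ge0 ?lee_fin// leey.
- exact: H.
Qed.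

End lebesgue_bounds.

(** * Consequences of Jensen's inequality *)

Section consequences_of_jensen.
Context {d : measure_display} {T : measurableType d} {R : realType}.
Variable mu : {measure set T -> \bar R}.
Variable F : int -> set (set T).
Hypothesis hF : sigma_finite_filtration mu F.

Let FT i : F i `<=` measurable. Proof. exact: (filtration_measurable hF). Qed.

Lemma ln_le_subr1 (x : R) : 0 < x -> ln x <= x - 1.
Proof. by move=> x0; have := expR_ge1Dx (ln x); rewrite lnK ?posrE//; lra. Qed.

(** The function f may have integral -oo, as log sigma may. *)
Lemma ae_le_integral_of_integrable D (f h : T -> \bar R) : measurable D ->
  measurable_fun D f -> mu.-integrable D h ->
  {ae mu, forall x, D x -> (f x <= h x)%E} ->
  (\int[mu]_(x in D) f x <= \int[mu]_(x in D) h x)%E.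
Proof.
move=> mD mf ih fh; have mh := measurable_int mu ih.
rewrite integralE [leRHS]integralE; apply: leeB.
- apply: ae_ge0_le_integral => //; try exact: measurable_funepos.
  apply: filterS fh => x H Dx; rewrite !funeposE.
  by rewrite ge_max !le_max (H Dx)/= lexx orbT.
- apply: ae_ge0_le_integral => //; try exact: measurable_funeneg.
  apply: filterS fh => x H Dx; rewrite !funenegE.
  by rewrite ge_max !le_max leeN2 (H Dx)/= lexx orbT.
Qed.

Lemma integrable_cst_of_finite (D : set T) (c : R) : measurable D ->
  (mu D < +oo)%E -> mu.-integrable D (fun=> c%:E).
Proof.
move=> mD finD; apply/integrableP; split; first exact: measurable_cst.
by rewrite integral_cst// lte_mul_pinfty ?lee_fin.
Qed.

(** Integrating log sigma <= 2 (sigma^(1/2) / Y + log Y - 1) over sets on which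
    Y is bounded above and below gives E(log sigma) <= 2 log Y. If there is no
    conditional expectation of log sigma, its default value -oo makes the
    claim trivial. *)
Lemma expectation_log_le i (sigma Y : T -> R) : measurable_fun [set: T] sigma ->
  (forall x, 0 <= sigma x) -> {ae mu, forall x, 0 < sigma x} ->
  (forall x, 0 < Y x) -> nonneg_condexp mu (F i) (fun x => sigma x `^ 2^-1) Y ->
  {ae mu, forall x, (expeR (econdexp mu F i (fun y => ln (sigma y)) x) <=
     (Y x ^+ 2)%:E)%E}.
Proof.
move=> ms s0 spos Y0 cY; have [mY _ YE] := cY.
have [ex|nex] := pselect (exists g, is_econdexp mu F i (fun y => ln (sigma y)) g);
    last first.
  apply: nearW => x; rewrite /econdexp xgetPN/=; first by rewrite lee_fin sqr_ge0.
  by move=> g Pg; apply: nex; exists g.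
set e := econdexp _ _ _ _.
have [me eE] : is_econdexp mu F i (fun y => ln (sigma y)) e by exact: xgetPex.
have [G exG] := filtration_exhausting hF i; have [AG Gfin ndG GT] := exG.
have mYT := measurable_for_measurable (@FT i) mY.
pose l x := 2 * ln (Y x).
have ml : measurable_for (F i) l.
  apply: measurable_forM; first exact: measurable_for_cst.
  exact: (measurableT_comp (measurable_ln (R := R)) mY).
have mlT := measurable_for_measurable (@FT i) ml.
have meT : measurable_fun [set: T] e.
  by move=> _ Z mZ; have := me measurableT Z mZ => /(generated_measurable (@FT i)).
pose D k := [set x | ((l x)%:E < e x)%E] `&`
  (G k `&` ([set x | Y x <= k.+1%:R] `&` [set x | (Y x)^-1 <= k.+1%:R])).
have mV : measurable_for (F i) (fun x => (Y x)^-1) by apply: measurable_forV => // x; exact: ltW.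
have AD k : <<s F i >> (D k).
  apply: generated_setI.
    have mlE : @measurable_fun _ _ (g_sigma_algebraType (F i)) (\bar R) [set: T]
      (EFin \o l) by exact/measurable_EFinP.
    have := @measurable_lte _ (g_sigma_algebraType (F i)) R setT measurableT _ _ mlE me.
    by rewrite setTI.
  apply: generated_setI => //; apply: generated_setI;
    apply: measurable_for_le => //; exact: measurable_for_cst.
have mD k := generated_measurable (@FT i) (AD k).
have FD k : F0 mu F i (D k).
  split; first by rewrite -(filtration_sigmaE hF).
  apply: le_lt_trans (Gfin k); apply: le_measure; rewrite ?inE//.
    exact: (generated_measurable (@FT i) (AG k)).
  by move=> x [_ []].
have lD k x : D k x -> `|l x| <= 2 * k.+1%:R.
  move=> [_ [_ [/= Y1 Y2]]]; rewrite normrM ger0_norm// ler_wpM2l//.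
  rewrite ler_norml; apply/andP; split.
    have := ln_le_subr1 (_ : 0 < (Y x)^-1); rewrite invr_gt0 Y0 => /(_ isT).
    rewrite lnV ?posrE//; lra.
  have := ln_le_subr1 (Y0 x); lra.
have il k : mu.-integrable (D k) (EFin \o l).
  apply: (@le_integrable _ _ _ _ _ (mD k) _ (EFin \o cst (2 * k.+1%:R))) => //.
  - by apply/measurable_EFinP; exact: measurable_funTS.
  - move=> x Dx /=; rewrite lee_fin (le_trans (lD k x Dx))//.
    by rewrite ler_norm.
  - by apply: integrable_cst_of_finite => //; have [] := FD k.
have ie k : mu.-integrable (D k) e.
  apply/integrableP; split; first exact: measurable_funTS.
  have [finp _] := eE _ (FD k).
  apply: (@le_lt_trans _ _ (\int[mu]_(x in D k) (e^\+ x + (2 * k.+1%:R)%:E))%E).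
    apply: ge0_le_integral => //.
    - by apply: measurableT_comp => //; exact: measurable_funTS.
    - apply: emeasurable_funD; last exact: measurable_cst.
      by apply: measurable_funepos; exact: measurable_funTS.
    - move=> x Dx.
      have := lD k x Dx; rewrite ler_norml => /andP[l1 _].
      have [le _] := Dx; move: le => /= le.
      have {}le : ((- (2 * k.+1%:R))%:E <= e x)%E.
        by apply: le_trans (ltW le); rewrite lee_fin.
      rewrite funeposE; case: (e x) le => [r| |]//=.
      rewrite lee_fin -EFin_max -EFinD lee_fin => rk.
      have k0 : 0 <= 2 * k.+1%:R :> R by rewrite mulr_ge0.
      by have [r0|r0] := leP 0 r; rewrite ?(ger0_norm r0) ?(ltr0_norm r0); lra.
  rewrite ge0_integralD//; last by apply: measurable_funepos; exact: measurable_funTS.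
  rewrite lte_add_pinfty// integral_cst// lte_mul_pinfty ?lee_fin//.
  by have [] := FD k.
have int_ratio k : (\int[mu]_(x in D k) (sigma x `^ 2^-1 * (Y x)^-1)%:E =
    mu (D k))%E.
  have := YE (fun x => \1_(D k) x * (Y x)^-1).
  move=> /(_ _ _)/esym H; transitivity (\int[mu]_x (\1_(D k) x)%:E)%E; last first.
    by rewrite integral_indic// setIT.
  transitivity (\int[mu]_x (\1_(D k) x / Y x * sigma x `^ 2^-1)%:E)%E.
    rewrite integral_mkcond; apply: eq_integral => x _.
    rewrite patchE indicE; case: ifPn => _; last by rewrite !mul0r.
    by rewrite mul1r mulrC.
  rewrite H; [|by apply: measurable_forM => //; exact: measurable_for_indic
              |by move=> x; rewrite mulr_ge0// invr_ge0 ltW].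
  by apply: eq_integral => x _; rewrite divfK// gt_eqF.
have ms2 : measurable_fun [set: T] (fun x => sigma x `^ 2^-1 * (Y x)^-1).
  apply: measurable_funM; first exact: measurable_fun_powR.
  exact: (measurable_for_measurable (@FT i) mV).
have is2 k : mu.-integrable (D k) (fun x => (sigma x `^ 2^-1 * (Y x)^-1)%:E).
  apply/integrableP; split; first by apply/measurable_EFinP; exact: measurable_funTS.
  under eq_integral => x _.
    rewrite gee0_abs; last by rewrite lee_fin mulr_ge0 ?powR_ge0// invr_ge0 ltW.
    over.
  by rewrite int_ratio; have [] := FD k.
have muD k : mu (D k) = 0%E.
  apply: (@positive_integral_null _ _ _ mu _ (fun x => (e x - (l x)%:E)%E)) => //.
  - apply: emeasurable_funB; first exact: measurable_funTS.
    by apply/measurable_EFinP; exact: measurable_funTS.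
  - by move=> x [lx _]; rewrite sube_gt0.
  rewrite (integralB (mD k) (ie k) (il k)) sube_le0.
  have [_ ->] := eE _ (FD k).
  have i2 : mu.-integrable (D k) (fun x => (2 * (sigma x `^ 2^-1 * (Y x)^-1 - 1))%:E).
    under eq_fun do rewrite EFinM.
    apply: integrableZl => //.
    under eq_fun do rewrite EFinB.
    apply: integrableB => //.
    by apply: integrable_cst_of_finite => //; have [] := FD k.
  have int2 : (\int[mu]_(x in D k) (2 * (sigma x `^ 2^-1 * (Y x)^-1 - 1))%:E = 0)%E.
    under eq_integral do rewrite EFinM.
    have i1 : mu.-integrable (D k) (fun=> 1%:E : \bar R).
      by apply: integrable_cst_of_finite => //; have [] := FD k.
    rewrite integralZl//; last first.
      by under eq_fun do rewrite EFinB; exact: integrableB.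
    under eq_integral do rewrite EFinB.
    rewrite integralB// int_ratio integral_cst// mul1e subee ?mule0//.
    by rewrite ge0_fin_numE//; have [] := FD k.
  apply: (@le_trans _ _ (\int[mu]_(x in D k)
      ((l x)%:E + (2 * (sigma x `^ 2^-1 * (Y x)^-1 - 1))%:E))%E).
    apply: ae_le_integral_of_integrable => //.
    - apply/measurable_EFinP; apply: measurable_funTS.
      exact: (measurableT_comp (measurable_ln (R := R)) ms).
    - exact: integrableD.
    apply: filterS spos => x sx _; rewrite -EFinD lee_fin /l.
    have -> : ln (sigma x) = 2 * ln (sigma x `^ 2^-1) by rewrite ln_powR; field.
    have q0 : 0 < sigma x `^ 2^-1 * (Y x)^-1 by rewrite mulr_gt0 ?powR_gt0 ?invr_gt0.
    have := ln_le_subr1 q0.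
    rewrite lnM ?posrE ?powR_gt0 ?invr_gt0// lnV ?posrE//; lra.
  by rewrite integralD// int2 adde0.
have [N [mN N0 subN]] : mu.-negligible (\bigcup_k D k).
  by apply: negligible_bigcup => k; apply/(negligibleP mu (mD k)); exact: muD.
exists N; split=> //; apply: subset_trans subN => x /= /negP; rewrite -ltNge => Hx.
have le : ((l x)%:E < e x)%E.
  rewrite ltNge; apply/negP => el.
  have : (expeR (e x) <= expeR (l x)%:E)%E by rewrite lee_expeR.
  rewrite /= /l mulrC expRM_natr lnK ?posrE// => H.
  by move: Hx; rewrite ltNge H.
have [k0 Gk] : exists k, G k x by have : [set: T] x by []; rewrite -GT => -[k _]; exists k.
pose k := maxn k0 (maxn (Num.trunc (Y x)) (Num.trunc (Y x)^-1)).
exists k => //; split=> //; split.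
  by have /subsetPset := ndG k0 k (leq_maxl _ _); apply.
have kle n : (n <= maxn (Num.trunc (Y x)) (Num.trunc (Y x)^-1))%N ->
    n.+1%:R <= k.+1%:R :> R.
  by move=> nk; rewrite ler_nat ltnS (leq_trans nk)// leq_maxr.
split => /=; apply: ltW; apply: lt_le_trans (truncnS_gt _) (kle _ _).
  exact: leq_maxl.
exact: leq_maxr.
Qed.

(** Young's inequality for the two factors of
    1 = w^(1/p) sigma^(1/p'), normalized by W and S, bounds (W S^(p-1))^(-1/p)
    by a function whose integral over Q is mu(Q). *)
Lemma one_le_Ap_product (p : R) i (w W S : T -> R) : 1 < p -> weight mu F w ->
  {ae mu, forall x, 0 < w x} -> weight mu F (dual_weight p w) ->
  nonneg_condexp mu (F i) w W -> nonneg_condexp mu (F i) (dual_weight p w) S ->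
  (forall x, 0 < W x) -> (forall x, 0 < S x) ->
  {ae mu, forall x, 1 <= W x * S x `^ (p - 1)}.
Proof.
move=> p1 ww wpos ws cW cS W0 S0.
have p0 : 0 < p by apply: lt_trans p1.
have pB0 : 0 < p - 1 by rewrite subr_gt0.
have [mW _ WE] := cW; have [mS _ SE] := cS.
have mw := weight_measurable ww; have ms := weight_measurable ws.
have w0 := weight_ge0 ww; have s0 := weight_ge0 ws.
have [G exG] := filtration_exhausting hF i.
pose U x := (W x * S x `^ (p - 1)) `^ (- p^-1).
have A0 x : 0 < W x * S x `^ (p - 1) by rewrite mulr_gt0// powR_gt0.
have mU : measurable_for (F i) U.
  by apply: measurable_for_powR; apply: measurable_forM => //; exact: measurable_for_powR.
have U0 x : 0 <= U x by exact: powR_ge0.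
have UP : {ae mu, forall x, p * U x <= (W x)^-1 * w x + (p - 1) * ((S x)^-1 * dual_weight p w x)}.
  apply: filterS wpos => x wx.
  have sx := dual_weight_gt0 p wx.
  pose b := (w x / W x) `^ p^-1.
  pose a := (dual_weight p w x / S x) `^ p^-1.
  have b0 : 0 <= b by exact: powR_ge0.
  have a0 : 0 <= a by exact: powR_ge0.
  have := young_powR p1 a0 b0.
  have -> : a `^ p = (S x)^-1 * dual_weight p w x.
    by rewrite /a -powRrM mulVf ?gt_eqF// powRr1 1?mulrC// mulr_ge0// invr_ge0 ltW.
  have -> : b `^ p = (W x)^-1 * w x.
    by rewrite /b -powRrM mulVf ?gt_eqF// powRr1 1?mulrC// mulr_ge0// invr_ge0 ltW.
  have -> : a `^ (p - 1) * b = U x.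
    rewrite /a /b powRAC -powRM ?powR_ge0//; last first.
      by rewrite mulr_ge0// invr_ge0 ltW.
    rewrite /U -[- p^-1]mulN1r powRrM powR_inv1 ?(ltW (A0 x))//; congr (_ `^ _).
    rewrite powRM ?invr_ge0 ?ltW// mulrACA dual_weightK// mul1r invfM mulrC.
    congr (_ * _).
    by rewrite -powR_inv1 ?(ltW (S0 x))// powRAC powR_inv1 ?powR_ge0.
  lra.
have IU Q : <<s F i >> Q -> (mu Q < +oo)%E ->
    (\int[mu]_(x in Q) (U x)%:E <= \int[mu]_(x in Q) 1%:E)%E.
  move=> AQ finQ; have mQ := generated_measurable (@FT i) AQ.
  have onQ (c f : T -> R) : (\int[mu]_(x in Q) ((c x)^-1 * f x)%:E =
      \int[mu]_x (\1_Q x * (c x)^-1 * f x)%:E)%E.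
    rewrite integral_mkcond; apply: eq_integral => x _.
    by rewrite patchE indicE -mulrA; case: ifPn => _; rewrite (mul1r, mul0r).
  have mean (u c : T -> R) : nonneg_condexp mu (F i) u c -> (forall x, 0 < c x) ->
      (\int[mu]_(x in Q) ((c x)^-1 * u x)%:E = \int[mu]_(x in Q) 1%:E)%E.
    move=> [mc _ cE] c0; rewrite onQ -cE.
    - rewrite [RHS]integral_mkcond; apply: eq_integral => x _.
      by rewrite divfK ?gt_eqF// patchE indicE; case: ifPn.
    - apply: measurable_forM; first exact: measurable_for_indic.
      by apply: measurable_forV => // x; exact: ltW.
    - by move=> x; rewrite mulr_ge0// invr_ge0 ltW.
  have mquot (u c : T -> R) : measurable_fun [set: T] u -> measurable_for (F i) c ->
      (forall x, 0 < c x) -> measurable_fun Q (fun x => (c x)^-1 * u x).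
    move=> mu_ mc c0; apply: measurable_funTS; apply: measurable_funM => //.
    apply: measurable_fun_inv; last exact: (measurable_for_measurable (@FT i)).
    by move=> x; exact: ltW.
  have qW x : 0 <= (W x)^-1 * w x by rewrite mulr_ge0// invr_ge0 ltW.
  have qS x : 0 <= (S x)^-1 * dual_weight p w x.
    by rewrite mulr_ge0// invr_ge0 ltW.
  have H : (p%:E * \int[mu]_(x in Q) (U x)%:E <= p%:E * \int[mu]_(x in Q) 1%:E)%E.
    rewrite -ge0_integralZl//; last 3 first.
    - apply/measurable_EFinP; apply: measurable_funTS.
      exact: (measurable_for_measurable (@FT i)).
    - by move=> x _; rewrite lee_fin.
    - by rewrite lee_fin ltW.
    apply: (@le_trans _ _ (\int[mu]_(x in Q) (((W x)^-1 * w x)%:E +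
        (p - 1)%:E * ((S x)^-1 * dual_weight p w x)%:E))%E).
      apply: ae_le_integral_right => //.
      - apply: emeasurable_funD; first by apply/measurable_EFinP; exact: mquot.
        by apply: measurable_funeM; apply/measurable_EFinP; exact: mquot.
      - by move=> x _; rewrite mule_ge0 ?lee_fin ?(ltW p0).
      - by move=> x _; rewrite adde_ge0 ?mule_ge0 ?lee_fin ?(ltW pB0).
      by apply: filterS UP => x Ux _; rewrite -!EFinM -EFinD lee_fin.
    rewrite ge0_integralD//; last 4 first.
    - by move=> x _; rewrite lee_fin.
    - by apply/measurable_EFinP; exact: mquot.
    - by move=> x _; rewrite mule_ge0 ?lee_fin ?(ltW pB0).
    - by apply: measurable_funeM; apply/measurable_EFinP; exact: mquot.
    rewrite ge0_integralZl//; last 3 first.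
    - by apply/measurable_EFinP; exact: mquot.
    - by move=> x _; rewrite lee_fin.
    - by rewrite lee_fin ltW.
    rewrite !mean// -[X in (X + _)%E]mul1e -ge0_muleDl ?lee_fin ?(ltW pB0)//.
    by rewrite -EFinD addrC subrK.
  by move: H; rewrite lee_pmul2l// lte_fin.
have : {ae mu, forall x, U x <= 1}.
  apply: (ae_le_of_sets (@FT i) exG) => //; first exact: measurable_for_cst.
apply: filterS => x Ux.
rewrite leNgt; apply/negP => lt1.
have := powR_gt0 (- p^-1) (A0 x); rewrite -/(U x) => Upos.
have : 1 < U x.
  rewrite /U powRN invf_gt1 ?powR_gt0//.
  have := gt0_ltr_powR (_ : 0 < p^-1) _ _ lt1; rewrite powR1.
  by apply; rewrite ?invr_gt0 ?nnegrE// ltW.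
by rewrite ltNge Ux.
Qed.

End consequences_of_jensen.

(** * The bounds for B_p, and for A_p with the tailed maximal function *)

Section two_weight_bounds.
Context {d : measure_display} {T : measurableType d} {R : realType}.
Variable mu : {measure set T -> \bar R}.
Variable F : int -> set (set T).
Hypothesis hF : sigma_finite_filtration mu F.
Variable p : R.
Hypothesis p1 : 1 < p.

Let FT i : F i `<=` measurable. Proof. exact: (filtration_measurable hF). Qed.
Let p0 : 0 < p. Proof. exact: lt_trans p1. Qed.
Let FE i : <<s F i >> = F i. Proof. exact: (filtration_sigmaE hF). Qed.

Lemma filtration_mono (i j : int) : i <= j -> F i `<=` F j.
Proof.
have [_ _ FS _] := hF.
by rewrite le_eqVlt => /orP[/eqP ->//|]; exact: FS.
Qed.

(** Positivity everywhere, not only almost everywhere, makes the quotients by S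
    and the logarithm of Y harmless. *)
Lemma positive_version i (u X : T -> R) : measurable_fun [set: T] u ->
  (forall x, 0 <= u x) -> {ae mu, forall x, 0 < u x} -> nonneg_condexp mu (F i) u X ->
  exists S, [/\ forall x, 0 < S x, nonneg_condexp mu (F i) u S &
    {ae mu, forall x, X x = S x}].
Proof.
move=> mu_ u0 upos cX; have [mX X0 _] := cX.
have Xpos := nonneg_condexp_positive (@FT i) mu_ u0 upos cX.
pose Z := [set x | X x <= 0].
have mZ : <<s F i >> Z by apply: measurable_for_le => //; exact: measurable_for_cst.
pose S x := X x + \1_Z x.
have S0 x : 0 < S x.
  rewrite /S indicE; case: (boolP (x \in Z)) => [_|]; first by rewrite ltr_wpDl.
  by move/negP => xZ; rewrite addr0 ltNge; apply/negP => H; apply: xZ; rewrite inE.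
have XS : {ae mu, forall x, X x = S x}.
  by apply: filterS Xpos => x Xx; rewrite /S indicE memNset ?addr0// /Z/= leNgt Xx.
exists S; split => //.
apply: (nonneg_condexp_ae (@FT i)) cX => //.
- exact: nearW.
- by apply: measurable_forD => //; exact: measurable_for_indic.
- by move=> x; exact: ltW.
Qed.

Lemma weight_positive_versions (w : T -> R) : weight mu F w ->
  {ae mu, forall x, 0 < w x} ->
  exists S : int -> T -> R, [/\ forall i x, 0 < S i x,
    forall i, nonneg_condexp mu (F i) w (S i) &
    forall i, {ae mu, forall x, condexp mu F i w x = S i x}].
Proof.
move=> ww wpos.
have /choice[S SP] : forall i, exists S, [/\ forall x, 0 < S x,
    nonneg_condexp mu (F i) w S & {ae mu, forall x, condexp mu F i w x = S x}].
  move=> i; have [X cX eX] := weight_condexp hF i ww.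
  have [S [S0 cS eS]] := positive_version (weight_measurable ww) (weight_ge0 ww) wpos cX.
  by exists S; split => //; apply: filterS2 eX eS => x ->.
by exists S; split => i; have [] := SP i.
Qed.

Lemma weight_versions (w : T -> R) : weight mu F w ->
  exists2 V : int -> T -> R, forall i, nonneg_condexp mu (F i) w (V i) &
    forall i, {ae mu, forall x, condexp mu F i w x = V i x}.
Proof.
move=> ww.
have /choice[V VP] : forall i, exists V, nonneg_condexp mu (F i) w V /\
    {ae mu, forall x, condexp mu F i w x = V x}.
  by move=> i; have [V cV eV] := weight_condexp hF i ww; exists V.
by exists V => i; have [] := VP i.
Qed.

(** The substitution f = g sigma: the measure sigma mu is the natural one for g,
    because sigma^(1-p) = omega. *)
Lemma opnorm_le_of_horizons (w v : T -> R) (C : R) :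
  weight mu F v -> weight mu F w -> {ae mu, forall x, 0 < w x} ->
  weight mu F (dual_weight p w) -> 0 <= C ->
  (forall (g : T -> R) (X : int -> T -> R), measurable_fun [set: T] g -> (forall x, 0 <= g x) ->
    (forall i, nonneg_condexp mu (F i) (fun x => g x * dual_weight p w x) (X i)) ->
    forall N, (\int[mu]_x (horizon_max X N x `^ p * v x)%:E <=
      C%:E * \int[mu]_x (g x `^ p * dual_weight p w x)%:E)%E) ->
  (opnorm mu p w v (doob mu F) <= (C `^ p^-1)%:E)%E.
Proof.
move=> wv ww wpos ws C0 H.
set s := dual_weight p w in ws H *.
have mw := weight_measurable ww; have ms := weight_measurable ws.
have w0 := weight_ge0 ww; have s0 := weight_ge0 ws.
have mv := weight_measurable wv; have v0 := weight_ge0 wv.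
apply: (opnorm_le p1) => // f Lf; have [mf _] := Lf.
have mabs : measurable_fun [set: T] (fun x => `|f x|) by exact: measurableT_comp.
pose g x := `|f x| / s x.
have mg : measurable_fun [set: T] g.
  by apply: measurable_funM => //; exact: measurable_fun_inv.
have g0 x : 0 <= g x by rewrite divr_ge0.
have gs : {ae mu, forall x, `|f x| = g x * s x}.
  apply: filterS wpos => x wx; rewrite /g divfK// gt_eqF//.
  exact: dual_weight_gt0.
have finf i E : F0 mu F i E -> (\int[mu]_(x in E) (`|f x|)%:E < +oo)%E.
  by move=> FE'; exact: (Lp_locally_integrable p1 (@FT i) ww wpos ws Lf FE').
have /choice[X cX] : forall i, exists X, nonneg_condexp mu (F i) (fun x => `|f x|) X.
  by move=> i; apply: (nonneg_condexp_exists_filtration hF) => // E; exact: finf.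
have mX i : measurable_fun [set: T] (X i).
  by have [mX _ _] := cX i; exact: (measurable_for_measurable (@FT i)).
have X0 i x : 0 <= X i x by have [] := cX i.
have cgX i : nonneg_condexp mu (F i) (fun x => g x * s x) (X i).
  apply: (nonneg_condexp_ae (@FT i)) (cX i) => //.
  - exact: measurable_funM.
  - by move=> x; rewrite mulr_ge0.
  - by have [] := cX i.
  - exact: nearW.
have fX i : {ae mu, forall x, `|condexp mu F i f x| <= X i x}.
  by apply: (abs_condexp_le hF) => // E; exact: finf.
apply: (doob_integral_le p1 mv v0 mX X0 fX) => N.
apply: (le_trans (H g X mg g0 cgX N)).
rewrite lee_wpmul2l ?lee_fin//.
rewrite le_eqVlt; apply/orP; left; apply/eqP; apply: ge0_ae_eq_integral => //.
- apply/measurable_EFinP; apply: measurable_funM => //; exact: measurable_fun_powR.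
- apply/measurable_EFinP; apply: measurable_funM => //; exact: measurable_fun_powR.
- by move=> x _; rewrite lee_fin mulr_ge0 ?powR_ge0.
- by move=> x _; rewrite lee_fin mulr_ge0 ?powR_ge0.
apply: filterS wpos => x wx _; congr EFin.
have sx : 0 < s x by exact: dual_weight_gt0.
rewrite /g powRM ?invr_ge0 ?(ltW sx)// -mulrA; congr (_ * _).
rewrite -[(s x)^-1]powR_inv1 ?(ltW sx)// powRAC powR_inv1 ?powR_ge0//.
rewrite -(mulr_powRB1 (ltW sx) p0) invfM mulrC mulrA divff ?gt_eqF// mul1r.
apply: (@mulfI _ (s x `^ (p - 1))); first by rewrite gt_eqF// powR_gt0.
by rewrite (dual_weightK p1 wx) divff// gt_eqF// powR_gt0.
Qed.

(** On Q, which is known from time i on, conditioning sigma and conditioning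
    its restriction to Q agree at all later times. *)
Lemma tail_integral_le (i : int) Q (s : T -> R) (S : int -> T -> R) (Tm :
  T -> R) :
  weight mu F s -> (forall j, nonneg_condexp mu (F j) s (S j)) ->
  measurable_fun [set: T] Tm -> (forall x, 0 <= Tm x) ->
  (forall x, exists2 j, i <= j & Tm x = S j x) -> F0 mu F i Q ->
  (\int[mu]_(x in Q) (Tm x)%:E <= \int[mu]_(x in Q) tailed_doob mu F i (s \* \1_Q)%R x)%E.
Proof.
move=> ws cS mTm Tm0 TmS [FQ finQ].
have ms := weight_measurable ws; have s0 := weight_ge0 ws.
have mQ := FT FQ.
have wsQ : weight mu F (s \* \1_Q)%R.
  split=> [|x]; last by rewrite mulr_ge0.
  split; first by apply: measurable_funM => //; exact: measurable_indic.
  move=> j E FE'; have mE : measurable E by apply: (@FT j); case: FE'.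
  have := weight_lty ws FE' => finE.
  apply/integrableP; split.
    apply/measurable_EFinP; apply: measurable_funTS.
    by apply: measurable_funM => //; exact: measurable_indic.
  apply: le_lt_trans finE; apply: le_integral_nonmeasurable => x _ //=.
  by rewrite lee_fin ger0_norm ?mulr_ge0// ler_piMr.
have SQ j : i <= j ->
    {ae mu, forall x, \1_Q x * S j x <= condexp mu F j (s \* \1_Q)%R x}.
  move=> ij; have [X cX eX] := weight_condexp hF j wsQ.
  have [mX X0 _] := cX; have [mS S0 _] := cS j.
  have FjQ : <<s F j >> Q by rewrite FE; exact: (filtration_mono ij).
  have [G exG] := filtration_exhausting hF j.
  have le1 : {ae mu, forall x, \1_Q x * S j x <= X x}.
    apply: (ae_le_of_sets (@FT j) exG) => //.
    - by apply: measurable_forM => //; exact: measurable_for_indic.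
    - by move=> x; rewrite mulr_ge0.
    move=> P AP _; rewrite (nonneg_condexp_set cX AP).
    have onQ (f : T -> R) : (\int[mu]_(x in P) (\1_Q x * f x)%:E =
        \int[mu]_(x in P `&` Q) (f x)%:E)%E.
      rewrite [RHS]integral_mkcondr; apply: eq_integral => x _.
      by rewrite patchE indicE; case: ifPn; rewrite (mul1r, mul0r).
    rewrite onQ (nonneg_condexp_set (cS j)); last exact: generated_setI.
    by rewrite -onQ; under eq_integral do rewrite mulrC.
  by apply: filterS2 eX le1 => x ->.
have SQ' : {ae mu, forall x, forall j, i <= j ->
    \1_Q x * S j x <= condexp mu F j (s \* \1_Q)%R x}.
  apply: ae_forall_int => j; have [ij|ij] := leP i j.
    by apply: filterS (SQ j ij) => x.
  by apply: nearW => x.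
apply: ae_le_integral_left => //.
- by apply/measurable_EFinP; exact: measurable_funTS.
- by move=> x _; rewrite lee_fin.
- move=> x _; apply: (@le_trans _ _ (`|condexp mu F i (s \* \1_Q)%R x|)%:E).
    by rewrite lee_fin.
  by apply: ereal_sup_ubound; exists i => /=.
apply: filterS SQ' => x H Qx; have [j ij ->] := TmS x.
apply: (@le_trans _ _ (`|condexp mu F j (s \* \1_Q)%R x|)%:E).
  rewrite lee_fin; apply: le_trans (ler_norm _); have := H j ij.
  by rewrite indicE mem_set// mul1r.
by apply: ereal_sup_ubound; exists j.
Qed.

(** A tail condition on the sets inside Sb is a tail condition on the weights
    supported by Sb. *)
Lemma tail_test_le (i : int) (Sb : set T) (D : R) (s : T -> R) (S : int ->
  T -> R)
    (Tm : T -> R) : weight mu F s -> (forall j, nonneg_condexp mu (F j) s (S j)) ->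
  measurable_fun [set: T] Tm -> (forall x, 0 <= Tm x) ->
  (forall x, exists2 j, i <= j & Tm x = S j x) -> F i Sb -> 0 <= D ->
  (forall Q, F0 mu F i Q -> Q `<=` Sb ->
     (\int[mu]_(x in Q) tailed_doob mu F i (s \* \1_Q)%R x <= D%:E * mass mu s Q)%E) ->
  forall psi, measurable_for (F i) psi -> (forall x, 0 <= psi x) ->
    (forall x, ~ Sb x -> psi x = 0) ->
    (\int[mu]_x (psi x * Tm x)%:E <= D%:E * \int[mu]_x (psi x * s x)%:E)%E.
Proof.
move=> ws cS mTm Tm0 TmS FSb D0 H psi mpsi psi0 psiSb.
have ms := weight_measurable ws; have s0 := weight_ge0 ws.
have mSb := FT FSb.
have mpsiT := measurable_for_measurable (@FT i) mpsi.
have psiE (f : T -> R) x : psi x * f x = psi x * (\1_Sb x * f x).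
  rewrite indicE; case: (boolP (x \in Sb)) => [_|/negP xS]; first by rewrite mul1r.
  by rewrite psiSb ?mul0r// => Sx; apply: xS; rewrite inE.
have [G exG] := filtration_exhausting hF i.
have mU : measurable_fun [set: T] (fun x => \1_Sb x * Tm x).
  by apply: measurable_funM => //; exact: measurable_indic.
have mW : measurable_fun [set: T] (fun x => D * (\1_Sb x * s x)).
  by apply: measurable_funM => //; apply: measurable_funM => //; exact: measurable_indic.
have U0 x : 0 <= \1_Sb x * Tm x :> R by rewrite mulr_ge0.
have W0 x : 0 <= D * (\1_Sb x * s x) by rewrite !mulr_ge0.
rewrite -ge0_integralZl_real//; last 2 first.
- exact: measurable_funM.
- by move=> x; rewrite mulr_ge0.
rewrite (_ : (\int[mu]_x (psi x * Tm x)%:E)%E =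
  (\int[mu]_x (psi x * (\1_Sb x * Tm x))%:E)%E); last first.
  by apply: eq_integral => x _; rewrite psiE.
rewrite (_ : (\int[mu]_x (D * (psi x * s x))%:E)%E =
  (\int[mu]_x (psi x * (D * (\1_Sb x * s x)))%:E)%E); last first.
  by apply: eq_integral => x _; rewrite psiE mulrCA.
apply: (le_integral_test (@FT i)) => //.
apply: (le_integral_exhausting (@FT i) exG) => // Q AQ finQ.
have onSb (f : T -> R) : (\int[mu]_(x in Q) (\1_Sb x * f x)%:E =
    \int[mu]_(x in Q `&` Sb) (f x)%:E)%E.
  rewrite [RHS]integral_mkcondr; apply: eq_integral => x _.
  by rewrite patchE indicE; case: ifPn; rewrite (mul1r, mul0r).
have FQSb : F0 mu F i (Q `&` Sb).
  split; first by rewrite -FE; apply: generated_setI => //; rewrite FE.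
  apply: le_lt_trans finQ; apply: le_measure; rewrite ?inE//.
  - by apply: measurableI => //; exact: (generated_measurable (@FT i)).
  - exact: (generated_measurable (@FT i)).
rewrite onSb; apply: (le_trans (tail_integral_le ws cS mTm Tm0 TmS FQSb)).
apply: (le_trans (H _ FQSb (@subIsetr _ _ _))).
under [leRHS]eq_integral do rewrite EFinM.
rewrite ge0_integralZl//; last 3 first.
- exact: (generated_measurable (@FT i)).
- apply/measurable_EFinP; apply: measurable_funTS; apply: measurable_funM => //.
- by move=> x _; rewrite lee_fin mulr_ge0.
by rewrite onSb.
Qed.

Lemma running_max_attained (X : nat -> T -> R) n x :
  exists2 k, (k <= n)%N & running_max X n x = X k x.
Proof.
elim: n => [|n [k kn E]]; first by exists 0%N.
have [->|[j [<-] ->]] := running_max_new X n.+1 x; first by exists n.+1.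
by exists k => //; exact: leqW.
Qed.

Section shifted.
Variable N : nat.
Let A n := F (n%:Z - N%:Z).

Lemma shifted_measurable n : A n `<=` measurable. Proof. exact: FT. Qed.

Lemma shifted_mono n : A n `<=` A n.+1.
Proof. by apply: filtration_mono; rewrite lerD2r lez_nat. Qed.

End shifted.

Proposition opnorm_le_geometric (v w : T -> R) (B : R) :
  weight mu F v -> weight mu F w -> {ae mu, forall x, 0 < w x} ->
  weight mu F (dual_weight p w) -> Bp_bound mu F p v w B ->
  (opnorm mu p w v (doob mu F) <=
   ((2 * p * B * (2 * (2 / (2 - 1))) `^ 2 * (2 * (p / (p - 1))) `^ p) `^ p^-1)%:E)%E.
Proof.
move=> wv ww wpos ws [B0 BP].
have mv := weight_measurable wv; have v0 := weight_ge0 wv.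
have ms := weight_measurable ws; have s0 := weight_ge0 ws.
have spos : {ae mu, forall x, 0 < dual_weight p w x}.
  by apply: filterS wpos => x; exact: dual_weight_gt0.
have [S [S0 cS eS]] := weight_positive_versions ws spos.
have [V cV eV] := weight_versions wv.
have ms2 : measurable_fun [set: T] (fun x => dual_weight p w x `^ 2^-1).
  exact: measurable_fun_powR.
have /choice[Y YP] : forall i, exists Y, (forall x, 0 < Y x) /\
    nonneg_condexp mu (F i) (fun x => dual_weight p w x `^ 2^-1) Y.
  move=> i.
  have [X cX] : exists X, nonneg_condexp mu (F i) (fun x => dual_weight p w x `^ 2^-1) X.
    apply: (nonneg_condexp_exists_filtration hF) => // [x|E FE']; first exact: powR_ge0.
    have mE : measurable E by apply: (@FT i); case: FE'.
    apply: (@le_lt_trans _ _ (\int[mu]_(x in E) (1 + dual_weight p w x)%:E)%E).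
      apply: ge0_le_integral => //.
      - by move=> x _; rewrite lee_fin powR_ge0.
      - by apply/measurable_EFinP; exact: measurable_funTS.
      - by apply/measurable_EFinP; apply: measurable_funTS; exact: measurable_funD.
      - move=> x _; rewrite lee_fin.
        have : (dual_weight p w x `^ 2^-1) ^+ 2 = dual_weight p w x.
          by rewrite -powR_mulrn ?powR_ge0// -powRrM mulVf// powRr1.
        have := powR_ge0 (dual_weight p w x) 2^-1.
        move: (dual_weight p w x `^ 2^-1) => t t0 <-.
        have := sqr_ge0 (t - 1); rewrite !expr2; nra.
    under eq_integral do rewrite EFinD.
    rewrite ge0_integralD//; last 2 first.
    - by move=> x _; rewrite lee_fin.
    - by apply/measurable_EFinP; exact: measurable_funTS.
    rewrite integral_cst// mul1e lte_add_pinfty//; first by case: FE'.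
    exact: weight_lty ws FE'.
  have [||Z [Z0 cZ _]] := positive_version ms2 _ _ cX.
  - by move=> x; exact: powR_ge0.
  - by apply: filterS spos => x; exact: powR_gt0.
  by exists Z.
apply: opnorm_le_of_horizons => //.
  by rewrite !mulr_ge0 ?powR_ge0// ltW.
move=> g X mg g0 cX N.
have [G exG] := filtration_exhausting hF (0%N%:Z - N%:Z).
have Gfin k : (\int[mu]_(x in G k) (dual_weight p w x)%:E < +oo)%E.
  by apply: (weight_lty ws); exact: (F0_exhausting hF k exG).
apply: (maximal_geometric_bound (@shifted_measurable N) (@shifted_mono N)
  ms s0 mg g0 mv v0 (fun n => cS (n%:Z - N%:Z)) (fun n => S0 (n%:Z - N%:Z))
  (fun n => cX (n%:Z - N%:Z)) (fun n => cV (n%:Z - N%:Z)) exG Gfin p1 (N + N) B0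
  (fun n => proj2 (YP (n%:Z - N%:Z)))).
move=> n; set i := n%:Z - N%:Z.
have [Y0 cY] := YP i.
have eY := expectation_log_le hF ms s0 spos Y0 cY.
have eSV : {ae mu, forall x, condexp mu F i (dual_weight p w) x = S i x /\
    condexp mu F i v x = V i x} by apply: filterS2 (eS i) (eV i).
apply: filterS3 eSV eY (BP i) => x [Sx Vx] Yx; rewrite Sx Vx => H.
have : ((V i x * S i x `^ p)%:E <= B%:E * (Y i x ^+ 2)%:E)%E.
  by apply: (le_trans H); rewrite lee_wpmul2l// lee_fin ltW.
by rewrite -EFinM lee_fin.
Qed.

(** [maximal_tail_bound] for the times -N, ..., N, the tails being maxima over
    the times between n and N. *)
Lemma maximal_tail_horizon (v s g : T -> R) (S X V : int -> T -> R) N L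
    (a D : nat -> R) (Sb : nat -> int -> set T) :
  weight mu F v -> weight mu F s ->
  (forall i x, 0 < S i x) -> (forall i, nonneg_condexp mu (F i) s (S i)) ->
  (forall i, nonneg_condexp mu (F i) v (V i)) ->
  measurable_fun [set: T] g -> (forall x, 0 <= g x) ->
  (forall i, nonneg_condexp mu (F i) (fun x => g x * s x) (X i)) ->
  (forall l, 0 <= a l) -> (forall l, 0 <= D l) -> (forall l i, F i (Sb l i)) ->
  (forall l i Q, F0 mu F i Q -> Q `<=` Sb l i ->
     (\int[mu]_(x in Q) tailed_doob mu F i (s \* \1_Q)%R x <=
      (D l)%:E * mass mu s Q)%E) ->
  (forall i, {ae mu, forall x, V i x * S i x `^ (p - 1) <=
     \sum_(l < L) a l * \1_(Sb l i) x}) ->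
  (\int[mu]_x (horizon_max X N x `^ p * v x)%:E <=
   (2 * p * (2 * (p / (p - 1))) `^ p * \sum_(l < L) a l * D l)%:E *
     \int[mu]_x (g x `^ p * s x)%:E)%E.
Proof.
move=> wv ws S0 cS cV mg g0 cX a0 D0 FSb tail aeV.
have mv := weight_measurable wv; have v0 := weight_ge0 wv.
have ms := weight_measurable ws; have s0 := weight_ge0 ws.
have [G exG] := filtration_exhausting hF (0%N%:Z - N%:Z).
(* Only the times up to N + N count; beyond, the subtraction gives 0. *)
pose Tm n x := running_max (fun k => S ((n + k)%N%:Z - N%:Z)) (N + N - n) x.
have mS j : measurable_fun [set: T] (S j).
  by have [mS _ _] := cS j; exact: (measurable_for_measurable (@FT j)).
have mTm n : measurable_fun [set: T] (Tm n).
  rewrite /Tm; elim: (N + N - n)%N => [|k IH]; first exact: mS.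
  by apply: measurable_maxr => //; exact: mS.
have Tm0 n x : 0 <= Tm n x by apply: running_max_ge0 => k; exact: ltW.
have Gfin k : (\int[mu]_(x in G k) (s x)%:E < +oo)%E.
  by apply: (weight_lty ws); exact: (F0_exhausting hF k exG).
apply: (maximal_tail_bound (@shifted_measurable N) (@shifted_mono N)
  ms s0 mg g0 mv v0 (fun n => cS (n%:Z - N%:Z)) (fun n => S0 (n%:Z - N%:Z))
  (fun n => cX (n%:Z - N%:Z)) (fun n => cV (n%:Z - N%:Z)) exG Gfin p1
  (Sb := fun l n => Sb l (n%:Z - N%:Z)) (Tm := Tm)) => //.
- by move=> l n; rewrite FE.
- move=> n k x /andP[nk kM].
  have -> : S (k%:Z - N%:Z) x = S ((n + (k - n))%N%:Z - N%:Z) x by rewrite subnKC.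
  apply: (@le_running_max_of _ _ (fun k => S ((n + k)%N%:Z - N%:Z))).
  exact: leq_sub2r.
- move=> l n psi _ mpsi psi0 psiSb.
  apply: (tail_test_le ws cS (mTm n) (Tm0 n) _ (FSb l (n%:Z - N%:Z)) (D0 l) (tail l _)) => //.
  move=> x; have [k _ E] := running_max_attained (fun k => S ((n + k)%N%:Z - N%:Z)) (N + N - n) x.
  by exists ((n + k)%N%:Z - N%:Z) => //; rewrite lerD2r lez_nat leq_addr.
Qed.

Lemma Ap_productE (v w : T -> R) (V S : int -> T -> R) (C : R) :
  (forall i, {ae mu, forall x, condexp mu F i v x = V i x}) ->
  (forall i, {ae mu, forall x, condexp mu F i (dual_weight p w) x = S i x}) ->
  Ap_bound mu F p v w C ->
  forall i, {ae mu, forall x, V i x * S i x `^ (p - 1) <= C}.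
Proof.
move=> eV eS [_ AP] i.
have pE : p / conj_exponent p = p - 1.
  by rewrite /conj_exponent invfM invrK mulrA divff ?mul1r// gt_eqF.
apply: filterS3 (eV i) (eS i) AP => x Vx Sx; rewrite pE => H.
rewrite -lee_fin; apply: le_trans H; apply: ereal_sup_ubound.
by exists i => //; rewrite Vx Sx.
Qed.

Proposition opnorm_le_Ap_Ainfty (v w : T -> R) (C D : R) :
  weight mu F v -> weight mu F w -> {ae mu, forall x, 0 < w x} ->
  weight mu F (dual_weight p w) -> Ap_bound mu F p v w C ->
  Ainfty_bound mu F (dual_weight p w) D ->
  (opnorm mu p w v (doob mu F) <=
   ((2 * p * (2 * (p / (p - 1))) `^ p * (C * D)) `^ p^-1)%:E)%E.
Proof.
move=> wv ww wpos ws AC [D0 AD].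
have spos : {ae mu, forall x, 0 < dual_weight p w x}.
  by apply: filterS wpos => x; exact: dual_weight_gt0.
have [S [S0 cS eS]] := weight_positive_versions ws spos.
have [V cV eV] := weight_versions wv.
have [C0 _] := AC.
apply: opnorm_le_of_horizons => //.
  by rewrite !mulr_ge0 ?powR_ge0// ltW.
move=> g X mg g0 cX N.
have -> : C * D = \sum_(l < 1) C * D by rewrite big_ord1.
apply: (maximal_tail_horizon N (L := 1) (a := fun=> C) (D := fun=> D)
  (Sb := fun _ _ => [set: T]) wv ws S0 cS cV mg g0 cX).
- by move=> _; exact: ltW.
- by move=> _; exact: ltW.
- by move=> _ i; rewrite -FE; exact: (@measurableT _ (g_sigma_algebraType (F i))).
- by move=> _ i Q FQ _; exact: AD.
move=> i; apply: filterS (Ap_productE eV eS AC i) => x H.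
by rewrite big_ord1 indicE mem_set// mulr1.
Qed.

End two_weight_bounds.

(** * The mixed bound *)

Section mixed_bound.
Context {d : measure_display} {T : measurableType d} {R : realType}.
Variable mu : {measure set T -> \bar R}.
Variable F : int -> set (set T).
Hypothesis hF : sigma_finite_filtration mu F.
Variable p : R.
Hypothesis p1 : 1 < p.

Let FT i : F i `<=` measurable. Proof. exact: (filtration_measurable hF). Qed.
Let p0 : 0 < p. Proof. exact: lt_trans p1. Qed.
Let FE i : <<s F i >> = F i. Proof. exact: (filtration_sigmaE hF). Qed.

Lemma ae_witness (Q : set T) (P : T -> Prop) : measurable Q -> (0 < mu Q)%E ->
  {ae mu, forall x, P x} -> exists2 x, Q x & P x.
Proof.
move=> mQ Qpos [N [mN N0 subN]]; apply: contrapT => nex.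
have QN : Q `<=` N.
  by move=> x Qx; apply: subN => /= Px; apply: nex; exists x.
have : (mu Q <= mu N)%E by apply: le_measure; rewrite ?inE.
by rewrite N0 leNgt Qpos.
Qed.

Lemma dyadic_level (a : R) : 1 <= a -> exists l : nat, 2 ^+ l <= a < 2 ^+ l.+1.
Proof.
move=> a1; pose n := Num.trunc a.
have [na an] : n%:R <= a /\ a < n.+1%:R.
  by split; [rewrite truncn_le// (le_trans ler01)|exact: truncnS_gt].
have n0 : (0 < n)%N by rewrite truncn_gt0.
exists (trunc_log 2 n); apply/andP; split.
  apply: le_trans na; rewrite -natrX ler_nat; exact: trunc_logP.
apply: (lt_le_trans an); rewrite -natrX ler_nat; exact: trunc_log_ltn.
Qed.

Lemma mixed_const_ge0 (w : T -> R) : (0 <= mixed_const mu F p w)%E.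
Proof. by apply: ereal_sup_ubound; left. Qed.

(** On Q the product of the averages is at least 2^l, hence so is the essential
    supremum that the mixed constant multiplies with the tail ratio of Q. *)
Lemma mixed_tail (w : T -> R) (W S : int -> T -> R) (m : R) i Q (l : nat) :
  weight mu F w -> {ae mu, forall x, 0 < w x} -> weight mu F (dual_weight p w) ->
  (forall i, {ae mu, forall x, condexp mu F i w x = W i x}) ->
  (forall i, {ae mu, forall x, condexp mu F i (dual_weight p w) x = S i x}) ->
  mixed_const mu F p w = m%:E ->
  F0 mu F i Q -> (forall x, Q x -> 2 ^+ l <= W i x * S i x `^ (p - 1)) ->
  (\int[mu]_(x in Q) tailed_doob mu F i (dual_weight p w \* \1_Q)%R x <=
   (m `^ p / 2 ^+ l)%:E * mass mu (dual_weight p w) Q)%E.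
Proof.
move=> ww wpos ws eW eS mixE FQ Ql.
set s := dual_weight p w in ws eS *.
have ms := weight_measurable ws; have s0 := weight_ge0 ws.
have m0 : 0 <= m by have := mixed_const_ge0 w; rewrite mixE lee_fin.
have mQ : measurable Q by apply: (@FT i); case: FQ.
have tailed0 x : (0 <= tailed_doob mu F i (s \* \1_Q)%R x)%E.
  apply: (@le_trans _ _ (`|condexp mu F i (s \* \1_Q)%R x|)%:E).
    by rewrite lee_fin.
  by apply: ereal_sup_ubound; exists i => /=.
have mass0 : (0 <= mass mu s Q)%E by apply: integral_ge0 => x _; rewrite lee_fin.
have RHS0 : (0 <= (m `^ p / 2 ^+ l)%:E * mass mu s Q)%E.
  by rewrite mule_ge0 ?lee_fin// divr_ge0 ?powR_ge0// exprn_ge0.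
have [Q0|Qpos] := leP (mu Q) 0%E.
  apply: le_trans RHS0; rewrite -[leRHS](integral0 mu Q).
  apply: ae_le_integral_right => //.
  exists Q; split => //; first by apply/eqP; rewrite eq_le Q0 measure_ge0.
  by move=> x /= H; apply: contrapT => nQ; apply: H.
have spos : {ae mu, forall x, 0 < s x}.
  by apply: filterS wpos => x; exact: dual_weight_gt0.
have masspos : (0 < mass mu s Q)%E.
  rewrite lt0e mass0 andbT; apply/eqP => M0.
  pose P := [set x | 0 < s x].
  have mP : measurable P.
    have := measurable_fun_ltr (measurable_cst (0 : R)) ms measurableT (Y := [set true]) I.
    by rewrite setTI.
  have QP0 : mu (Q `&` P) = 0%E.
    apply: (@positive_integral_null _ _ _ mu _ (fun x => (s x)%:E)).
    - exact: measurableI.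
    - by apply/measurable_EFinP; exact: measurable_funTS.
    - by move=> x [].
    - rewrite -M0; apply: le_integral_subset => // [x _|x _]; by rewrite lee_fin.
  have nQP : {ae mu, forall x, ~ (Q `&` P) x}.
    exists (Q `&` P); split => //; first exact: measurableI.
    by move=> x /= /contrapT.
  have [x Qx [nx sx]] : exists2 x, Q x & ~ (Q `&` P) x /\ 0 < s x.
    by apply: ae_witness => //; apply: filterS2 nQP spos.
  by apply: nx; split.
have massfin : (mass mu s Q < +oo)%E by exact: weight_lty ws FQ.
set ess := ess_sup mu (fun x =>
  (condexp mu F i w x * condexp mu F i s x `^ (p - 1) * \1_Q x)%:E).
set I := (\int[mu]_(x in Q) tailed_doob mu F i (s \* \1_Q)%R x)%E.
have I0 : (0 <= I)%E by apply: integral_ge0.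
have ess_ge : ((2 ^+ l)%:E <= ess)%E.
  have H := ess_sup_ge mu (fun x =>
    (condexp mu F i w x * condexp mu F i s x `^ (p - 1) * \1_Q x)%:E).
  have [x Qx [[Hx Wx] Sx]] : exists2 x, Q x &
     (((condexp mu F i w x * condexp mu F i s x `^ (p - 1) * \1_Q x)%:E <= ess)%E
      /\ condexp mu F i w x = W i x) /\ condexp mu F i s x = S i x.
    by apply: ae_witness => //; apply: filterS3 H (eW i) (eS i).
  apply: le_trans Hx; rewrite lee_fin Wx Sx indicE mem_set// mulr1.
  exact: Ql.
have : ((ess * (I / mass mu s Q)) `^ p^-1 <= m%:E)%E.
  by rewrite -mixE; apply: ereal_sup_ubound; right; exists i, Q.
have -> : (mass mu s Q)%E = (fine (mass mu s Q))%:E.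
  by rewrite fineK// ge0_fin_numE.
have rpos : 0 < fine (mass mu s Q) by rewrite fine_gt0// masspos.
move: (fine (mass mu s Q)) rpos => r r0 {RHS0 masspos massfin mass0}.
rewrite inver gt_eqF//.
have l0 : 0 < 2 ^+ l :> R by rewrite exprn_gt0.
have rV0 : 0 < r^-1 by rewrite invr_gt0.
move=> H.
have {}H : ((2 ^+ l)%:E * (I * r^-1%:E) <= (m `^ p)%:E)%E.
  apply: (@le_trans _ _ (ess * (I * r^-1%:E))%E).
    by rewrite lee_wpmul2r// mule_ge0// lee_fin ltW.
  set Z := (ess * _)%E in H *.
  have Z0 : (0 <= Z)%E.
    rewrite mule_ge0 ?mule_ge0 ?lee_fin ?(ltW rV0)//.
    by apply: le_trans ess_ge; rewrite lee_fin ltW.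
  have -> : Z = ((Z `^ p^-1) `^ p)%E.
    by rewrite -poweRrM mulVf ?gt_eqF// poweRe1.
  rewrite -poweR_EFin; apply: gt0_ler_poweR => //; first exact: ltW.
  - by rewrite in_itv/= poweR_ge0 leey.
  - by rewrite in_itv/= lee_fin m0 leey.
case: I I0 H => [y||]//=.
- rewrite !lee_fin => y0 H; rewrite -[m `^ p / _ * _]mulrAC ler_pdivlMr//.
  rewrite -ler_pdivrMr//; apply: le_trans H; rewrite le_eqVlt; apply/orP; left.
  by apply/eqP; ring.
- by rewrite gt0_mulye ?lte_fin// gt0_muley ?lte_fin// leye_eq.
Qed.

Lemma one_le_Ap_bound (w : T -> R) C : (0 < mu [set: T])%E ->
  weight mu F w -> {ae mu, forall x, 0 < w x} -> weight mu F (dual_weight p w) ->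
  Ap_bound mu F p w w C -> 1 <= C.
Proof.
move=> mupos ww wpos ws AC.
have spos : {ae mu, forall x, 0 < dual_weight p w x}.
  by apply: filterS wpos => x; exact: dual_weight_gt0.
have [S [S0 cS eS]] := weight_positive_versions hF ws spos.
have [W [W0 cW eW]] := weight_positive_versions hF ww wpos.
have H1 := one_le_Ap_product hF p1 ww wpos ws (cW 0) (cS 0) (W0 0) (S0 0).
have H2 := Ap_productE p1 eW eS AC 0.
have [x _ [h1 h2]] : exists2 x, [set: T] x & 1 <= W 0 x * S 0 x `^ (p - 1) /\
    W 0 x * S 0 x `^ (p - 1) <= C.
  by apply: ae_witness => //; apply: filterS2 H1 H2.
exact: le_trans h1 h2.
Qed.

(** Level l consists of all points where the product is at least 2^l; the
    levels need not be disjoint, since the product at a point is dominated by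
    the term of the highest level below it. The weights 2^(l+1) and the tail
    constants m^p / 2^l multiply to 2 m^p, once for every level. *)
Proposition opnorm_le_mixed (w : T -> R) (m c : R) : weight mu F w ->
  {ae mu, forall x, 0 < w x} -> weight mu F (dual_weight p w) ->
  (forall n, exists2 C, Ap_bound mu F p w w C & C <= c + n.+1%:R^-1) -> 1 <= c ->
  mixed_const mu F p w = m%:E ->
  (opnorm mu p w w (doob mu F) <=
   ((2 * p * (2 * (p / (p - 1))) `^ p * (2 * m `^ p * (1 + log2 c))) `^ p^-1)%:E)%E.
Proof.
move=> ww wpos ws Cc c1 mixE.
have spos : {ae mu, forall x, 0 < dual_weight p w x}.
  by apply: filterS wpos => x; exact: dual_weight_gt0.
have [S [S0 cS eS]] := weight_positive_versions hF ws spos.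
have [W [W0 cW eW]] := weight_positive_versions hF ww wpos.
have m0 : 0 <= m by have := mixed_const_ge0 w; rewrite mixE lee_fin.
have ln2 : 0 < ln 2 :> R by rewrite ln_gt0// ltr1n.
have log0 : 0 <= log2 c by rewrite /log2 divr_ge0 ?ln_ge0// ler1n.
have K0 : 0 <= 2 * p * (2 * (p / (p - 1))) `^ p.
  by rewrite !mulr_ge0 ?powR_ge0// ltW.
pose L := (Num.trunc (log2 c)).+1.
have Lle : L%:R <= 1 + log2 c by rewrite -natr1 addrC lerD2l truncn_le.
have Ac i : {ae mu, forall x, W i x * S i x `^ (p - 1) <= c}.
  have : {ae mu, forall x, forall n : nat,
      W i x * S i x `^ (p - 1) <= c + n.+1%:R^-1}.
    apply: ae_foralln => n; have [C AC Cn] := Cc n.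
    by apply: filterS (Ap_productE p1 eW eS AC i) => x H; exact: le_trans H Cn.
  apply: filterS => x H; apply/ler_addgt0Pl => e e0.
  have [n ne] : exists n : nat, n.+1%:R^-1 < e.
    exists (Num.trunc e^-1); rewrite invf_plt ?posrE//; exact: truncnS_gt.
  by rewrite [leRHS]addrC; apply: le_trans (H n) _; rewrite lerD2l ltW.
apply: opnorm_le_of_horizons => //.
  by rewrite mulr_ge0// mulr_ge0 ?addr_ge0// mulr_ge0 ?powR_ge0.
move=> g X mg g0 cX N.
pose a l : R := 2 ^+ l.+1.
pose D l : R := m `^ p / 2 ^+ l.
pose Sb (l : nat) i := [set x | 2 ^+ l <= W i x * S i x `^ (p - 1)].
have aD : \sum_(l < L) a l * D l = 2 * m `^ p * L%:R.
  rewrite (eq_bigr (fun=> 2 * m `^ p)).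
    by rewrite sumr_const card_ord mulr_natr.
  by move=> l _; rewrite /a /D exprS; field; rewrite expf_neq0.
apply: (@le_trans _ _ ((2 * p * (2 * (p / (p - 1))) `^ p *
    \sum_(l < L) a l * D l)%:E *
    \int[mu]_x (g x `^ p * dual_weight p w x)%:E)%E); last first.
  rewrite lee_wpmul2r//.
    by apply: integral_ge0_real => x; rewrite mulr_ge0 ?powR_ge0// weight_ge0.
  by rewrite lee_fin ler_wpM2l// aD ler_wpM2l// mulr_ge0 ?powR_ge0.
apply: (maximal_tail_horizon hF p1 N (L := L) (a := a) (D := D) (Sb := Sb) ww ws S0 cS cW mg g0 cX).
- by move=> l; rewrite exprn_ge0.
- by move=> l; rewrite divr_ge0 ?powR_ge0// exprn_ge0.
- move=> l i; rewrite -FE; apply: measurable_for_le; first exact: measurable_for_cst.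
  have [mW _ _] := cW i; have [mS _ _] := cS i.
  by apply: measurable_forM => //; exact: measurable_for_powR.
- move=> l i Q FQ QSb.
  exact: (mixed_tail ww wpos ws eW eS mixE FQ).
move=> i.
have A1 := one_le_Ap_product hF p1 ww wpos ws (cW i) (cS i) (W0 i) (S0 i).
apply: filterS2 A1 (Ac i) => x; rewrite -/(Sb _ _).
set y := W i x * S i x `^ (p - 1) => y1 yc.
have [l /andP[ly yl]] := dyadic_level y1.
have lL : (l < L)%N.
  rewrite ltnS truncn_ge_nat// /log2 ler_pdivlMr// mulr_natl -lnXn ?ltr0n//.
  by rewrite ler_ln ?posrE ?exprn_gt0// ?(lt_le_trans ltr01)// (le_trans ly).
rewrite (bigD1 (Ordinal lL))//= {1}indicE mem_set ?mulr1//.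
apply: (le_trans (ltW yl)); rewrite lerDl.
by apply: sumr_ge0 => j _; rewrite mulr_ge0// exprn_ge0.
Qed.

End mixed_bound.

Section infima_of_constants.
Context {R : realType}.

(** Passes from all admissible constants to the smallest one; the infimum need
    not be attained. *)
Lemma le_mul_ereal_inf_poweR (x : \bar R) (K p : R) (B : set R) : 0 < p ->
  0 <= K ->
  B !=set0 -> (forall b, B b -> 0 < b) -> (0 <= x)%E ->
  (forall b, B b -> (x <= (K * b `^ p^-1)%:E)%E) ->
  (x <= K%:E * ereal_inf [set b%:E | b in B] `^ p^-1)%E.
Proof.
move=> p0 K0 [b0 Bb0] Bpos x0 xB.
have inf0 : (0 <= ereal_inf [set b%:E | b in B])%E.
  by apply: le_ereal_inf_tmp => _ [b Bb <-]; rewrite lee_fin ltW// Bpos.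
have [KE|Kne] := eqVneq K 0.
  by have := xB _ Bb0; rewrite KE mul0r mul0e.
have Kpos : 0 < K by rewrite lt0r Kne.
case: x x0 xB => [r| |]//= r0 rB; last by have := rB _ Bb0.
rewrite lee_fin in r0.
have rK0 : 0 <= r / K by rewrite divr_ge0.
have H : (((r / K) `^ p)%:E <= ereal_inf [set b%:E | b in B])%E.
  apply: le_ereal_inf_tmp => _ [b Bb <-]; rewrite lee_fin.
  have := rB _ Bb; rewrite lee_fin mulrC -ler_pdivrMr// => rb.
  have := le_powR (ltW p0) rK0 rb.
  by rewrite -powRrM mulVf ?gt_eqF// powRr1// ltW// Bpos.
have {}H : ((r / K)%:E <= ereal_inf [set b%:E | b in B] `^ p^-1)%E.
  have -> : (r / K)%:E = (((r / K) `^ p)%:E `^ p^-1)%E.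
    by rewrite poweR_EFin -powRrM divff ?gt_eqF// powRr1.
  apply: gt0_ler_poweR; rewrite ?invr_ge0 ?(ltW p0)//.
  - by rewrite in_itv/= lee_fin powR_ge0 leey.
  - by rewrite in_itv/= inf0 leey.
have -> : r%:E = (K%:E * (r / K)%:E)%E by rewrite -EFinM mulrC divfK.
by rewrite lee_wpmul2l.
Qed.

End infima_of_constants.

Lemma opnorm_ge0 d (T : measurableType d) (R : realType)
    (mu : {measure set T -> \bar R}) (p : R) (w v : T -> R)
    (N : (T -> R) -> T -> \bar R) : (0 <= opnorm mu p w v N)%E.
Proof. by apply: le_ereal_inf_tmp => _ [C [C0 _] <-]; rewrite lee_fin. Qed.

Unset Implicit Arguments.
Set Strict Implicit.

Theorem theorem1p7 (R : realType) (p : R) (hp : 1 < p) :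
  exists2 K : R, 0 < K &
  forall (d : measure_display) (T : measurableType d)
    (mu : {sigma_finite_measure set T -> \bar R}) (F : int -> set (set T))
    (v omega : T -> R),
    sigma_finite_filtration mu F ->
    weight mu F v -> weight mu F omega ->
    {ae mu, forall x, 0 < omega x} ->
    weight mu F (dual_weight p omega) ->
    [/\ Bp mu F p v omega ->
          (opnorm mu p omega v (doob mu F) <=
             K%:E * Bp_const mu F p v omega `^ p^-1)%E,
        Ap mu F p v omega -> Ainfty mu F (dual_weight p omega) ->
          (opnorm mu p omega v (doob mu F) <=
             K%:E * (Ap_const mu F p v omega `^ p^-1 *
                     Ainfty_const mu F (dual_weight p omega) `^ p^-1))%E
      & Ap mu F p omega omega ->
          (opnorm mu p omega omega (doob mu F) <=
             K%:E * (mixed_const mu F p omega *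
               ((1 + log2 (fine (Ap_const mu F p omega omega))) `^ p^-1)%:E))%E].
Proof.
have p0 : 0 < p by apply: lt_trans hp.
pose K1 := (2 * (p / (p - 1))) `^ p; pose K2 : R := (2 * (2 / (2 - 1))) `^ 2.
have K10 : 0 < K1.
  by apply: powR_gt0; rewrite mulr_gt0// divr_gt0// subr_gt0.
have K21 : 2 <= K2.
  rewrite /K2 (_ : 2 * (2 / (2 - 1)) = 4); last by field.
  by rewrite powR_mulrn// expr2 -natrM ler_nat.
have K20 : 0 < K2 by apply: lt_le_trans K21.
pose K0 := 2 * p * K1 * K2.
have K00 : 0 < K0 by rewrite !mulr_gt0.
have KP x y : 0 <= x -> x <= K0 * y -> 0 <= y ->
    x `^ p^-1 <= K0 `^ p^-1 * y `^ p^-1.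
  move=> x0 xy y0; rewrite -powRM ?(ltW K00)//.
  by apply: le_powR => //; rewrite invr_ge0 ltW.
have KP0 : 0 < K0 `^ p^-1 by exact: powR_gt0.
have pV0 : 0 <= p^-1 by rewrite invr_ge0 ltW.
exists (K0 `^ p^-1) => // d T mu F v w hF wv ww wpos ws; split.
- move=> [B BP]; apply: le_mul_ereal_inf_poweR => //.
  + exact: ltW.
  + by exists B.
  + by move=> b [].
  + exact: opnorm_ge0.
  move=> b Bb; have [b0 _] := Bb.
  apply: (le_trans (opnorm_le_geometric hF hp wv ww wpos ws Bb)).
  rewrite lee_fin; apply: KP => //; last exact: ltW.
    by rewrite !mulr_ge0 ?powR_ge0// ltW.
  by rewrite le_eqVlt; apply/orP; left; apply/eqP; rewrite -/K1 -/K2 /K0; ring.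
- move=> [A AA] [D DD].
  have inf0 (B : set R) : (forall b, B b -> 0 < b) -> B !=set0 ->
      exists2 r : R, 0 <= r & ereal_inf [set b%:E | b in B] = r%:E.
    move=> Bpos [b Bb].
    have h0 : (0 <= ereal_inf [set b%:E | b in B])%E.
      by apply: le_ereal_inf_tmp => _ [c Bc <-]; rewrite lee_fin ltW// Bpos.
    have hb : (ereal_inf [set b%:E | b in B] <= b%:E)%E.
      by apply: ereal_inf_lbound; exists b.
    case: ereal_inf h0 hb => [r| |]// r0 _; exists r => //.
  have AD a e : Ap_bound mu F p v w a -> Ainfty_bound mu F (dual_weight p w) e ->
      (opnorm mu p w v (doob mu F) <= (K0 `^ p^-1 * e `^ p^-1 * a `^ p^-1)%:E)%E.
    move=> Aa De; have [a0 _] := Aa; have [e0 _] := De.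
    apply: (le_trans (opnorm_le_Ap_Ainfty hF hp wv ww wpos ws Aa De)).
    rewrite lee_fin -[leRHS]mulrA -powRM ?(ltW a0) ?(ltW e0)// -/K1.
    have ae0 : 0 <= a * e by rewrite mulr_ge0 ?(ltW a0) ?(ltW e0).
    have C0 : 0 <= 2 * p * K1 by rewrite !mulr_ge0 ?(ltW p0) ?(ltW K10).
    rewrite (mulrC e); apply: KP => //; first exact: mulr_ge0.
    rewrite /K0 ler_wpM2r// ler_peMr//; apply: le_trans K21; by rewrite ler1n.
  have [a a0 aE] := inf0 (Ap_bound mu F p v w) (fun b => @proj1 _ _) (ex_intro _ A AA).
  rewrite muleA {1}/Ap_const aE poweR_EFin -EFinM.
  apply: le_mul_ereal_inf_poweR => //.
  + by rewrite mulr_ge0 ?powR_ge0.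
  + by exists D.
  + by move=> b [].
  + exact: opnorm_ge0.
  move=> e De.
  have := @le_mul_ereal_inf_poweR _ (opnorm mu p w v (doob mu F))
    (K0 `^ p^-1 * e `^ p^-1) p (Ap_bound mu F p v w).
  rewrite aE poweR_EFin -EFinM mulrAC; apply => //.
  + by rewrite mulr_ge0 ?powR_ge0.
  + by exists A.
  + by move=> b [].
  + exact: opnorm_ge0.
  + by move=> b Ab; exact: AD.
move=> [A AA].
have mix0 := mixed_const_ge0 mu F p w.
have L0 c : 0 <= ((1 + log2 c) `^ p^-1 : R) by exact: powR_ge0.
(* When mu = 0 the A_p constant is 0 and carries no information. *)
have [muT0|mupos] := leP (mu [set: T]) 0%E.
  have muT : mu [set: T] = 0%E by apply/eqP; rewrite eq_le muT0 measure_ge0.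
  apply: (@le_trans _ _ (0 `^ p^-1)%:E).
    apply: (opnorm_le hp (weight_ge0 ww) (weight_ge0 ww)) => // f _.
    rewrite mul0e -[leRHS](integral0 mu [set: T]).
    apply: ae_le_integral_right => //.
      by move=> x _; rewrite mule_ge0 ?poweR_ge0// lee_fin (weight_ge0 ww).
    by exists [set: T]; split.
  rewrite powR0 ?gt_eqF ?invr_gt0//.
  by rewrite !mule_ge0 ?lee_fin ?(ltW KP0).
have C1 C : Ap_bound mu F p w w C -> 1 <= C.
  exact: one_le_Ap_bound.
pose c := fine (Ap_const mu F p w w).
have cE : Ap_const mu F p w w = c%:E.
  rewrite /c fineK// fin_numE; apply/andP; split.
    apply/eqP => E; have : (1%:E <= Ap_const mu F p w w)%E.
      by apply: le_ereal_inf_tmp => _ [C AC <-]; rewrite lee_fin C1.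
    by rewrite E.
  apply/eqP => E; have : (Ap_const mu F p w w <= A%:E)%E.
    by apply: ereal_inf_lbound; exists A.
  by rewrite E.
have c1 : 1 <= c.
  rewrite -lee_fin -cE.
  by apply: le_ereal_inf_tmp => _ [C AC <-]; rewrite lee_fin C1.
have ln2 : 0 < ln 2 :> R by rewrite ln_gt0// ltr1n.
have log0 : 0 <= log2 c by rewrite /log2 divr_ge0 ?ln_ge0// ler1n.
rewrite -/c.
have Lpos : 0 < (1 + log2 c) `^ p^-1 by apply: powR_gt0; rewrite ltr_pwDl.
case mE : (mixed_const mu F p w) mix0 => [m| |]// m0; last first.
  by rewrite gt0_mulye ?lte_fin// gt0_muley ?lte_fin// leey.
rewrite lee_fin in m0.
have Cc n : exists2 C, Ap_bound mu F p w w C & C <= c + n.+1%:R^-1.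
  have : (Ap_const mu F p w w < (c + n.+1%:R^-1)%:E)%E.
    by rewrite cE lte_fin ltrDl invr_gt0.
  by move=> /ereal_inf_lt[_ [C AC <-]]; rewrite lte_fin => /ltW; exists C.
apply: (le_trans (opnorm_le_mixed hF hp ww wpos ws Cc c1 mE)).
rewrite -/K1 -!EFinM lee_fin.
have -> : m * (1 + log2 c) `^ p^-1 = (m `^ p * (1 + log2 c)) `^ p^-1.
  rewrite powRM ?powR_ge0 ?addr_ge0// -powRrM divff ?gt_eqF// powRr1//.
apply: KP.
- by rewrite !mulr_ge0 ?powR_ge0 ?addr_ge0 ?(ltW K10) ?(ltW p0).
- rewrite /K0 -[2 * m `^ p * _]mulrA mulrA ler_wpM2r ?mulr_ge0 ?powR_ge0 ?addr_ge0//.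
  by rewrite ler_wpM2l ?mulr_ge0 ?(ltW K10) ?(ltW p0).
- by rewrite mulr_ge0 ?powR_ge0 ?addr_ge0.
Qed.
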